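(* Let $(M,g,\lambda)$ be a Lorentzian manifold with a null-distribution $\lambda$, and let $P(M,g,\lambda)$ be the associated $GN$-structure. Then $$\mathfrak{g}_{(g,\lambda)}=aut[P(M,g,\lambda)],$$ where $\mathfrak{g}_{(g,\lambda)}$ is the Lie algebra of algebra preserving nil-Killing vector fields with respect to $\lambda$ and $aut[P(M,g,\lambda)]$ is the Lie algebra of infinitesimal automorphisms of the $GN$-structure $P(M,g,\lambda)$.
   Context: **The group $GN$.** On $\mathbb{R}^n$, $n=\dim M$, rename the standard basis $\{k,l,m_1,\dots,m_{n-2}\}$ and let $\eta$ be the Minkowski inner product with $\eta(k,l)=1$, $\eta(m_i,m_j)=\delta_{ij}$ and all other products of basis vectors zero. $GN\subset GL(n,\mathbb{R})$ is the Lie group of invertible linear maps $f$ with (1) $f(k)\in\mathbb{R}k$; (2) $\eta(f(w),f(\tilde w))=\eta(w,\tilde w)$ for all $w,\tilde w\in\{k\}^\perp$; (3) $\eta(f(k),f(z))=\eta(k,z)$ for all $z\in\mathbb{R}^n$. A $GN$-structure on $M$ is a principal $GN$-subbundle of the frame bundle of $M$; a frame $u:\mathbb{R}^n\to T_xM$ is written $(X,Y,Z_i)=(u(k),u(l),u(m_i))$. **The $GN$-structure $P(M,g,\lambda)$.** A null-distribution $\lambda$ is a rank-one distribution consisting of $g$-null vectors. $P(M,g,\lambda)$ is the $GN$-structure whose fibre over $p$ consists of all bases $(X,Y,Z_1,\dots,Z_{n-2})$ of $T_pM$ with $X\in\lambda_p$, $Z_i\in\lambda_p^\perp$, $g(X,Y)=1$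 and $g(Z_i,Z_j)=\delta_{ij}$ (no condition is put on $g(Y,Y)$ or $g(Y,Z_i)$). **Infinitesimal automorphisms.** A diffeomorphism is an automorphism of a $GN$-structure $P$ if the action of its derivative on frames maps $P$ into itself. A vector field is an infinitesimal automorphism if its (local) flow maps preserve $P$ in this sense. **Algebra preserving nil-Killing.** A vector field $X$ is nil-Killing w.r.t. $\lambda$ if $\mathcal{L}_Xg(Y,Z)=0$ and $\mathcal{L}_Xg(W,\tilde W)=0$ for all $Y\in\lambda$, $Z\in TM$, $W,\tilde W\in\lambda^\perp$. It is algebra preserving if in addition $[X,\lambda]\subset\lambda$. $\mathfrak{g}_{(g,\lambda)}$ denotes the set of all algebra preserving nil-Killing vector fields w.r.t. $\lambda$; it is a Lie algebra. *)

(* Defs.v *)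
From HB Require Import structures.
From mathcomp Require Import all_boot all_order all_algebra.
From mathcomp Require Import all_classical all_reals.
From mathcomp Require Import topology normedtype landau derive realfun.

Set Implicit Arguments.
Unset Strict Implicit.
Unset Printing Implicit Defensive.

Import Order.TTheory GRing.Theory Num.Theory.
Import numFieldNormedType.Exports.

Local Open Scope classical_set_scope.
Local Open Scope ring_scope.

(* C^k and smooth maps between finite-dimensional normed spaces, on an open
   set U; maps are total and their values outside U are irrelevant. *)
Fixpoint Ck {R : realType} {V W : normedModType R} (k : nat) (U : set V)
    (f : V -> W) : Prop :=
  if k is k'.+1 then
    (forall x, U x -> differentiable f x) /\
    (forall v, Ck k' U (fun x => 'D_v f x))
  else forall x, U x -> {for x, continuous f}.

Definition smooth {R : realType} {V W : normedModType R} (U : set V)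
    (f : V -> W) : Prop := forall k, Ck k U f.

(* Smooth manifolds without boundary, of dimension d.+1, given by an atlas.
   The chart [i] is the partial homeomorphism [phi i : dom i -> phi i @` dom i]
   with inverse [psi i]; both are total functions with junk values elsewhere.
   [chart_at p] selects one chart around p. *)
Record manifold (R : realType) (d : nat) := Manifold {
  point :> topologicalType;
  chart : Type;
  dom : chart -> set point;
  phi : chart -> point -> 'rV[R]_d.+1;
  psi : chart -> 'rV[R]_d.+1 -> point;
  chart_at : point -> chart;
  mfd_hausdorff : hausdorff_space point;
  mfd_second_countable : @second_countable point;
  open_dom : forall i, open (dom i);
  open_cod : forall i, open (phi i @` dom i);
  phiK : forall i p, dom i p -> psi i (phi i p) = p;
  phi_continuous : forall i p, dom i p -> {for p, continuous (phi i)};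
  psi_continuous : forall i x, (phi i @` dom i) x -> {for x, continuous (psi i)};
  dom_chart_at : forall p, dom (chart_at p) p;
  transition_smooth : forall i j,
    smooth (phi i @` (dom i `&` dom j)) (phi j \o psi i) }.

Arguments dom {R d m} i _.
Arguments phi {R d m} i _.
Arguments psi {R d m} i _.
Arguments chart_at {R d m} p.

Section Calculus.
Context {R : realType} {d : nat} {M : manifold R d}.
Implicit Types (p q : M) (i j : chart M) (U : set M) (u v w : 'rV[R]_d.+1).

(* A tangent vector at p is represented by its coordinates in [chart_at p], so
   that T_pM is 'rV_d.+1 and a vector field is a function M -> 'rV_d.+1.
   [coord i p v] gives the coordinates of v : T_pM in another chart [i] around p,
   and [tvec i p w] is the vector of T_pM with coordinates w in the chart [i]. *)
Definition coord i p v : 'rV[R]_d.+1 :=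
  'd (phi i \o psi (chart_at p)) (phi (chart_at p) p) v.

Definition tvec i p w : 'rV[R]_d.+1 :=
  'd (phi (chart_at p) \o psi i) (phi i p) w.

Definition local_rep i (X : M -> 'rV[R]_d.+1) : 'rV[R]_d.+1 -> 'rV[R]_d.+1 :=
  fun x => coord i (psi i x) (X (psi i x)).

Definition smooth_field U (X : M -> 'rV[R]_d.+1) : Prop :=
  forall i, smooth (phi i @` (U `&` dom i)) (local_rep i X).

(* Derivative of f along v : T_pM. *)
Definition deriv_along (f : M -> R) p v : R :=
  'D_v (f \o psi (chart_at p)) (phi (chart_at p) p).

Definition bracket (X Y : M -> 'rV[R]_d.+1) p : 'rV[R]_d.+1 :=
  let c := chart_at p in
  'D_(X p) (local_rep c Y) (phi c p) - 'D_(Y p) (local_rep c X) (phi c p).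

(* The derivative T_pM -> T_(f p)M of f : M -> M at p. *)
Definition tangent_map (f : M -> M) p v : 'rV[R]_d.+1 :=
  'd (phi (chart_at (f p)) \o f \o psi (chart_at p)) (phi (chart_at p) p) v.

(* theta is smooth near (t, p) as a map from R * M to M. *)
Definition smooth_at2 (theta : R -> M -> M) (t : R) p : Prop :=
  exists i j, exists N : set (R * 'rV[R]_d.+1),
    [/\ open N, dom i p, N (t, phi i p),
        forall s x, N (s, x) ->
          (phi i @` dom i) x /\ dom j (theta s (psi i x)) &
        smooth N (fun z : R * 'rV[R]_d.+1 => phi j (theta z.1 (psi i z.2)))].

(* A (local) flow of X with flow domain D: an open subset of R * M whose
   time slices {t | (t, p) in D} are intervals containing 0, or empty.  The
   maximal flow is one such flow, and so is any flow on ]-e, e[ * U. *)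
Definition is_flow (X : M -> 'rV[R]_d.+1) (D : set (R * M))
    (theta : R -> M -> M) : Prop :=
  [/\ open D,
      forall t s p, D (t, p) -> 0 <= s <= t \/ t <= s <= 0 -> D (s, p),
      forall p, D (0, p) -> theta 0 p = p,
      forall t p, D (t, p) -> smooth_at2 theta t p &
      forall t p, D (t, p) ->
        is_derive t 1
          (fun s => phi (chart_at (theta t p)) (theta s p))
          (X (theta t p))].

End Calculus.

(* The basis {k, l, m_1, ..., m_n} of R^(n+2). *)
Section Indices.
Variable n : nat.
Definition idx_k : 'I_n.+2 := ord0.
Definition idx_l : 'I_n.+2 := lift ord0 ord0.
Definition idx_m (a : 'I_n) : 'I_n.+2 := lift ord0 (lift ord0 a).
End Indices.
Arguments idx_k {n}.
Arguments idx_l {n}.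

Section GN.
Context {R : realType} {n : nat}.

Definition vec_k : 'rV[R]_n.+2 := delta_mx 0 idx_k.

Definition eta (v w : 'rV[R]_n.+2) : R :=
  v 0 idx_k * w 0 idx_l + v 0 idx_l * w 0 idx_k
  + \sum_(a < n) v 0 (idx_m a) * w 0 (idx_m a).

(* A linear map f of R^(n+2) is the matrix F with f v = v *m F. *)
Definition GN : set 'M[R]_n.+2 := [set F |
  [/\ F \in unitmx,
      exists c : R, vec_k *m F = c *: vec_k,
      forall v w, eta vec_k v = 0 -> eta vec_k w = 0 ->
        eta (v *m F) (w *m F) = eta v w &
      forall w, eta (vec_k *m F) (w *m F) = eta vec_k w]].

End GN.

(* Here dim M = n + 2. *)
Section Structures.
Context {R : realType} {n : nat} (M : manifold R n.+1).
Implicit Types (p : M) (u F : 'M[R]_n.+2).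

(* A frame u : R^(n+2) -> T_pM is the invertible matrix u with u(v) = v *m u, so
   row a u is the image of the a-th basis vector and u \o F is F *m u.  A
   principal GN-subbundle of the frame bundle is a family of GN-orbits of frames
   admitting smooth local sections. *)
Record GN_structure := GNStructure {
  frames :> M -> set 'M[R]_n.+2;
  frames_unit : forall p u, frames p u -> u \in unitmx;
  frames_orbit : forall p u F, frames p u -> (frames p (F *m u) <-> GN F);
  frames_section : forall p, exists U (s : M -> 'M[R]_n.+2),
    [/\ open U, U p, forall q, U q -> frames q (s q) &
        forall a, smooth_field U (fun q => row a (s q))] }.

Definition push_frame (f : M -> M) p u : 'M[R]_n.+2 :=
  \matrix_(a < n.+2) tangent_map f p (row a u).

Definition preserves_frames (P : GN_structure) (U : set M) (f : M -> M) : Prop :=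
  forall p u, U p -> P p u -> P (f p) (push_frame f p u).

Definition aut (P : GN_structure) : set (M -> 'rV[R]_n.+2) := [set X |
  smooth_field setT X /\
  forall D theta, is_flow X D theta ->
    forall t, preserves_frames P [set p | D (t, p)] (theta t)].

(* Signature (-, +, ..., +). *)
Record lorentz_metric := LorentzMetric {
  metric :> M -> 'rV[R]_n.+2 -> 'rV[R]_n.+2 -> R;
  metric_linear : forall p v, scalar (metric p v);
  metric_sym : forall p v w, metric p v w = metric p w v;
  metric_signature : forall p, exists2 e : 'M[R]_n.+2, e \in unitmx &
    forall a b, metric p (row a e) (row b e) =
      if a == b then (if a == ord0 then -1 else 1) else 0;
  metric_smooth : forall i v w,
    smooth (phi i @` dom i)
      (fun x => metric (psi i x) (tvec i (psi i x) v) (tvec i (psi i x) w)) }.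

Record null_distribution (g : lorentz_metric) := NullDistribution {
  nulld :> M -> set 'rV[R]_n.+2;
  nulld_line : forall p, exists U (K : M -> 'rV[R]_n.+2),
    [/\ open U, U p, smooth_field U K &
        forall q, U q -> K q != 0 /\ nulld q = [set c *: K q | c in setT]];
  nulld_null : forall p v, nulld p v -> g p v v = 0 }.

Definition perp (g : lorentz_metric) (lam : M -> set 'rV[R]_n.+2) :
  M -> set 'rV[R]_n.+2 := fun p => [set w | forall v, lam p v -> g p v w = 0].

Definition lie_metric (X : M -> 'rV[R]_n.+2) (g : lorentz_metric)
    (Y Z : M -> 'rV[R]_n.+2) p : R :=
  deriv_along (fun q => g q (Y q) (Z q)) p (X p)
  - g p (bracket X Y p) (Z p) - g p (Y p) (bracket X Z p).

(* Smooth local sections of the distribution E over U. *)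
Definition section_on (E : M -> set 'rV[R]_n.+2) (U : set M)
    (Y : M -> 'rV[R]_n.+2) : Prop :=
  smooth_field U Y /\ forall q, U q -> E q (Y q).

(* The conditions on L_X g, and the inclusion [X, lam] in lam below, are tested
   on smooth sections over open sets. *)
Definition nil_killing (g : lorentz_metric) (lam : null_distribution g)
    (X : M -> 'rV[R]_n.+2) : Prop :=
  forall U, open U ->
    (forall Y Z, section_on lam U Y -> smooth_field U Z ->
       forall p, U p -> lie_metric X g Y Z p = 0) /\
    (forall W W', section_on (perp g lam) U W -> section_on (perp g lam) U W' ->
       forall p, U p -> lie_metric X g W W' p = 0).

Definition algebra_preserving (lam : M -> set 'rV[R]_n.+2)
    (X : M -> 'rV[R]_n.+2) : Prop :=
  forall U Y, open U -> section_on lam U Y ->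
    forall p, U p -> lam p (bracket X Y p).

Definition alg_nil_killing (g : lorentz_metric) (lam : null_distribution g) :
  set (M -> 'rV[R]_n.+2) := [set X |
  [/\ smooth_field setT X, nil_killing lam X & algebra_preserving lam X]].

Definition adapted_frames (g : lorentz_metric) (lam : null_distribution g) p :
  set 'M[R]_n.+2 := [set u |
  [/\ u \in unitmx,
      lam p (row idx_k u),
      forall a, perp g lam p (row (idx_m a) u),
      g p (row idx_k u) (row idx_l u) = 1 &
      forall a b, g p (row (idx_m a) u) (row (idx_m b) u) = (a == b)%:R]].

End Structures.
Section CkTheory.
Context {R : realType} {V : normedModType R}.
Implicit Types (W : normedModType R) (U : set V).

Lemma near_eq_diff {W} (f g : V -> W) x :
  (\forall y \near x, f y = g y) -> differentiable f x ->
  differentiable g x /\ ('d g x = 'd f x :> (V -> W)).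
Proof.
move=> fg df.
have H : continuous ('d f x) /\ g \o shift x = cst (g x) + 'd f x +o_ 0 id.
  split; first exact: diff_continuous.
  apply/eqaddoP => e e0.
  have /eqaddoP/(_ e e0) := diff_locally df => H.
  have fg0 : \forall h \near (0 : V), f (h + x) = g (h + x).
    by move: fg; rewrite (near_shift 0 x) => H'; near do rewrite -{1 2}[x]subr0; apply: H'.
  near=> h.
  have : `|(f \o shift x - (cst (f x) + 'd f x)) h| <= e * `|h| by near: h.
  rewrite !fctE /= (nbhs_singleton fg).
  suff -> : f (h + x) = g (h + x) by [].
  by near: h.
have E : 'd g x = 'd f x :> (V -> W).
  by apply: diff_unique; [exact: H.1|exact: H.2].
by split => //; apply/diff_locallyP; rewrite E.
Unshelve. all: by end_near. Qed.

Lemma Ck_ext {W} k U (f g : V -> W) : open U -> {in U, f =1 g} ->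
  Ck k U f -> Ck k U g.
Proof.
move=> oU; elim: k f g => [|k IH] f g fg /=.
  move=> cf x Ux; have fgx : \near x, f x = g x.
    by near=> y; apply: fg; rewrite inE; near: y; exact: open_nbhs_nbhs.
  rewrite /prop_for /continuous_at -(nbhs_singleton fgx).
  exact: cvg_trans (near_eq_cvg fgx) (cf x Ux).
have fgx x : U x -> \forall y \near x, f y = g y.
  by move=> Ux; near=> y; apply: fg; rewrite inE; near: y; exact: open_nbhs_nbhs.
case=> df cf; split=> [x Ux|v]; first by have [] := near_eq_diff (fgx x Ux) (df x Ux).
apply: IH (cf v) => x; rewrite inE => Ux; exact: near_eq_derive (fgx x Ux).
Unshelve. all: by end_near. Qed.

Lemma Ck_sub {W} k U U' (f : V -> W) : U' `<=` U -> Ck k U f -> Ck k U' f.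
Proof.
move=> UU'; elim: k f => [|k IH] f /=; first by move=> cf x /UU'/cf.
by case=> df cf; split=> [x /UU'/df //|v]; exact: IH (cf v).
Qed.

Lemma CkW {W} k U (f : V -> W) : Ck k.+1 U f -> Ck k U f.
Proof.
elim: k f => [|k IH] f; first by case=> df _ x /df; exact: differentiable_continuous.
by move=> [df cf]; split=> // v; exact: IH (cf v).
Qed.

Lemma Ck_cst {W} k U (c : W) : Ck k U (fun=> c).
Proof.
elim: k c => [|k IH] c /=; first by move=> x _; exact: cst_continuous.
split=> [x _|v]; first exact: differentiable_cst.
have -> : (fun x : V => 'D_v (fun=> c) x) = fun=> 0.
  by apply/funext => x; rewrite derive_cst.
exact: IH.
Qed.

Lemma Ck_add {W} k U (f g : V -> W) : open U ->
  Ck k U f -> Ck k U g -> Ck k U (fun x => f x + g x).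
Proof.
move=> oU; elim: k f g => [|k IH] f g /=.
  by move=> cf cg x Ux; apply: cvgD; [exact: cf|exact: cg].
move=> [df cf] [dg cg]; split=> [x Ux|v].
  by apply: differentiableD; [exact: df|exact: dg].
apply: (Ck_ext oU _ (IH _ _ (cf v) (cg v))) => x; rewrite inE => Ux.
by apply/esym/deriveD; apply: diff_derivable; [exact: df|exact: dg].
Qed.

Lemma Ck_sum {W} k U (I : Type) (r : seq I) (f : I -> V -> W) : open U ->
  (forall i, Ck k U (f i)) -> Ck k U (fun x => \sum_(i <- r) f i x).
Proof.
move=> oU cf; elim: r => [|i r IH].
  by apply: (Ck_ext oU _ (@Ck_cst W k U 0)) => x _; rewrite big_nil.
by apply: (Ck_ext oU _ (Ck_add oU (cf i) IH)) => x _; rewrite big_cons.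
Qed.

Lemma Ck_mul k U (f g : V -> R) : open U ->
  Ck k U f -> Ck k U g -> Ck k U (fun x => f x * g x).
Proof.
move=> oU; elim: k f g => [|k IH] f g.
  by move=> cf cg x Ux; apply: cvgM; [exact: cf|exact: cg].
move=> Cf Cg; have [[df cf] [dg cg]] := (Cf, Cg); split=> [x Ux|v].
  by apply: differentiableM; [exact: df|exact: dg].
have := Ck_add oU (IH _ _ (CkW Cf) (cg v)) (IH _ _ (CkW Cg) (cf v)).
apply: Ck_ext => // x; rewrite inE => Ux.
by apply/esym/deriveM; apply: diff_derivable; [exact: df|exact: dg].
Qed.

Lemma Ck_opp k U (f : V -> R) : open U -> Ck k U f -> Ck k U (fun x => - f x).
Proof.
move=> oU cf; apply: (Ck_ext oU _ (Ck_mul oU (@Ck_cst R k U (-1)) cf)) => x _.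
by rewrite mulN1r.
Qed.

Lemma Ck_inv k U (f : V -> R) : open U -> (forall x, U x -> f x != 0) ->
  Ck k U f -> Ck k U (fun x => (f x)^-1).
Proof.
move=> oU f0; elim: k => [|k IH].
  by move=> cf x Ux; apply: cvgV; [exact: f0|exact: cf].
move=> Cf; have [df cf] := Cf; split=> [x Ux|v].
  by apply: differentiableV; [exact: df|exact: f0].
have Ci := IH (CkW Cf).
have := Ck_opp oU (Ck_mul oU (Ck_mul oU Ci Ci) (cf v)).
apply: Ck_ext => // x; rewrite inE => Ux.
rewrite deriveV; [|exact: f0|by apply: diff_derivable; exact: df].
by rewrite /GRing.scale /= mulNr expr2 invfM.
Qed.

Lemma Ck_sqrt k U (f : V -> R) : open U -> (forall x, U x -> 0 < f x) ->
  Ck k U f -> Ck k U (fun x => Num.sqrt (f x)).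
Proof.
move=> oU f0; elim: k => [|k IH].
  move=> cf x Ux; apply: (@continuous_comp _ _ _ f); first exact: cf.
  exact: sqrt_continuous.
move=> Cf; have [df cf] := Cf.
have ds (y : R) : 0 < y -> differentiable (@Num.sqrt R) y.
  by move=> y0; apply/derivable1_diffP; have [] := is_derive1_sqrt y0.
split=> [x Ux|v].
  by apply: (@differentiable_comp _ _ _ _ f); [exact: df|exact/ds/f0].
have Cs := IH (CkW Cf).
have s0 x : U x -> 2 * Num.sqrt (f x) != 0.
  by move=> Ux; rewrite mulf_neq0// gt_eqF// sqrtr_gt0 f0.
have := Ck_mul oU (cf v) (Ck_inv oU s0 (Ck_mul oU (@Ck_cst R k U 2) Cs)).
apply: Ck_ext => // x; rewrite inE => Ux.
have dsx := ds _ (f0 _ Ux).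
rewrite [RHS]deriveE; last by apply: (@differentiable_comp _ _ _ _ f); [exact: df|].
rewrite (@diff_comp _ _ _ _ f) /=; [|exact: df|exact: dsx].
rewrite deriv1E /=; last by apply/derivable1_diffP.
rewrite derive1E derive_sqrt ?f0//.
by rewrite -deriveE //; exact: df.
Qed.

Lemma Ck_mxP m k U (f : V -> 'rV[R]_m.+1) : open U ->
  Ck k U f <-> forall j, Ck k U (fun x => f x 0 j).
Proof.
move=> oU.
have fE (h : V -> 'rV[R]_m.+1) : h = fun x => \sum_(j < m.+1) h x 0 j *: delta_mx 0 j.
  by apply/funext => x; rewrite -row_sum_delta.
elim: k f => [|k IH] f.
  split=> [cf j x Ux|cf].
    apply: (@continuous_comp _ _ _ f (fun N : 'rV[R]_m.+1 => N 0 j)).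
      exact: cf.
    exact: coord_continuous.
  rewrite [f]fE; apply: Ck_sum => // j x Ux.
  by apply: cvgZr_tmp; exact: cf.
split=> [[df cf] j|cf].
  split=> [x Ux|v].
    apply: (@differentiable_comp _ _ _ _ f (fun N : 'rV[R]_m.+1 => N 0 j)).
      exact: df.
    exact: differentiable_coord.
  apply: (Ck_ext oU _ ((IH _).1 (cf v) j)) => x; rewrite inE => Ux.
  rewrite derive_mx ?mxE //; exact/diff_derivable/df.
have df x : U x -> differentiable f x.
  move=> Ux; rewrite [f]fE.
  pose F j := fun x => f x 0 j *: (delta_mx 0 j : 'rV[R]_m.+1).
  have -> : (fun x => \sum_(j < m.+1) f x 0 j *: delta_mx 0 j) = \sum_(j < m.+1) F j.
    by apply/funext => y; rewrite fct_sumE.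
  by apply: differentiable_sum => j; apply: differentiableZl; exact: (cf j).1.
split=> // v; apply/IH => j.
apply: (Ck_ext oU _ ((cf j).2 v)) => x; rewrite inE => Ux.
rewrite derive_mx ?mxE //; exact/diff_derivable/df.
Qed.

End CkTheory.

Lemma diff_delta {R : realType} m {W : normedModType R} (f : 'rV[R]_m.+1 -> W) x v :
  differentiable f x -> 'd f x v = \sum_(a < m.+1) v 0 a *: 'D_(delta_mx 0 a) f x.
Proof.
move=> df; rewrite {1}(row_sum_delta v) linear_sum; apply: eq_bigr => a _.
by rewrite linearZ deriveE.
Qed.

Lemma Ck_comp {R : realType} {V : normedModType R} m k (U : set V)
  (O : set 'rV[R]_m.+1) (h : V -> 'rV[R]_m.+1) (f : 'rV[R]_m.+1 -> R) :
  open U -> open O -> (forall x, U x -> O (h x)) ->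
  Ck k U h -> Ck k O f -> Ck k U (f \o h).
Proof.
move=> oU oO UO; elim: k f => [|k IH] f.
  by move=> ch cf x Ux; apply: continuous_comp; [exact: ch|exact/cf/UO].
move=> Ch Cf; have [[dh ch] [df cf]] := (Ch, Cf); split=> [x Ux|v].
  by apply: differentiable_comp; [exact: dh|exact/df/UO].
have := fun a => Ck_mul oU ((Ck_mxP _ _ oU).1 (ch v) a)
  (IH _ (CkW Ch) (cf (delta_mx 0 a))).
move=> /(Ck_sum (index_enum _) oU); apply: Ck_ext => // x; rewrite inE => Ux.
rewrite [RHS]deriveE; last by apply: differentiable_comp; [exact: dh|exact/df/UO].
rewrite diff_comp /=; [|exact: dh|exact/df/UO].
rewrite diff_delta; last exact/df/UO.
by apply: eq_bigr => a _; rewrite -deriveE; last exact: dh.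
Qed.

Section Charts.
Context {R : realType} {d : nat} {M : manifold R d}.
Implicit Types (p q : M) (i j l : chart M) (U : set M).

Lemma psiK i (U : set M) x : (phi i @` (U `&` dom i)) x ->
  [/\ U (psi i x), dom i (psi i x) & phi i (psi i x) = x].
Proof. by move=> [p [Up ip] <-]; rewrite phiK. Qed.

Lemma open_phi i U : open U -> open (phi i @` (U `&` dom i)).
Proof.
move=> oU; rewrite openE => x Ux.
have [Up ip px] := psiK Ux.
have cx : (phi i @` dom i) x by exists (psi i x).
have n1 : \forall y \near x, (phi i @` dom i) y.
  by apply: open_nbhs_nbhs; split; [exact: open_cod|].
have n2 : \forall y \near x, U (psi i y).
  by apply: (psi_continuous cx); exact: open_nbhs_nbhs.
rewrite /interior; near=> y.
have [q iq qy] : (phi i @` dom i) y by near: y.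
have : U (psi i y) by near: y.
by rewrite -qy phiK // => Uq; exists q.
Unshelve. all: by end_near. Qed.

Lemma transition_diff i j p : dom i p -> dom j p ->
  differentiable (phi j \o psi i) (phi i p).
Proof. by move=> ip jp; apply: (transition_smooth i j 1).1; exists p. Qed.

Lemma transition_comp i j l p v : dom i p -> dom j p -> dom l p ->
  'd (phi l \o psi j) (phi j p) ('d (phi j \o psi i) (phi i p) v) =
  'd (phi l \o psi i) (phi i p) v.
Proof.
move=> ip jp lp.
have dij := transition_diff ip jp.
have E : (phi j \o psi i) (phi i p) = phi j p by rewrite /= phiK.
have djl : differentiable (phi l \o psi j) ((phi j \o psi i) (phi i p)).
  by rewrite E; exact: transition_diff.
have := diff_comp dij djl; rewrite E => C.
transitivity ('d ((phi l \o psi j) \o (phi j \o psi i)) (phi i p) v).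
  exact: (esym (congr1 (fun f => f v) C)).
suff fg : \forall y \near phi i p,
    (phi l \o psi i) y = ((phi l \o psi j) \o (phi j \o psi i)) y.
  exact: (congr1 (fun f => f v) (near_eq_diff fg (transition_diff ip lp)).2).
have o := @open_phi i (dom j) (@open_dom _ _ M j).
have xo : (phi i @` (dom j `&` dom i)) (phi i p) by exists p.
near=> y.
have /psiK[jy _ _] : (phi i @` (dom j `&` dom i)) y.
  by near: y; exact: open_nbhs_nbhs.
by rewrite /= phiK.
Unshelve. all: by end_near. Qed.

Lemma transition_id i p v : dom i p -> 'd (phi i \o psi i) (phi i p) v = v.
Proof.
move=> ip.
have di : differentiable (@id 'rV[R]_d.+1) (phi i p) by [].
have fg : \forall y \near phi i p, id y = (phi i \o psi i) y.
  have o := @open_cod _ _ M i.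
  have xo : (phi i @` dom i) (phi i p) by exists p.
  near=> y; have [q iq <-] : (phi i @` dom i) y.
    by near: y; exact: open_nbhs_nbhs.
  by rewrite /= phiK.
rewrite (congr1 (fun f => f v) (near_eq_diff fg di).2).
by rewrite (diff_val (f := id)).
Unshelve. all: by end_near. Qed.

Lemma coordK i p v : dom i p -> tvec i p (coord i p v) = v.
Proof.
by move=> ip; rewrite /tvec transition_comp ?transition_id //; exact: dom_chart_at.
Qed.

Lemma tvecK i p v : dom i p -> coord i p (tvec i p v) = v.
Proof.
by move=> ip; rewrite /coord transition_comp ?transition_id //; exact: dom_chart_at.
Qed.

Lemma smooth_field_chart i U X : open U -> U `<=` dom i ->
  smooth (phi i @` (U `&` dom i)) (local_rep i X) -> smooth_field U X.
Proof.
move=> oU Ui sX j k.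
pose tau := phi i \o psi j; pose tau' := phi j \o psi i.
pose O := phi j @` (U `&` dom j); pose O' := phi i @` ((U `&` dom j) `&` dom i).
have oU' : open (U `&` dom j) by apply: openI => //; exact: open_dom.
have [oO oO'] : open O /\ open O' by split; exact: open_phi.
have OO' x : O x -> O' (tau x).
  by move=> /psiK[Up jp px]; exists (psi j x) => //; split => //; exact: Ui.
have Ctau m : Ck m O tau.
  apply: Ck_sub (transition_smooth j i m) => x [p [Up jp] <-].
  by exists p => //; split => //; exact: Ui.
have Ctau' m a b : Ck m O' (fun y => ('D_(delta_mx 0 a) tau' y) 0 b).
  apply: (Ck_mxP _ _ oO').1.
  apply: Ck_sub ((transition_smooth i j m.+1).2 _) => x [p [[Up jp] ip] <-].
  by exists p.
have CX m a : Ck m O' (fun y => local_rep i X y 0 a).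
  apply: (Ck_mxP _ _ oO').1; apply: Ck_sub (sX m) => x [p [[Up jp] ip] <-].
  by exists p.
apply/(Ck_mxP _ _ oO) => b.
have H := fun a => Ck_comp oO oO' OO' (Ctau k) (Ck_mul oO' (CX k a) (Ctau' k a b)).
apply: Ck_ext (Ck_sum (index_enum _) oO H) => // x; rewrite inE => /psiK[Up jp px].
pose p := psi j x; have ip : dom i p := Ui _ Up.
have tx : tau x = phi i p by [].
have -> : local_rep j X x = 'd (phi j \o psi i) (phi i p) (coord i p (X p)).
  by rewrite /coord transition_comp //; exact: dom_chart_at.
rewrite diff_delta; last exact: transition_diff.
rewrite summxE; apply: eq_bigr => a _; rewrite mxE /= tx.
by rewrite /local_rep phiK.
Qed.

End Charts.

Section Bilinear.
Context {R : realType} {V : lmodType R} {T : Type}.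
Variable h : T -> V -> V -> R.
Hypothesis hlin : forall x v, scalar (h x v).
Hypothesis hsym : forall x v w, h x v w = h x w v.

Lemma hZr x v c w : h x v (c *: w) = c * h x v w.
Proof.
have h0 : h x v 0 = 0.
  have := hlin x v 1 0 0; rewrite scale1r addr0 mul1r => /eqP.
  by rewrite -[X in X == _]addr0 (inj_eq (addrI _)) eq_sym => /eqP.
by have := hlin x v c w 0; rewrite h0 !addr0.
Qed.
Lemma hDr x v w w' : h x v (w + w') = h x v w + h x v w'.
Proof. by have := hlin x v 1 w w'; rewrite scale1r mul1r. Qed.
Lemma hZl x v c w : h x (c *: v) w = c * h x v w.
Proof. by rewrite hsym hZr hsym. Qed.
Lemma hDl x v v' w : h x (v + v') w = h x v w + h x v' w.
Proof. by rewrite hsym hDr !(hsym _ w). Qed.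
Lemma h0r x v : h x v 0 = 0.
Proof. by rewrite -(scale0r 0) hZr mul0r. Qed.
Lemma hBr x v w w' : h x v (w - w') = h x v w - h x v w'.
Proof. by rewrite hDr -scaleN1r hZr mulN1r. Qed.
Lemma hBl x v v' w : h x (v - v') w = h x v w - h x v' w.
Proof. by rewrite hsym hBr !(hsym _ w). Qed.
Lemma hsumr x v (I : Type) (r : seq I) (P : pred I) (F : I -> V) :
  h x v (\sum_(i <- r | P i) F i) = \sum_(i <- r | P i) h x v (F i).
Proof. by apply: (big_morph (h x v)); [exact: hDr|exact: h0r]. Qed.
Lemma hsuml x w (I : Type) (r : seq I) (P : pred I) (F : I -> V) :
  h x (\sum_(i <- r | P i) F i) w = \sum_(i <- r | P i) h x (F i) w.
Proof. by rewrite hsym hsumr; apply: eq_bigr => i _; rewrite hsym. Qed.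

End Bilinear.

Section Gram.
Context {R : realType} {n : nat}.
Let V := 'rV[R]_n.+2.
Variable h : V -> V -> V -> R.
Hypothesis hlin : forall x v, scalar (h x v).
Hypothesis hsym : forall x v w, h x v w = h x w v.
Let hZr := hZr hlin.
Let hDr := hDr hlin.
Let hBr := hBr hlin.
Let hsumr := hsumr hlin.
Let hZl := hZl hlin hsym.
Let hBl := hBl hlin hsym.
Let hsuml := hsuml hlin hsym.

Variable O : set V.
Hypothesis oO : open O.
Hypothesis hsm : forall v w, smooth O (fun x => h x v w).

Lemma smooth_h (U : set V) (xi et : V -> V) : open U -> U `<=` O ->
  smooth U xi -> smooth U et -> smooth U (fun x => h x (xi x) (et x)).
Proof.
move=> oU UO sxi set' k.
have H a b := Ck_mul oU (Ck_mul oU ((Ck_mxP _ _ oU).1 (sxi k) a)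
  ((Ck_mxP _ _ oU).1 (set' k) b)) (Ck_sub UO (@hsm (delta_mx 0 a) (delta_mx 0 b) k)).
have H2 := Ck_sum (index_enum _) oU (fun a => Ck_sum (index_enum _) oU (H a)).
apply: (Ck_ext oU _ H2) => x _.
rewrite [in RHS](row_sum_delta (xi x)) [in RHS](row_sum_delta (et x)) hsuml.
apply: eq_bigr => a _; rewrite hsumr; apply: eq_bigr => b _.
by rewrite hZl hZr mulrA.
Qed.

Lemma smooth_scale (U : set V) (c : V -> R) (xi : V -> V) : open U ->
  smooth U c -> smooth U xi -> smooth U (fun x => c x *: xi x).
Proof.
move=> oU sc sxi k; apply/(Ck_mxP _ _ oU) => j.
apply: (Ck_ext oU _ (Ck_mul oU (sc k) ((Ck_mxP _ _ oU).1 (sxi k) j))) => x _.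
by rewrite mxE.
Qed.

Lemma smooth_sub (U : set V) (xi et : V -> V) : open U ->
  smooth U xi -> smooth U et -> smooth U (fun x => xi x - et x).
Proof.
move=> oU sc sxi k; apply/(Ck_mxP _ _ oU) => j.
have := Ck_add oU ((Ck_mxP _ _ oU).1 (sc k) j)
  (Ck_opp oU ((Ck_mxP _ _ oU).1 (sxi k) j)).
by apply: Ck_ext => // x _; rewrite !mxE.
Qed.

Lemma open_pos (U : set V) (f : V -> R) x0 : open U -> U x0 -> smooth U f ->
  0 < f x0 -> exists U', [/\ open U', U' x0, U' `<=` U & forall x, U' x -> 0 < f x].
Proof.
move=> oU Ux sf f0.
have : nbhs x0 [set x | U x /\ 0 < f x].
  near=> x; split; near: x; first exact: open_nbhs_nbhs.
  have c0 : {for x0, continuous f} := sf 0%N x0 Ux.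
  have : nbhs (f x0) [set y | 0 < y] by exact: lt_nbhsr.
  by move/c0.
rewrite nbhsE => -[U' [oU' Ux'] UU']; exists U'.
by split => // x /UU' [].
Unshelve. all: by end_near. Qed.

Variable x0 : V.
Variable kap : V -> V.
Hypothesis Ox0 : O x0.
Hypothesis skap : smooth O kap.
Hypothesis kap0 : forall x, O x -> h x (kap x) (kap x) = 0.
Hypothesis hpos : forall x w, O x -> h x (kap x) w = 0 ->
  (forall c, w <> c *: kap x) -> 0 < h x w w.

Lemma ell_exists : (exists v, h x0 (kap x0) v <> 0) ->
  exists U (ell : V -> V), [/\ open U, U x0, U `<=` O, smooth U ell &
    forall x, U x -> h x (kap x) (ell x) = 1].
Proof.
move=> [v hv].
pose f x := h x (kap x) v.
have sf : smooth O f by apply: smooth_h => //; move=> k; exact: Ck_cst.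
have [|U [oU Ux0 UO fU]] :=
    @open_pos O (fun x => f x * f x) x0 oO Ox0 (fun k => Ck_mul oO (sf k) (sf k)).
  by rewrite -expr2 exprn_even_gt0 //=; exact/eqP.
have f0 x : U x -> f x != 0 by move=> /fU; apply: contraTneq => ->; rewrite mul0r ltxx.
exists U, (fun x => (f x)^-1 *: v); split => //.
  apply: smooth_scale => //; last by move=> k; exact: Ck_cst.
  by move=> k; apply: Ck_inv => //; exact: Ck_sub (sf k).
by move=> x Ux; rewrite hZr mulVf // f0.
Qed.

Lemma new_vector m (z : nat -> V) : (m < n)%N ->
  exists w, [/\ h x0 (kap x0) w = 0, forall a, (a < m)%N -> h x0 (z a) w = 0 &
    forall c, w <> c *: kap x0].
Proof.
move=> mn.
pose y (b : 'I_m.+1) := if b == ord0 then kap x0 else z b.-1.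
pose C : 'M[R]_(n.+2, m.+1) := \matrix_(a, b) h x0 (y b) (delta_mx 0 a).
have CE w b : (w *m C) 0 b = h x0 (y b) w.
  rewrite [in RHS](row_sum_delta w) hsumr mxE; apply: eq_bigr => a _.
  by rewrite mxE hZr.
have : ~~ (kermx C <= kap x0)%MS.
  apply/negP => /mxrankS; rewrite mxrank_ker.
  move=> /leq_trans/(_ (rank_leq_row _)).
  have := rank_leq_col C.
  by rewrite leq_subLR => r1 r2; have := leq_trans r2 (leq_add r1 (leqnn 1)); 
     rewrite addn1 !ltnS leqNgt mn.
move=> /row_subPn[i /negP ni]; pose w := row i (kermx C).
have wC b : h x0 (y b) w = 0.
  by rewrite -CE /w -row_mul mulmx_ker row0 mxE.
exists w; split=> [|a am|c wc].
- exact: (wC ord0).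
- by have := wC (lift ord0 (Ordinal am)).
- by apply: ni; apply/sub_rVP; exists c.
Qed.

Lemma gram_schmidt (U : set V) (ell : V -> V) : open U -> U x0 -> U `<=` O ->
  smooth U ell -> (forall x, U x -> h x (kap x) (ell x) = 1) ->
  forall m, (m <= n)%N -> exists U' (z : nat -> V -> V),
    [/\ open U', U' x0, U' `<=` U,
        forall a, (a < m)%N -> smooth U' (z a) /\
          forall x, U' x -> h x (kap x) (z a x) = 0 &
        forall a b x, (a < m)%N -> (b < m)%N -> U' x ->
          h x (z a x) (z b x) = (a == b)%:R].
Proof.
move=> oU Ux0 UO sell hell; elim=> [|m IH] mn.
  by exists U, (fun _ => ell); split.
have [U1 [z [oU1 U1x U1U zs zz]]] := IH (ltnW mn).
have [w [kw zw wk]] := new_vector (fun a => z a x0) mn.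
have U1O : U1 `<=` O by move=> x /U1U/UO.
have sk : smooth U1 kap by move=> k; exact: Ck_sub (skap k).
have se : smooth U1 ell by move=> k; exact: Ck_sub (sell k).
have sw : smooth U1 (fun=> w) by move=> k; exact: Ck_cst.
pose w1 x := w - h x (kap x) w *: ell x.
have sw1 : smooth U1 w1.
  by apply: smooth_sub => //; apply: smooth_scale => //; exact: smooth_h.
pose w2 x := w1 x - \sum_(a < m) h x (w1 x) (z a x) *: z a x.
have sw2 : smooth U1 w2.
  apply: smooth_sub => // k; apply: Ck_sum => // a.
  by apply: smooth_scale => //; [apply: smooth_h => //|]; exact: (zs _ (ltn_ord a)).1.
have kw2 x : U1 x -> h x (kap x) (w2 x) = 0.
  move=> U1x'; rewrite /w2 /w1 !hBr hZr hell ?mulr1 ?subrr ?sub0r; last exact: U1U.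
  rewrite hsumr big1 ?oppr0 // => a _; rewrite hZr.
  by rewrite (zs _ (ltn_ord a)).2 // mulr0.
have zw2 x a : U1 x -> (a < m)%N -> h x (z a x) (w2 x) = 0.
  move=> U1x' am; rewrite /w2 hBr hsumr (bigD1 (Ordinal am)) //= hZr zz // eqxx mulr1.
  rewrite big1 ?addr0 ?(hsym _ (w1 x)) ?subrr // => b ba; rewrite hZr zz //.
  rewrite (_ : (a == b) = false) ?mulr0 //; apply/negbTE; apply: contra ba => /eqP E.
  by apply/eqP/val_inj.
have w2x0 : w2 x0 = w.
  rewrite /w2 big1 ?subr0.
    by rewrite /w1 kw scale0r subr0.
  by move=> a _; rewrite /w1 kw scale0r subr0 hsym zw // scale0r.
have [||U2 [oU2 U2x U21 pos]] :=
    @open_pos U1 (fun x => h x (w2 x) (w2 x)) x0 oU1 U1x.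
- exact: smooth_h.
- by rewrite w2x0; apply: hpos.
pose q x := (Num.sqrt (h x (w2 x) (w2 x)))^-1 *: w2 x.
have sq : smooth U2 q.
  apply: smooth_scale => //; last by move=> k; exact: Ck_sub (sw2 k).
  move=> k; apply: Ck_inv => //; first by move=> x /pos p; rewrite gt_eqF // sqrtr_gt0.
  apply: Ck_sqrt => //; apply: smooth_h => //; first by move=> x /U21/U1O.
    by move=> j; exact: Ck_sub (sw2 j).
  by move=> j; exact: Ck_sub (sw2 j).
have zq x a : U2 x -> (a < m)%N -> h x (z a x) (q x) = 0.
  by move=> U2x' am; rewrite hZr zw2 ?mulr0 //; exact: U21.
have qq x : U2 x -> h x (q x) (q x) = 1.
  move=> /pos p; rewrite hZl hZr mulrA -invfM -expr2 sqr_sqrtr ?ltW // mulVf //.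
  by rewrite gt_eqF.
exists U2, (fun a => if (a < m)%N then z a else q); split => //.
- by move=> x /U21/U1U.
- move=> a am; case: ifP => am'; split.
  + by move=> k; apply: Ck_sub ((zs a am').1 k).
  + by move=> x /U21; exact: (zs a am').2.
  + by [].
  + by move=> x Ux; rewrite hZr kw2 ?mulr0 //; exact: U21.
- have lt a : (a < m.+1)%N -> (a < m)%N = false -> a = m.
    by move=> am /negbT; rewrite -leqNgt => ma; apply/eqP; rewrite eqn_leq -ltnS am.
  move=> a b x am bm Ux; case: ifP => am'; case: ifP => bm'.
  + by apply: zz => //; exact: U21.
  + by rewrite zq // (lt b) // ltn_eqF.
  + by rewrite hsym zq // (lt a) // gtn_eqF.
  + by rewrite qq // (lt a) // (lt b) // eqxx.
Qed.

End Gram.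

Section Adapted.
Context {R : realType} {n : nat} (M : manifold R n.+1).
Variables (g : lorentz_metric M) (lam : null_distribution g).
Implicit Types (p : M) (u F : 'M[R]_n.+2) (v w : 'rV[R]_n.+2).

Let gZr := hZr (metric_linear g).
Let gDr := hDr (metric_linear g).
Let gBr := hBr (metric_linear g).
Let g0r := h0r (metric_linear g).
Let gsumr := hsumr (metric_linear g).
Let gZl := hZl (metric_linear g) (metric_sym g).
Let gBl := hBl (metric_linear g) (metric_sym g).
Let gDl := hDl (metric_linear g) (metric_sym g).
Let gsuml := hsuml (metric_linear g) (metric_sym g).

Lemma big_idx (G : nmodType) (f : 'I_n.+2 -> G) :
  \sum_a f a = f idx_k + (f idx_l + \sum_(a < n) f (idx_m a)).
Proof. by rewrite big_ord_recl big_ord_recl. Qed.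

Lemma lorentz_null_pos p k w : k != 0 -> g p k k = 0 -> g p k w = 0 ->
  (forall c, w <> c *: k) -> 0 < g p w w.
Proof.
have [e ue ge] := metric_signature g p.
have gE v v' : g p (v *m e) (v' *m e) =
    - (v 0 ord0 * v' 0 ord0) + \sum_(a < n.+1) v 0 (lift ord0 a) * v' 0 (lift ord0 a).
  rewrite !mulmx_sum_row gsuml.
  under eq_bigr => a _.
    rewrite gZl gsumr (bigD1 a) //= big1 ?addr0; last first.
      by move=> b ba; rewrite gZr ge eq_sym (negbTE ba) mulr0.
    rewrite gZr ge eqxx; over.
  rewrite big_ord_recl /=; congr (_ + _); first by rewrite mulrN1 mulrN.
  by apply: eq_bigr => a _; rewrite mulr1.
have toe v : v = (v *m invmx e) *m e by rewrite mulmxKV.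
rewrite (toe k) (toe w); set k' := k *m _; set w' := w *m _.
move=> k0 kk kw wk.
have k00 : k' 0 ord0 != 0.
  apply: contra k0 => /eqP k00; suff -> : k' = 0 by rewrite mul0mx.
  move: kk; rewrite gE k00 mul0r oppr0 add0r => /eqP.
  rewrite psumr_eq0 => [/allP kz|a _]; last by rewrite -expr2 sqr_ge0.
  apply/rowP => a; rewrite [RHS]mxE; case: (unliftP ord0 a) => [b ->|-> //].
  by have := kz b (mem_index_enum _); rewrite /= mulf_eq0 orbb => /eqP.
pose c := w' 0 ord0 / k' 0 ord0; pose r := w' - c *: k'.
have -> : g p (w' *m e) (w' *m e) = g p (r *m e) (r *m e).
  rewrite /r mulmxBl -scalemxAl gBl !gBr !gZr !gZl kk kw (metric_sym g p (w' *m e) (k' *m e)) kw.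
  by rewrite !mulr0 !subr0.
have r0 : r 0 ord0 = 0 by rewrite /r [LHS]mxE [X in _ + X]mxE [X in _ - X]mxE /c divfK // subrr.
rewrite gE r0 mul0r oppr0 add0r lt_def sumr_ge0 ?andbT; last first.
  by move=> a _; rewrite -expr2 sqr_ge0.
apply/negP; rewrite psumr_eq0 => [/allP rz|a _]; last by rewrite -expr2 sqr_ge0.
apply: (wk c); rewrite scalemxAl; congr (_ *m _).
apply/eqP; rewrite -subr_eq0 -/r; apply/eqP/rowP => a; rewrite [RHS]mxE.
case: (unliftP ord0 a) => [b ->|-> //].
by have := rz b (mem_index_enum _); rewrite /= mulf_eq0 orbb => /eqP.
Qed.

Lemma lorentz_nondeg p k : k != 0 -> exists v, g p k v <> 0.
Proof.
have [e ue ge] := metric_signature g p.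
move=> k0; apply/existsNP => gk; move/eqP: k0; apply.
rewrite -[k](mulmxKV ue); set k' := k *m _.
suff -> : k' = 0 by rewrite mul0mx.
apply/rowP => a; rewrite [RHS]mxE; apply/eqP.
have := gk (row a e); rewrite -[k](mulmxKV ue) -/k' mulmx_sum_row gsuml (bigD1 a) //=.
rewrite big1 ?addr0; last by move=> b ba; rewrite gZl ge (negbTE ba) mulr0.
rewrite gZl ge eqxx => /eqP; rewrite mulf_eq0 => /orP[//|].
by case: ifP; rewrite ?oppr_eq0 oner_eq0.
Qed.

Lemma null_line p : exists2 K : 'rV[R]_n.+2, K != 0 & lam p = [set c *: K | c in setT].
Proof. by have [U [K [_ Up _ /(_ p Up)[? ?]]]] := nulld_line lam p; exists (K p). Qed.

Lemma etaE (v w : 'rV[R]_n.+2) : v 0 idx_l = 0 -> w 0 idx_l = 0 ->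
  eta v w = \sum_(a < n) v 0 (idx_m a) * w 0 (idx_m a).
Proof. by move=> v0 w0; rewrite /eta v0 w0 mulr0 mul0r !add0r. Qed.

Lemma eta_k (w : 'rV[R]_n.+2) : eta vec_k w = w 0 idx_l.
Proof.
rewrite /eta !mxE !eqxx mul1r mul0r addr0 big1 ?addr0 // => a _.
by rewrite mxE mul0r.
Qed.

Lemma eta_kZ (c : R) (w : 'rV[R]_n.+2) : eta (c *: vec_k) w = c * w 0 idx_l.
Proof.
rewrite -eta_k /eta !mulrDr mulr_sumr !mxE; congr (_ + _ + _); rewrite ?mulrA //.
by apply: eq_bigr => a _; rewrite !mxE mulrA.
Qed.

Lemma adapted_pair p u :
  lam p (row idx_k u) -> (forall a, perp g lam p (row (idx_m a) u)) ->
  g p (row idx_k u) (row idx_l u) = 1 ->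
  (forall a b, g p (row (idx_m a) u) (row (idx_m b) u) = (a == b)%:R) ->
  (forall v w, v 0 idx_l = 0 -> w 0 idx_l = 0 ->
     g p (v *m u) (w *m u) = eta v w) /\
  (forall w, g p (vec_k *m u) (w *m u) = w 0 idx_l).
Proof.
move=> lk lm kl mm.
have mE (v : 'rV[R]_n.+2) : v *m u = v 0 idx_k *: row idx_k u +
    (v 0 idx_l *: row idx_l u + \sum_(a < n) v 0 (idx_m a) *: row (idx_m a) u).
  by rewrite mulmx_sum_row big_idx.
have kk : g p (row idx_k u) (row idx_k u) = 0 by exact: nulld_null lk.
have km a : g p (row idx_k u) (row (idx_m a) u) = 0 by exact: lm.
split => [v w v0 w0|w].
  rewrite !mE v0 w0 !scale0r !add0r etaE // gDl !gDr gZl gZr kk !mulr0 add0r.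
  rewrite gZl gsumr big1 ?mulr0 ?add0r; last by move=> a _; rewrite gZr km mulr0.
  rewrite gZr metric_sym gsumr big1 ?mulr0 ?add0r; last first.
    by move=> a _; rewrite gZr km mulr0.
  rewrite gsuml; apply: eq_bigr => a _; rewrite gZl gsumr (bigD1 a) //= gZr mm eqxx.
  rewrite big1 ?addr0 ?mulr1 // => b ba; rewrite gZr mm eq_sym (negbTE ba).
  by rewrite mulr0.
rewrite -rowE mE !gDr !gZr kk mulr0 add0r kl mulr1 gsumr big1 ?addr0 //.
by move=> a _; rewrite gZr km mulr0.
Qed.

Lemma pair_unit p u :
  (forall v w, v 0 idx_l = 0 -> w 0 idx_l = 0 ->
     g p (v *m u) (w *m u) = eta v w) ->
  (forall w, g p (vec_k *m u) (w *m u) = w 0 idx_l) -> u \in unitmx.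
Proof.
move=> vw kw; rewrite -row_free_unit; apply: inj_row_free => w wu.
have w0 : w 0 idx_l = 0 by rewrite -kw wu g0r.
have wm a : w 0 (idx_m a) = 0.
  have := vw (delta_mx 0 (idx_m a)) w; rewrite wu g0r etaE ?mxE // => /(_ erefl w0).
  rewrite (bigD1 a) //= mxE !eqxx mul1r big1 ?addr0 // => b ba.
  by rewrite mxE !(inj_eq lift_inj) (negbTE ba) mul0r.
have wk : w = w 0 idx_k *: vec_k.
  rewrite {1}(row_sum_delta w) big_idx w0 scale0r add0r big1 ?addr0 // => a _.
  by rewrite wm scale0r.
have k1 := kw (delta_mx 0 idx_l); rewrite mxE !eqxx in k1.
have : w 0 idx_k * g p (vec_k *m u) (delta_mx 0 idx_l *m u) = 0.
  by rewrite -gZl scalemxAl -wk wu metric_sym g0r.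
by rewrite k1 mulr1 => wk0; rewrite wk wk0 scale0r.
Qed.

Lemma adaptedP p u : adapted_frames lam p u <->
  [/\ u \in unitmx, lam p (vec_k *m u),
      forall v w, v 0 idx_l = 0 -> w 0 idx_l = 0 ->
        g p (v *m u) (w *m u) = eta v w &
      forall w, g p (vec_k *m u) (w *m u) = w 0 idx_l].
Proof.
have mk : vec_k *m u = row idx_k u by rewrite -rowE.
have [K K0 lamE] := null_line p.
split=> [[uu lk lm kl mm]|[uu lk vw kw]].
  by have [vw kw] := adapted_pair lk lm kl mm; split => //; rewrite mk.
split => //; first by rewrite -mk.
- move=> a v; rewrite rowE.
  have kn0 : vec_k *m u != 0.
    apply/eqP => k0; have := kw (delta_mx 0 idx_l); rewrite k0 metric_sym g0r mxE !eqxx.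
    by move/eqP; rewrite eq_sym oner_eq0.
  move: lk; rewrite lamE => -[c _ ck] [c' _ <-].
  have c0 : c != 0 by apply: contra kn0 => /eqP c0; rewrite -ck c0 scale0r.
  have -> : K = c^-1 *: (vec_k *m u) by rewrite -ck scalerA mulVf // scale1r.
  by have kma := kw (delta_mx 0 (idx_m a)); rewrite !gZl kma mxE /= !mulr0.
- by have := kw (delta_mx 0 idx_l); rewrite -!rowE mxE !eqxx.
- move=> a b; rewrite !rowE vw ?mxE //= etaE ?mxE //.
  rewrite (bigD1 a) //= !mxE !eqxx /= mul1r big1 ?addr0.
    by rewrite !(inj_eq lift_inj) .
  by move=> c ca; rewrite mxE eqxx /= !(inj_eq lift_inj) (negbTE ca) mul0r.
Qed.

Lemma adapted_orbit p u F :
  adapted_frames lam p u -> (adapted_frames lam p (F *m u) <-> GN F).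
Proof.
have [K K0 lamE] := null_line p.
have lamZ c v : lam p v -> lam p (c *: v).
  by rewrite lamE => -[c' _ <-]; exists (c * c') => //; rewrite scalerA.
move=> /adaptedP[uu lk vw kw].
have k0 : vec_k *m u != 0.
  apply/eqP => k0; have := kw (delta_mx 0 idx_l); rewrite k0 metric_sym g0r mxE !eqxx.
  by move/eqP; rewrite eq_sym oner_eq0.
have kF0 c : F \in unitmx -> vec_k *m F = c *: vec_k -> c != 0.
  move=> uF kF; apply: contra k0 => /eqP c0.
  by rewrite -[vec_k](mulmxK uF) kF c0 scale0r !mul0mx.
split=> [/adaptedP[uFu lk' vw' kw']|[uF [c kF] eF ekF]].
  have uF : F \in unitmx by move: uFu; rewrite unitmx_mul => /andP[].
  have [c kF] : exists c, vec_k *m F = c *: vec_k.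
    move: lk lk'; rewrite lamE => -[a _ aK] [b _]; rewrite mulmxA => bK.
    have a0 : a != 0 by apply: contra k0 => /eqP a0; rewrite -aK a0 scale0r.
    exists (b / a); apply: (can_inj (mulmxK uu)); rewrite -bK -scalemxAl -aK scalerA.
    by rewrite divfK.
  have e3 w : eta (vec_k *m F) (w *m F) = eta vec_k w.
    have := kw' w; rewrite !mulmxA kF -scalemxAl gZl kw eta_k => <-.
    exact: eta_kZ.
  have l0 v : v 0 idx_l = 0 -> (v *m F) 0 idx_l = 0.
    move=> v0; have := e3 v; rewrite kF eta_kZ eta_k v0 => /eqP.
    by rewrite mulf_eq0 (negbTE (kF0 _ uF kF)) => /eqP.
  split => //; first by exists c.
  move=> v w; rewrite !eta_k => v0 w0.
  by rewrite -vw ?l0 // -!mulmxA vw'.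
have l0 v : v 0 idx_l = 0 -> (v *m F) 0 idx_l = 0.
  move=> v0; have := ekF v; rewrite kF eta_kZ eta_k v0 => /eqP.
  by rewrite mulf_eq0 (negbTE (kF0 _ uF kF)) => /eqP.
apply/adaptedP; split.
- by rewrite unitmx_mul uF.
- by rewrite mulmxA kF -scalemxAl; exact: lamZ.
- move=> v w v0 w0; rewrite !mulmxA vw ?l0 //.
  by apply: eF; rewrite eta_k.
- by move=> w; rewrite !mulmxA kF -scalemxAl gZl kw -eta_kZ -kF ekF eta_k.
Qed.

Lemma adapted_section p : exists U (s : M -> 'M[R]_n.+2),
  [/\ open U, U p, forall q, U q -> adapted_frames lam q (s q) &
      forall a, smooth_field U (fun q => row a (s q))].
Proof.
have [U0 [K [oU0 U0p sK KE]]] := nulld_line lam p.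
pose i := chart_at p.
pose h x v w := g (psi i x) (tvec i (psi i x) v) (tvec i (psi i x) w).
have hlin x v : scalar (h x v).
  by move=> c w w'; rewrite /h /tvec linearP gDr gZr.
have hsym x v w : h x v w = h x w v by exact: metric_sym.
pose U1 := U0 `&` dom i.
have oU1 : open U1 by apply: openI => //; exact: open_dom.
pose O := phi i @` (U0 `&` dom i).
have oO : open O by exact: open_phi.
have hsm v w : smooth O (fun x => h x v w).
  by move=> k; apply: Ck_sub (@metric_smooth _ _ _ g i v w k) => x [q [_ iq] <-]; exists q.
have x0O : O (phi i p) by exists p => //; split => //; exact: dom_chart_at.
pose kap := local_rep i K.
have tkap x : O x -> tvec i (psi i x) (kap x) = K (psi i x).
  by move=> /psiK[_ iq _]; rewrite /kap coordK.
have kap0 x : O x -> h x (kap x) (kap x) = 0.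
  move=> Ox; have [Uq _ _] := psiK Ox; rewrite /h tkap //.
  by apply: (@nulld_null _ _ _ g lam); rewrite (KE _ Uq).2; exists 1 => //; rewrite scale1r.
have hpos x w : O x -> h x (kap x) w = 0 -> (forall c, w <> c *: kap x) -> 0 < h x w w.
  move=> Ox; have [Uq iq _] := psiK Ox; rewrite /h tkap // => kw wk.
  apply: lorentz_null_pos (KE _ Uq).1 _ kw _.
    by have := kap0 x Ox; rewrite /h tkap.
  move=> c wc; apply: (wk c); rewrite -[w](tvecK _ iq) wc.
  by rewrite /kap /local_rep /coord linearZ.
have [|U2 [ell [oU2 U2x U2O sell kell]]] := ell_exists hlin hsym oO hsm x0O (sK i).
  have [v Kv] := lorentz_nondeg p (KE p U0p).1.
  exists (coord i p v); rewrite /h tkap // phiK ?coordK //; exact: dom_chart_at.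
have [U3 [z [oU3 U3x U32 zs zz]]] :=
  gram_schmidt hlin hsym hsm x0O (sK i) hpos oU2 U2x U2O sell kell (leqnn n).
have U3O x : U3 x -> O x by move=> /U32/U2O.
pose fr x (a : 'I_n.+2) :=
  if nat_of_ord a is a1.+1 then (if a1 is a2.+1 then z a2 x else ell x) else kap x.
pose s q : 'M[R]_n.+2 := \matrix_a tvec i q (fr (phi i q) a).
pose U := [set q | dom i q /\ U3 (phi i q)].
have oU : open U.
  rewrite openE => q [iq Uq]; rewrite /interior /U.
  have n1 : nbhs q (dom i) by apply: open_nbhs_nbhs; split => //; exact: open_dom.
  have n2 : nbhs q (phi i @^-1` U3).
    by apply: (phi_continuous iq); exact: open_nbhs_nbhs.
  exact: filterI.
have Ui : U `<=` dom i by move=> q [].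
have imU x : (phi i @` (U `&` dom i)) x -> U3 x by move=> [q [[_ ?] _] <-].
exists U, s; split => //.
- by split => //; exact: dom_chart_at.
- move=> q [iq Uq].
  have Oq := U3O _ Uq; have U2q := U32 _ Uq.
  have [U0q _ _] := psiK Oq; rewrite phiK // in U0q.
  have hE v w : g q (tvec i q v) (tvec i q w) = h (phi i q) v w by rewrite /h phiK.
  have rE a : row a (s q) = tvec i q (fr (phi i q) a) by rewrite rowK.
  have frm a : fr (phi i q) (idx_m a) = z a (phi i q) by rewrite /fr /=.
  have kz (a : 'I_n) : h (phi i q) (kap (phi i q)) (z a (phi i q)) = 0 by exact: (zs a (ltn_ord a)).2.
  have Kq : K q = row idx_k (s q).
    by rewrite rE -[K q](coordK _ iq) /fr /= /kap /local_rep phiK.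
  have kq : fr (phi i q) idx_k = kap (phi i q) by [].
  have lq : fr (phi i q) idx_l = ell (phi i q) by [].
  have lk : lam q (row idx_k (s q)).
    by rewrite (KE _ U0q).2 -Kq; exists 1 => //; rewrite scale1r.
  have lm a : perp g lam q (row (idx_m a) (s q)).
    move=> v; rewrite (KE _ U0q).2 => -[c _ <-].
    by rewrite gZl Kq !rE hE kq frm kz mulr0.
  have kl : g q (row idx_k (s q)) (row idx_l (s q)) = 1 by rewrite !rE hE kq lq kell.
  have mm a b : g q (row (idx_m a) (s q)) (row (idx_m b) (s q)) = (a == b)%:R.
    by rewrite !rE hE !frm zz.
  have [vw kw] := adapted_pair lk lm kl mm.
  by split => //; exact: pair_unit vw kw.
- move=> a; have oP := open_phi (i := i) oU; apply: smooth_field_chart oU Ui _ => k.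
  have : Ck k U3 (fun x => fr x a).
    case: (unliftP ord0 a) => [b ->|->]; last exact: Ck_sub (sK i k).
    case: (unliftP ord0 b) => [c ->|->]; last exact: Ck_sub (sell k).
    exact: ((zs c (ltn_ord c)).1 k).
  move=> /(Ck_sub imU); apply: (Ck_ext oP) => x; rewrite inE => /psiK[_ iq px].
  by rewrite /local_rep rowK tvecK // px.
Qed.

(* The GN-structure P(M, g, lam). *)
Definition adapted_structure : GN_structure M :=
  GNStructure (fun p u (h : adapted_frames lam p u) => let: And5 hu _ _ _ _ := h in hu)
    adapted_orbit adapted_section.

End Adapted.

(* Main.v *)
Require Import Defs.
From mathcomp Require Import all_boot all_order all_algebra.
From mathcomp Require Import all_classical all_reals.
From mathcomp Require Import topology normedtype landau derive realfun.
From mathcomp Require Import ring lra.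
From mathcomp Require Import sequences measure lebesgue_measure lebesgue_integral ftc.

Set Implicit Arguments.
Unset Strict Implicit.
Unset Printing Implicit Defensive.

Import Order.TTheory GRing.Theory Num.Theory.
Import numFieldNormedType.Exports.

Local Open Scope classical_set_scope.
Local Open Scope ring_scope.

(* The argument turns on three derivatives along a flow [th] of [X], with
   [J = d(th_t) v]:  d/dt g(J, J') = (L_X g)(J, J')  and, for a vector field [Y],
   d/dt g(J, Y) = (L_X g)(J, Y) + g(J, [X, Y]), where [L_X g] is tensorial.

   If [X] is nil-Killing and preserves [lam], take [Y = K] spanning [lam] locally:
   [X, K] = f K, so g(J, K) satisfies a linear scalar equation and the flow
   preserves the orthogonal complement of [lam].  A vector of that complement
   keeps its norm, and a null vector orthogonal to [lam] lies in [lam], so [lam]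
   is preserved too; the remaining products of an adapted frame are then constant.

   Conversely the flow of an infinitesimal automorphism keeps those products
   constant, so their derivatives at time 0 vanish; this gives the nil-Killing
   equations, and [g(w, [X, Y]) = 0] for [Y] in [lam] and [w] orthogonal to [lam].
   Here one needs that smooth fields have smooth local flows: Picard iteration on a
   time interval short compared with the Lipschitz constant [L], and smoothness by
   induction on the order, since a derivative of the solution with respect to the
   initial point solves a linear equation with the same constant [L]. *)

(** An adapted frame records the line [lam], the metric on [perp lam] and the products with the
    vector in [lam], and nothing else. Their derivatives at time 0 are exactly the components of
    [L_X g] in the nil-Killing conditions. Those conditions are tested on sections, whereas a
    transported vector [J] lives along a single curve; hence the pointwise form of [L_X g] and the
    extension of vectors by constant coefficients in a local adapted frame.

    A tangent vector is stored by its coordinates in [chart_at] of its base point, and this chart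
    may jump along a curve. Each time derivative is therefore taken in the chart chosen at one fixed
    time and compared with the stored coordinates at nearby times.

    Uniqueness is proved on short intervals, where half of a supremum can be absorbed. It extends to
    the whole time domain because the times at which a frame is adapted form a relatively open and
    closed set. In the smoothness proof, an [L] that grew with the order would let the time interval
    shrink without bound. *)

Local Notation coord := Defs.coord.

(** * Derivatives and estimates for vector-valued functions *)

Section RowNorm.
Context {R : realType} {m : nat}.
Implicit Types v : 'rV[R]_m.+1.

Lemma row_norm_coord v j : `|v 0 j| <= `|v|.
Proof.
rewrite [leRHS]/Num.norm /= mx_normrE.
exact: (le_bigmax (0 : R) (fun ij : 'I_1 * 'I_m.+1 => `|v ij.1 ij.2|) (0, j)).
Qed.

Lemma row_norm_le v C : (forall j, `|v 0 j| <= C) -> `|v| <= C.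
Proof.
move=> vC; have C0 : 0 <= C by exact: le_trans (vC ord0).
rewrite [leLHS]/Num.norm /= mx_normrE; apply: bigmax_le => // -[i j] _ /=.
by rewrite ord1.
Qed.

(** The norm of a row is the maximum of its coordinates, so applying the scalar mean value theorem
    to each coordinate loses no constant. *)
Lemma mean_value_le (f : R -> 'rV[R]_m.+1) a b C : a <= b ->
  (forall t, a <= t <= b -> derivable f t 1 /\ `|'D_1 f t| <= C) ->
  `|f b - f a| <= C * (b - a).
Proof.
move=> ab fC; apply: row_norm_le => j.
pose fj t := f t 0 j.
have dfj t : a <= t <= b -> is_derive t 1 fj ('D_1 f t 0 j).
  move=> /fC[df _]; apply: DeriveDef; first exact: ((derivable_mxP f t 1).1 df).
  by rewrite derive_mx // mxE.
have [||c cab E] := @MVT_segment R fj (fun t => 'D_1 f t 0 j) a b ab.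
- by move=> t /[!in_itv]/= /andP[/ltW at_ /ltW tb]; apply: dfj; rewrite at_.
- apply: derivable_within_continuous => t /[!in_itv]/= tab.
  by have [] := dfj t tab.
have -> : (f b - f a) 0 j = fj b - fj a by rewrite !mxE.
rewrite in_itv /= in cab; rewrite E normrM [X in _ * X]ger0_norm ?subr_ge0 //.
rewrite ler_wpM2r ?subr_ge0 //.
exact: le_trans (row_norm_coord _ _) (fC _ cab).2.
Qed.

(* On a short interval the supremum [M] of [`|w|] satisfies
   [M <= M / 2 + (b - a) * de], which replaces Gronwall's inequality. *)
Lemma short_gronwall (w : R -> 'rV[R]_m.+1) a b c L de : a <= c <= b ->
  0 <= L -> 0 <= de -> (b - a) * L <= 2^-1 -> w c = 0 ->
  (forall t, a <= t <= b -> derivable w t 1 /\ `|'D_1 w t| <= L * `|w t| + de) ->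
  forall t, a <= t <= b -> `|w t| <= 2 * (b - a) * de.
Proof.
move=> /andP[ac cb] L0 de0 bL wc dw t tab.
have ab : a <= b := le_trans ac cb.
have [|s sab smax] := @EVT_max R (fun t => `|w t|) a b ab.
  apply: continuous_in_subspaceT => s; rewrite inE /= in_itv /= => sab.
  apply: (@continuous_comp _ _ _ w (fun v => `|v|)); last exact: norm_continuous.
  by apply: differentiable_continuous; apply/derivable1_diffP; have [] := dw s sab.
rewrite in_itv /= in sab; have /andP[as_ sb] := sab.
have sM r : a <= r <= b -> `|w r| <= `|w s| by move=> rab; apply: smax; rewrite in_itv.
suff : `|w s| <= 2 * (b - a) * de by exact/le_trans/sM.
have dwM r : a <= r <= b -> derivable w r 1 /\ `|'D_1 w r| <= L * `|w s| + de.
  move=> rab; have [d1 d2] := dw r rab; split => //; apply: le_trans d2 _.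
  by rewrite lerD2r ler_wpM2l // sM.
have M0 : 0 <= `|w s| := normr_ge0 _.
have : `|w s| <= (L * `|w s| + de) * (b - a).
  have nn : 0 <= L * `|w s| + de by rewrite addr_ge0 // mulr_ge0.
  have [cs|/ltW sc] := leP c s.
    have := @mean_value_le w c s (L * `|w s| + de) cs; rewrite wc subr0.
    move=> H; apply: le_trans (H _) _ => [r /andP[cr rs]|].
      by apply: dwM; rewrite (le_trans ac cr) (le_trans rs sb).
    by rewrite ler_wpM2l // lerB.
  have := @mean_value_le w s c (L * `|w s| + de) sc; rewrite wc sub0r normrN.
  move=> H; apply: le_trans (H _) _ => [r /andP[sr rc]|].
    by apply: dwM; rewrite (le_trans as_ sr) (le_trans rc cb).
  by rewrite ler_wpM2l // lerB.
move=> H; have : (b - a) * L * `|w s| <= 2^-1 * `|w s| by rewrite ler_wpM2r.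
by move: H; nra.
Qed.

End RowNorm.

(** * Derivatives along lines and composition with linear maps *)

Section Lines.
Context {R : realType} {V W : normedModType R}.
Implicit Types (f : V -> W) (x v : V).

Lemma is_derive_line f x v (s : R) : derivable f (s *: v + x) v ->
  is_derive s 1 (fun r : R => f (r *: v + x)) ('D_v f (s *: v + x)).
Proof.
have E : (fun h : R => h^-1 *: (((fun r : R => f (r *: v + x)) \o shift s) (h *: 1) - f (s *: v + x)))
    = (fun h : R => h^-1 *: ((f \o shift (s *: v + x)) (h *: v) - f (s *: v + x))).
  apply/funext => h /=; congr (_ *: (f _ - _)).
  by rewrite [h%:A]mulr1 scalerDl addrA.
by move=> df; apply: DeriveDef; rewrite ?/derivable ?/derive E.
Qed.

Lemma derive_linear_comp {V' : normedModType R} (l : {linear V' -> V}) f (x v : V') :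
  'D_v (f \o l) x = 'D_(l v) f (l x).
Proof.
rewrite /derive; set g1 := fun h => h^-1 *: _; set g2 := fun h => h^-1 *: _.
suff -> : g1 = g2 by [].
apply/funext => h; rewrite /g1 /g2 /=.
by rewrite (linearD l) (linearZ_LR l).
Qed.

Lemma Ck_linear_comp {V' : normedModType R} k (l : {linear V' -> V}) (O : set V) f :
  continuous l -> Ck k O f -> Ck k (l @^-1` O) (f \o l).
Proof.
move=> cl; elim: k f => [|k IH] f /=.
  by move=> cf x Ox; apply: continuous_comp; [exact: cl|exact: cf].
move=> [df cf]; split=> [x Ox|v].
  by apply: differentiable_comp; [exact: linear_differentiable|exact: df].
have -> : (fun x : V' => 'D_v (f \o l) x) = (fun y => 'D_(l v) f y) \o l.
  by apply/funext => x; rewrite derive_linear_comp.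
exact: IH.
Qed.

Lemma Ck_linear k (O : set V) (l : {linear V -> W}) : continuous l -> Ck k O l.
Proof.
move=> cl; case: k => [|k]; first by move=> x _; exact: cl.
split=> [x _|v]; first exact: linear_differentiable.
have -> : (fun x : V => 'D_v l x) = fun=> l v; last exact: Ck_cst.
by apply/funext => x; rewrite deriveE ?diff_lin //; exact: linear_differentiable.
Qed.

(** The case of zero differential; a general one reduces to it by subtracting the candidate linear
    part. *)
Lemma differentiable_small f x :
  (forall e : R, 0 < e -> \forall y \near x, `|f y - f x| <= e * `|y - x|) ->
  differentiable f x.
Proof.
move=> sf.
have H : continuous (\0 : V -> W) /\ f \o shift x = cst (f x) + \0 +o_ 0 id.
  split; first exact: cst_continuous.
  apply/eqaddoP => e e0; have := sf e e0; rewrite (near_shift 0 x) => H.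
  near=> h; rewrite !fctE /= addr0.
  have : `|f ((shift (x - 0)) h) - f x| <= e * `|(shift (x - 0)) h - x| by near: h.
  by rewrite /= subr0 addrK.
have E : 'd f x = \0 :> (V -> W).
  by apply: diff_unique; [exact: H.1|exact: H.2].
by apply/diff_locallyP; rewrite E; exact: H.
Unshelve. all: by end_near. Qed.

End Lines.

Section Projections.
Context {R : realType} {V W : normedModType R}.

Lemma continuous_fst : continuous (fst : V * W -> V).
Proof. by move=> x; exact: cvg_fst. Qed.

Lemma continuous_snd : continuous (snd : V * W -> W).
Proof. by move=> x; exact: cvg_snd. Qed.

Lemma differentiable_fst (x : V * W) : differentiable fst x.
Proof. exact: linear_differentiable continuous_fst. Qed.

Lemma differentiable_snd (x : V * W) : differentiable snd x.
Proof. exact: linear_differentiable continuous_snd. Qed.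

End Projections.

Section Near.
Context {R : realType} {V : normedModType R}.

Lemma nearP (x : V) (P : V -> Prop) :
  (\forall y \near x, P y) <-> exists2 r : R, 0 < r & forall y, `|y - x| < r -> P y.
Proof.
split=> [/nbhs_ballP[r /= r0 xr]|[r r0 xr]].
  exists r => // y yx; apply: xr; rewrite -ball_normE /ball_ /=.
  by rewrite distrC.
apply/nbhs_ballP; exists r => //= y; rewrite -ball_normE /ball_ /= distrC.
exact: xr.
Qed.

Lemma near_ord (N : nat) (x : V) (P : nat -> V -> Prop) :
  (forall j, (j < N)%N -> \forall y \near x, P j y) ->
  \forall y \near x, forall j, (j < N)%N -> P j y.
Proof.
elim: N => [|N IH] H; first by near=> y.
have H1 : \forall y \near x, forall j, (j < N)%N -> P j y.
  by apply: IH => j jN; apply: H; exact: ltnW.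
have H2 := H N (ltnSn N).
near=> y => j; rewrite ltnS leq_eqVlt => /predU1P[->|]; first by near: y.
by move: j; near: y.
Unshelve. all: by end_near. Qed.

End Near.

(** * Differentiability from continuous partial derivatives *)

Section Partials.
Context {R : realType}.

Lemma derivable_scalar_le (p : R -> R) (c d et : R) :
  (forall s : R, `|s| <= `|c| -> derivable p s 1 /\ `|'D_1 p s - d| <= et) ->
  `|p c - p 0 - c * d| <= et * `|c|.
Proof.
move=> H.
have dP (s : R) : `|s| <= `|c| -> is_derive s 1 p ('D_1 p s).
  by move=> /H[/derivableP].
have cP (a b : R) : (forall s : R, a <= s <= b -> `|s| <= `|c|) -> {within `[a, b], continuous p}.
  move=> ab; apply: derivable_within_continuous => s /[!in_itv]/= /ab /H.
  by case.
have [c0|c0] := leP 0 c.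
  have b (s : R) : 0 <= s <= c -> `|s| <= `|c|.
    by move=> /andP[s0 sc]; rewrite !ger0_norm.
  have [||s] := @MVT_segment R p (fun s => 'D_1 p s) 0 c c0.
  - by move=> s /[!in_itv]/= /andP[/ltW s0 /ltW sc]; apply/dP/b; rewrite s0.
  - exact: cP.
  rewrite in_itv /= => /b/H[_ sd]; rewrite subr0 => ->.
  by rewrite mulrC -mulrBr normrM mulrC ler_wpM2r.
have b (s : R) : c <= s <= 0 -> `|s| <= `|c|.
  by move=> /andP[s0 sc]; rewrite !ler0_norm ?lerN2 // ltW.
have [||s] := @MVT_segment R p (fun s => 'D_1 p s) c 0 (ltW c0).
- by move=> s /[!in_itv]/= /andP[/ltW s0 /ltW sc]; apply/dP/b; rewrite s0.
- exact: cP.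
rewrite in_itv /= => /b/H[_ sd]; rewrite sub0r => E.
have -> : p c - p 0 - c * d = c * ('D_1 p s - d) by move: E; rewrite mulrN; lra.
by rewrite normrM mulrC ler_wpM2r.
Qed.

Section Family.
Context {V : normedModType R}.
Variables (N : nat) (e : nat -> V) (c : nat -> V -> R).
Hypothesis cD : forall j v w, c j (v + w) = c j v + c j w.
Hypothesis dc : forall j v, differentiable (c j) v.
Hypothesis cE : forall v, v = \sum_(j < N) c j v *: e j.
Hypothesis cle : forall j v, `|c j v| <= `|v|.
Hypothesis ele : forall k v (s : R), (k < N)%N -> `|s| <= `|c k v| ->
  `|s *: e k + \sum_(j < k) c j v *: e j| <= `|v|.

(** The increment of [f] is split along the axes, one coordinate at a time; [ele] keeps every point
    of the broken path in the ball where the partial derivatives are close to their values at [x].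
    The directions are abstract because the result is applied to [R * 'rV[R]_d.+1], which is not a
    space of rows. *)
Lemma differentiable_partials (f : V -> R) x :
  (forall j, (j < N)%N -> \forall y \near x, derivable f y (e j)) ->
  (forall j, (j < N)%N -> {for x, continuous ('D_(e j) f)}) ->
  differentiable f x.
Proof.
move=> df cf.
pose L v := \sum_(j < N) c j v * 'D_(e j) f x.
have dL : differentiable L x.
  pose F (j : 'I_N) := fun v => c j v * 'D_(e j) f x.
  have -> : L = \sum_(j < N) F j by apply/funext => v; rewrite fct_sumE.
  apply: differentiable_sum => j; apply: differentiableM => //.
have -> : f = (f - L) + L by rewrite subrK.
apply: differentiableD => //; apply: differentiable_small => eps eps0.
(* There are [N] segments, and each may contribute an error of [eps / N.+1] times the norm; the
   successor keeps the quotient meaningful for [N = 0]. *)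
have et0 : 0 < eps / N.+1%:R by rewrite divr_gt0.
have : \forall y \near x, forall j, (j < N)%N ->
    derivable f y (e j) /\ `|'D_(e j) f y - 'D_(e j) f x| <= eps / N.+1%:R.
  apply: near_ord => j jN.
  have /cvgrPdist_le/(_ _ et0) cfj := cf j jN; have dfj := df j jN.
  near=> y; split; first by near: y.
  by rewrite distrC; near: y.
move=> /nearP[r r0 H]; apply/nearP; exists r => // y yx.
pose v := y - x; pose S k := \sum_(j < k) c j v *: e j.
have -> : (f - L) y - (f - L) x = f y - f x - L v.
  have -> : L v = L y - L x.
    rewrite /L -sumrB; apply: eq_bigr => j _; rewrite -mulrBl; congr (_ * _).
    by have := cD j v x; rewrite subrK => ->; rewrite addrK.
  by rewrite !fctE /=; ring.
have T k : (k <= N)%N -> `|f (x + S k) - f x - \sum_(j < k) c j v * 'D_(e j) f x|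
    <= k%:R * (eps / N.+1%:R) * `|v|.
  elim: k => [|k IH] kN; first by rewrite /S !big_ord0 addr0 subrr subr0 normr0 !mul0r.
  have := @derivable_scalar_le (fun s => f (s *: e k + (x + S k))) (c k v)
     ('D_(e k) f x) (eps / N.+1%:R).
  rewrite scale0r add0r => Hk.
  have {}Hk : `|f (c k v *: e k + (x + S k)) - f (x + S k) - c k v * 'D_(e k) f x|
      <= eps / N.+1%:R * `|v|.
    apply: (le_trans (Hk _)); last by rewrite ler_wpM2l // ltW.
    move=> s sc.
    have [|dk ck] := H (s *: e k + (x + S k)) _ k kN.
      by rewrite addrCA addrAC subrr add0r; exact: le_lt_trans (ele kN sc) yx.
    by have [d1 d2] := is_derive_line dk; split; rewrite ?d2.
  rewrite /S !big_ord_recr /= -/(S k).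
  have := lerD (IH (ltnW kN)) Hk; set A := f (x + S k) - _ - _; set B := f _ - _ - _.
  move=> AB.
  set C := (X in `|X| <= _); have -> : C = A + B.
    rewrite /C /A /B (addrC _ (x + S k)) addrA; ring.
  apply: le_trans (ler_normD _ _) _; apply: le_trans AB _.
  by rewrite -[k.+1%:R]natr1 !mulrDl mul1r.
have := T N (leqnn N); rewrite /S -cE /v subrKC => /le_trans; apply.
rewrite ler_wpM2r // mulrA ler_pdivrMr ?ltr0Sn // mulrC ler_wpM2l ?ltW //.
by rewrite ltr_nat.
Unshelve. all: by end_near. Qed.

End Family.

(** Dropping the coordinates of [v] after the [k]-th and shrinking that one cannot increase the
    maximum norm. This provides [ele] for rows. *)
Lemma row_partial_le m k (v : 'rV[R]_m.+1) (s : R) : (k < m.+1)%N ->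
  `|s| <= `|v 0 (inord k)| ->
  `|s *: delta_mx 0 (inord k) + \sum_(j < k) v 0 (inord j) *: delta_mx 0 (inord j)
    : 'rV[R]_m.+1| <= `|v|.
Proof.
move=> km sv; apply: row_norm_le => j.
have E l : (l <= m.+1)%N -> (\sum_(i < l) v 0 (inord i) *: delta_mx 0 (inord i) : 'rV[R]_m.+1) 0 j =
    (if (j < l)%N then v 0 j else 0).
  elim: l => [|l IH] lm; first by rewrite big_ord0 mxE.
  rewrite big_ord_recr /= mxE IH; last exact: ltnW.
  rewrite !mxE /= ltnS [(j <= l)%N]leq_eqVlt.
  have [E|jl] := eqVneq (j : nat) l.
    by rewrite -E inord_val eqxx ltnn add0r mulr1.
  rewrite (_ : (j == inord l) = false) ?mulr0 ?addr0 //.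
  by apply: contraNF jl => /eqP ->; rewrite inordK.
rewrite mxE E; last exact: ltnW.
rewrite !mxE /=; have [jk|jk] := eqVneq j (inord k).
  rewrite jk inordK // ltnn addr0 mulr1 (le_trans sv) //; exact: row_norm_coord.
rewrite mulr0 add0r; case: ifP => _; first exact: row_norm_coord.
by rewrite normr0 normr_ge0.
Qed.

Lemma row_sum_inord m (v : 'rV[R]_m.+1) :
  v = \sum_(j < m.+1) v 0 (inord j) *: delta_mx 0 (inord j).
Proof.
rewrite {1}(row_sum_delta v); apply: eq_bigr => j _; by rewrite inord_val.
Qed.

Lemma differentiable_time_row d (f : R * 'rV[R]_d.+1 -> R) x :
  (\forall y \near x, derivable f y (1, 0)) ->
  {for x, continuous ('D_(1, 0) f)} ->
  (forall v, \forall y \near x, derivable f y (0, v)) ->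
  (forall v, {for x, continuous ('D_(0, v) f)}) ->
  differentiable f x.
Proof.
move=> df cf dfv cfv.
(* Index 0 is the time axis and [i.+1] the [i]-th space axis. *)
pose e (j : nat) : R * 'rV[R]_d.+1 :=
  if j is i.+1 then (0, delta_mx 0 (inord i)) else (1, 0).
pose c (j : nat) (v : R * 'rV[R]_d.+1) := if j is i.+1 then v.2 0 (inord i) else v.1.
have S k (v : R * 'rV[R]_d.+1) : \sum_(j < k.+1) c j v *: e j =
    (v.1, \sum_(j < k) v.2 0 (inord j) *: delta_mx 0 (inord j)).
  rewrite big_ord_recl /=.
  elim: k => [|k IH].
    rewrite !big_ord0 addr0; congr (_, _); last exact: scaler0.
    exact: mulr1.
  rewrite big_ord_recr /= addrA IH big_ord_recr /=; congr (_, _) => /=.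
  by rewrite scaler0 addr0.
apply: (@differentiable_partials _ d.+2 e c).
- by move=> [|j] v w //=; rewrite mxE.
- move=> [|j] v; first exact: differentiable_fst.
  apply: (@differentiable_comp _ _ _ _ snd (fun N : 'rV[R]_d.+1 => N 0 _)).
    exact: differentiable_snd.
  exact: differentiable_coord.
- by move=> v; rewrite S -row_sum_inord; case: v.
- move=> [|j] v /=; first by rewrite prod_normE le_max lexx.
  apply: le_trans (row_norm_coord _ _) _.
  by rewrite prod_normE le_max lexx orbT.
- move=> [|k] v s kN /= sc.
    rewrite big_ord0 addr0 !prod_normE /= scaler0 normr0.
    rewrite ge_max le_max -[s *: 1]/(s * 1) mulr1 sc /=.
    by rewrite le_max normr_ge0.
  rewrite S !prod_normE /= scaler0 add0r.
  rewrite ge_max !le_max lexx /= row_partial_le ?orbT //.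
- by move=> [|j] _; [exact: df|exact: dfv].
- by move=> [|j] _; [exact: cf|exact: cfv].
Qed.

End Partials.

(** * Symmetry of second derivatives *)

Section Schwarz.
Context {R : realType} {V : normedModType R}.
Implicit Types (f : V -> R) (v w x : V).

(** Two uses of the mean value theorem, first along [v] and then along [w], turn the second
    difference over the parallelogram into [h ^+ 2] times ['D_w ('D_v f)] at an intermediate point,
    and continuity brings that point back to [x]. *)
Lemma second_difference f v w x (eps : R) : 0 < eps ->
  (\forall y \near x, differentiable f y) ->
  (\forall y \near x, differentiable ('D_v f) y) ->
  {for x, continuous (fun y => 'D_w ('D_v f) y)} ->
  \forall h \near 0^'+, `|f (h *: v + (h *: w + x)) - f (h *: w + x) -
     (f (h *: v + x) - f x) - h ^+ 2 * 'D_w ('D_v f) x| <= eps * h ^+ 2.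
Proof.
move=> eps0 df ddf /cvgrPdist_le/(_ _ eps0) cf.
have : \forall y \near x, [/\ differentiable f y, differentiable ('D_v f) y &
    `|'D_w ('D_v f) x - 'D_w ('D_v f) y| <= eps].
  by apply: filterS3 df ddf cf => y.
move=> /nearP[r r0 H].
(* The parallelogram with sides [h *: v] and [h *: w] lies within [h * C] of [x]; the summand 1
   makes [C] positive when both vectors vanish. *)
pose C := `|v| + `|w| + 1; have C0 : 0 < C by rewrite ltr_wpDl // addr_ge0.
near=> h.
have h0 : 0 < h by near: h; exact: nbhs_right_gt.
have hr : h * C < r.
  by rewrite -ltr_pdivlMr //; near: h; apply: nbhs_right_lt; rewrite divr_gt0.
have in_r (s t : R) : 0 <= s <= h -> 0 <= t <= h -> `|s *: v + (t *: w + x) - x| < r.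
  move=> /andP[s0 sh] /andP[t0 th]; rewrite addrA addrK.
  apply: le_lt_trans hr; apply: le_trans (ler_normD _ _) _.
  rewrite !normrZ !ger0_norm // /C.
  have : s * `|v| <= h * `|v| by rewrite ler_wpM2r.
  have : t * `|w| <= h * `|w| by rewrite ler_wpM2r.
  rewrite !mulrDr mulr1; move: (ltW h0); lra.
have hh : 0 <= h <= h by rewrite lexx ltW.
have h00 : (0 : R) <= 0 <= h by rewrite lexx ltW.
pose p (s : R) := f (s *: v + (h *: w + x)) - f (s *: v + x).
have dp (s : R) : 0 <= s <= h ->
    is_derive s 1 p ('D_v f (s *: v + (h *: w + x)) - 'D_v f (s *: v + x)).
  move=> sh; apply: is_deriveB; apply: is_derive_line; apply: diff_derivable.
    by have [] := H _ (in_r s h sh hh).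
  by have [] := H _ (in_r s 0 sh h00); rewrite scale0r add0r.
have [||s] := @MVT_segment R p
    (fun s => 'D_v f (s *: v + (h *: w + x)) - 'D_v f (s *: v + x)) 0 h (ltW h0).
- by move=> r1 /[!in_itv]/= sh; apply: dp; case/andP: sh => /ltW -> /ltW ->.
- apply: derivable_within_continuous => s /[!in_itv]/= sh.
  by have [] := dp s sh.
rewrite in_itv /= => sh E1.
pose q (t : R) := 'D_v f (t *: w + (s *: v + x)).
have dq (t : R) : 0 <= t <= h -> is_derive t 1 q ('D_w ('D_v f) (t *: w + (s *: v + x))).
  move=> th; apply: is_derive_line; apply: diff_derivable.
  by have [] := H _ (in_r s t sh th); rewrite addrCA.
have [||t] := @MVT_segment R q
    (fun t => 'D_w ('D_v f) (t *: w + (s *: v + x))) 0 h (ltW h0).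
- by move=> r1 /[!in_itv]/= th; apply: dq; case/andP: th => /ltW -> /ltW ->.
- apply: derivable_within_continuous => t /[!in_itv]/= th.
  by have [] := dq t th.
rewrite in_itv /= => th E2.
have -> : f (h *: v + (h *: w + x)) - f (h *: w + x) - (f (h *: v + x) - f x) = p h - p 0.
  by rewrite /p !scale0r !add0r; ring.
rewrite E1 subr0.
have -> : 'D_v f (s *: v + (h *: w + x)) - 'D_v f (s *: v + x) = q h - q 0.
  by rewrite /q scale0r add0r addrCA.
rewrite E2 subr0 -mulrA -expr2 [_ * h ^+ 2]mulrC -mulrBr normrM mulrC.
rewrite [`|h ^+ 2|]ger0_norm ?sqr_ge0 // ler_wpM2r ?sqr_ge0 // distrC addrCA.
by have [] := H _ (in_r s t sh th).
Unshelve. all: by end_near. Qed.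

(** The second difference is symmetric in [v] and [w], and it approximates both mixed derivatives to
    within [eps / 2] after division by [h ^+ 2]. *)
Lemma derive_commute f v w x (U : set V) : open U -> U x -> Ck 2 U f ->
  'D_w ('D_v f) x = 'D_v ('D_w f) x.
Proof.
move=> oU Ux [df /[dup] /(_ v)[dfv cv] /(_ w)[dfw cw]].
apply/eqP; rewrite -subr_eq0 -normr_le0; apply/ler_addgt0Pl => eps eps0.
have U' : \forall y \near x, U y by exact: open_nbhs_nbhs.
have e2 : 0 < eps / 2 by rewrite divr_gt0.
have F0 : \forall y \near x, differentiable f y by exact: filterS U'.
have Fv : \forall y \near x, differentiable ('D_v f) y by exact: filterS U'.
have Fw : \forall y \near x, differentiable ('D_w f) y by exact: filterS U'.
have A1 := second_difference e2 F0 Fv (cv w x Ux).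
have A2 := second_difference e2 F0 Fw (cw v x Ux).
have [h [h0 [B1 B2]]] := @filter_ex _ _ (at_right_proper_filter (0 : R)) _
  (filterI (nbhs_right_gt 0) (filterI A1 A2)).
have h2 : 0 < h ^+ 2 by rewrite exprn_gt0.
have E : h *: v + (h *: w + x) = h *: w + (h *: v + x) by rewrite addrCA.
rewrite E in B1; rewrite addr0 -(ler_pM2r h2); move: B1 B2 => {E A1 A2 F0 Fv Fw}.
move: ('D_w ('D_v f) x) ('D_v ('D_w f) x) => a b.
move: (f _) (f (h *: w + x)) (f (h *: v + x)) (f x) => D c c' e B1 B2.
have -> : `|a - b| * h ^+ 2 = `|(a - b) * h ^+ 2|.
  by rewrite normrM [X in _ = _ * X]ger0_norm // ltW.
have -> : (a - b) * h ^+ 2 =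
  (D - c' - (c - e) - h ^+ 2 * b) - (D - c - (c' - e) - h ^+ 2 * a) by ring.
apply: le_trans (ler_normB _ _) _; apply: le_trans (lerD B2 B1) _.
by rewrite -mulrDl -splitr.
Qed.

End Schwarz.

(** * Ordinary differential equations *)

Section Antiderivative.
Context {R : realType}.

Lemma antiderivative (f : R -> R) b : continuous f ->
  exists F : R -> R, F 0 = 0 /\ forall t : R, `|t| < b -> is_derive t 1 F (f t).
Proof.
move=> cf.
(* Integrating from [- b] instead of 0 covers both signs of [t] with one formula; the value at 0 is
   subtracted afterwards. *)
pose F x := (\int[lebesgue_measure]_(t in [set` `[- b, x]]) f t)%R.
have fint : (@lebesgue_measure R).-integrable `[- b, b] (EFin \o f).
  apply: continuous_compact_integrable; first exact: segment_compact.
  exact: continuous_subspaceT.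
exists (fun x => F x - F 0); split => [|t]; first by rewrite subrr.
rewrite ltr_norml => /andP[bt tb].
have [dF FE] := @continuous_FTC1_closed R f (- b) t b tb fint bt (cf t).
have dFt : is_derive t 1 F (f t).
  by apply: DeriveDef; [exact: dF|rewrite -FE derive1E].
have -> : (fun x => F x - F 0) = F - cst (F 0) by [].
by apply: is_derive_eq; rewrite subr0.
Qed.

Lemma antiderivative_row m (f : R -> 'rV[R]_m.+1) b : continuous f ->
  exists F : R -> 'rV[R]_m.+1,
    F 0 = 0 /\ forall t : R, `|t| < b -> is_derive t 1 F (f t).
Proof.
move=> cf.
have /choice[F FP] : forall j : 'I_m.+1, exists F : R -> R,
    F 0 = 0 /\ forall t : R, `|t| < b -> is_derive t 1 F (f t 0 j).
  move=> j; apply: (@antiderivative (fun t => f t 0 j)) => t.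
  apply: (@continuous_comp _ _ _ f (fun N : 'rV[R]_m.+1 => N 0 j)); first exact: cf.
  exact: coord_continuous.
exists (fun t => \row_j F j t); split => [|t tb].
  by apply/rowP => j; rewrite !mxE (FP j).1.
have dF : derivable (fun t => \row_j F j t) t 1.
  apply/derivable_mxP => i j; rewrite (_ : (fun x => _) = F j); last first.
    by apply/funext => x; rewrite mxE.
  by have [] := (FP j).2 t tb.
apply: DeriveDef => //; rewrite derive_mx //; apply/rowP => j; rewrite mxE.
rewrite (_ : (fun x => _) = F j); last by apply/funext => x; rewrite mxE.
by have [_ ->] := (FP j).2 t tb.
Qed.

End Antiderivative.

(** * Picard iteration on a short time interval *)

Section Picard.
Context {R : realType} {m : nat}.
Let V := 'rV[R]_m.+1.
Variables (a L be rho : R) (G : R -> V -> V).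
Hypotheses (a0 : 0 < a) (L0 : 0 <= L) (be0 : 0 <= be).
Hypotheses (aL : a * L <= 2^-1) (abe : 2 * a * be <= rho).
Hypothesis Gc : forall u : R -> V, continuous u -> (forall t, `|u t| <= rho) ->
  continuous (fun t => G t (u t)).
Hypothesis GL : forall (t : R) v w, `|v| <= rho -> `|w| <= rho ->
  `|G t v - G t w| <= L * `|v - w|.
Hypothesis G0 : forall t, `|G t 0| <= be.

(** Freezing time outside [[-a, a]] turns curves on this interval into bounded continuous curves on
    the whole line, so that all uniform estimates are over [R]. *)
Definition clamp (t : R) : R := Num.max (- a) (Num.min a t).

Lemma clamp_continuous : continuous clamp.
Proof.
move=> t; apply: (@continuous_max _ _ (cst (- a)) (cst a \min id)).
  exact: cst_continuous.
by apply: continuous_min; [exact: cst_continuous|exact: cvg_id].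
Qed.

Lemma clamp_le t : `|clamp t| <= a.
Proof.
by rewrite ler_norml le_max lexx /= ge_max ge_min lexx /= andbT; move: a0; lra.
Qed.

Lemma clamp_id t : `|t| <= a -> clamp t = t.
Proof. by rewrite ler_norml /clamp => /andP[? ?]; rewrite min_r // max_r. Qed.

Let good (u : R -> V) := continuous u /\ forall t, `|u t| <= rho.

(** The Picard operator, as a relation because antiderivatives are obtained only by existence. The
    derivative is required for [|t| < a + 1] so that it is available at the endpoints of
    [[-a, a]]. *)
Let prim (u u' : R -> V) := exists W : R -> V,
  [/\ W 0 = 0, forall t : R, `|t| < a + 1 -> is_derive t 1 W (G t (u t)) &
      forall t, u' t = W (clamp t)].

Lemma mean_value_sym (W : R -> V) C : 0 <= C -> W 0 = 0 ->
  (forall t : R, `|t| <= a -> derivable W t 1 /\ `|'D_1 W t| <= C) ->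
  forall t : R, `|t| <= a -> `|W t| <= C * a.
Proof.
move=> C0 W0 dW t ta; have := ta; rewrite ler_norml => /andP[at_ ta'].
have [t0|/ltW t0] := leP 0 t.
  have := @mean_value_le R m W 0 t C t0; rewrite W0 !subr0 => /(_ _)/le_trans; apply.
    move=> s /andP[s0 st]; apply: dW; rewrite ger0_norm //; exact: le_trans ta'.
  by rewrite ler_wpM2l.
have := @mean_value_le R m W t 0 C t0; rewrite W0 !sub0r normrN => /(_ _)/le_trans; apply.
  move=> s /andP[st s0]; apply: dW; rewrite ler0_norm // lerNl; exact: le_trans st.
by rewrite ler_wpM2l // lerNl.
Qed.

(** The integrand is bounded by [L * rho + be], and over time [a] this gives at most
    [rho / 2 + rho / 2]: one half from [aL], the other from [abe]. *)
Lemma prim_good u : good u -> exists u', good u' /\ prim u u'.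
Proof.
move=> [cu ur].
have [W [W0 dW]] := antiderivative_row (a + 1) (Gc cu ur).
have dWa (t : R) : `|t| <= a -> is_derive t 1 W (G t (u t)).
  by move=> ta; apply: dW; apply: le_lt_trans ta _; rewrite ltrDl.
exists (W \o clamp); split; last by exists W.
have rho0 : 0 <= rho := le_trans (normr_ge0 _) (ur 0).
split=> [t|t].
  apply: continuous_comp; first exact: clamp_continuous.
  apply: differentiable_continuous; apply/derivable1_diffP.
  by have [] := dWa _ (clamp_le t).
have := @mean_value_sym W (L * rho + be) _ W0 _ _ (clamp_le t).
move=> /(_ _ _)/le_trans; apply.
- by rewrite addr_ge0 // mulr_ge0.
- move=> s /dWa[d1 d2]; split => //; rewrite d2.
  have -> : G s (u s) = (G s (u s) - G s 0) + G s 0 by rewrite subrK.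
  apply: le_trans (ler_normD _ _) _; apply: lerD => //.
  apply: le_trans (GL _ _ _) _ => //; first by rewrite normr0.
  by rewrite subr0 ler_wpM2l.
by move: aL abe; have := ler_wpM2r rho0 aL; nra.
Qed.

(** The contraction factor is [a * L], at most one half. *)
Lemma prim_lip u v u' v' c : 0 <= c -> good u -> good v -> prim u u' -> prim v v' ->
  (forall t, `|u t - v t| <= c) -> forall t, `|u' t - v' t| <= c / 2.
Proof.
move=> c0 [_ ur] [_ vr] [W [W0 dW u'E]] [W' [W'0 dW' v'E]] uv t.
rewrite u'E v'E; pose D (s : R) := W s - W' s; rewrite -/(D (clamp t)).
have -> : c / 2 = c / (2 * a) * a by field; rewrite ?gt_eqF.
have lta (s : R) : `|s| <= a -> `|s| < a + 1.
  by move=> sa; apply: le_lt_trans sa _; rewrite ltrDl.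
apply: mean_value_sym (clamp_le t) => [||s sa].
- by rewrite divr_ge0 // mulr_ge0 // ltW.
- by rewrite /D W0 W'0 subrr.
have [dD eD] : is_derive s 1 D (G s (u s) - G s (v s)).
  by apply: is_deriveB; [exact: dW (lta s sa)|exact: dW' (lta s sa)].
split => //; rewrite eD; apply: le_trans (GL _ _ _) _ => //.
apply: le_trans (ler_wpM2l L0 (uv s)) _.
by rewrite ler_pdivlMr ?mulr_gt0 //; have := ler_wpM2r c0 aL; nra.
Qed.

Theorem picard : exists u : R -> V,
  [/\ u 0 = 0, continuous u, forall t, `|u t| <= rho &
      forall t : R, `|t| < a -> is_derive t 1 u (G t (u t))].
Proof.
have rho0 : 0 <= rho by apply: le_trans abe; rewrite !mulr_ge0 // ltW.
have /choice[T TP] : forall u : {u | good u}, exists u' : {u | good u},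
    prim (sval u) (sval u').
  by move=> [u gu]; have [u' [gu' pu]] := prim_good gu; exists (exist _ u' gu').
have g0 : good (fun=> 0).
  by split; [exact: cst_continuous|move=> t; rewrite normr0].
pose U n := sval (iter n T (exist _ _ g0)).
have gU n : good (U n) by rewrite /U; case: (iter _ _ _).
have pU n : prim (U n) (U n.+1) by exact: TP.
(* The iteration starts from the zero curve, so its first step has size at most [rho]. *)
have U1 n t : `|U n.+1 t - U n t| <= rho * 2^-1 ^+ n.
  elim: n t => [|n IH] t.
    by rewrite /U /= subr0 mulr1; case: (T _) => u [].
  rewrite exprSr mulrA; apply: prim_lip (gU _) (gU _) (pU _) (pU _) IH t.
  by rewrite mulr_ge0 // exprn_ge0 // invr_ge0.
have Uk n k t : `|U (n + k)%N t - U n t| <= 2 * rho * 2^-1 ^+ n - 2 * rho * 2^-1 ^+ (n + k).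
  elim: k => [|k IH]; first by rewrite addn0 !subrr normr0.
  rewrite addnS; have -> : U (n + k).+1 t - U n t =
    (U (n + k).+1 t - U (n + k)%N t) + (U (n + k)%N t - U n t) by rewrite subrKA.
  apply: le_trans (ler_normD _ _) _; apply: le_trans (lerD (U1 _ _) IH) _.
  by rewrite exprS; lra.
have half_small (e : R) : 0 < e -> exists n, 2 * rho * 2^-1 ^+ n < e.
  move=> e0; have : (fun n => 2 * rho * 2^-1 ^+ n) @ \oo --> 0.
    by apply: cvg_geometric; rewrite ger0_norm ?invr_ge0 //; lra.
  move=> /cvgrPdist_lt/(_ e e0)[n _ H]; exists n.
  by have := H n (leqnn n); rewrite /= sub0r normrN => /(le_lt_trans (ler_norm _)).
have lim_le (f : nat -> R) l C : f @ \oo --> l -> (\forall n \near \oo, f n <= C) -> l <= C.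
  move=> fl fC; rewrite -(cvg_lim _ fl) //; apply: limr_le => //.
  by apply/cvg_ex; exists l.
have Uc t : cvgn (fun n => U n t).
  apply: cauchy_cvg; apply: cauchy_exP => e e0; have [n ne] := half_small e e0.
  exists (U n t), n => // k /= nk; rewrite -ball_normE /ball_ /= distrC.
  rewrite -(subnKC nk); apply: le_lt_trans (Uk _ _ _) _; apply: le_lt_trans ne.
  by rewrite lerBlDr lerDl !mulr_ge0 // exprn_ge0 // invr_ge0.
pose u t := limn (fun n => U n t).
have uU n t : `|u t - U n t| <= 2 * rho * 2^-1 ^+ n.
  have cU : (fun k => `|U k t - U n t|) @ \oo --> `|u t - U n t|.
    by apply: cvg_norm; apply: cvgB; [exact: Uc|exact: cvg_cst].
  apply: (lim_le _ _ _ cU); exists n => // k /= nk; rewrite -(subnKC nk).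
  by apply: le_trans (Uk _ _ _) _; rewrite lerBlDr lerDl !mulr_ge0 // exprn_ge0 // invr_ge0.
have cu : continuous u.
  move=> t; apply/cvgrPdist_lt => e e0.
  have e3 : 0 < e / 3 by rewrite divr_gt0.
  have [n ne] := half_small _ e3.
  have /cvgrPdist_lt/(_ _ e3) cUn := (gU n).1 t.
  near=> s.
  have -> : u t - u s = (u t - U n t) + (U n t - U n s) - (u s - U n s).
    by rewrite opprB !subrKA.
  apply: le_lt_trans (ler_normB _ _) _.
  apply: le_lt_trans (lerD (ler_normD _ _) (lexx _)) _.
  have H1 : `|U n t - U n s| < e / 3 by near: s.
  have := uU n t; have := uU n s; move: ne H1; lra.
have ur t : `|u t| <= rho.
  have cU : (fun k => `|U k t|) @ \oo --> `|u t| by apply: cvg_norm; exact: Uc.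
  by apply: (lim_le _ _ _ cU); apply: nearW => k; exact: (gU k).2.
have gu : good u by [].
have [u' [gu' pu']] := prim_good gu.
(* The limit is a fixed point: its image and [u] are both close to [U n.+1], one by contraction and
   the other by convergence. *)
have u'u t : u' t = u t.
  apply/eqP; rewrite -subr_eq0 -normr_le0; apply/ler_addgt0Pl => e e0; rewrite addr0.
  have [n ne] := half_small _ e0; apply: le_trans (ltW ne).
  have -> : u' t - u t = (u' t - U n.+1 t) - (u t - U n.+1 t) by rewrite opprB subrKA.
  apply: le_trans (ler_normB _ _) _.
  have H : `|u' t - U n.+1 t| <= 2 * rho * 2^-1 ^+ n / 2.
    apply: prim_lip gu (gU n) pu' (pU n) (uU n) t.
    by rewrite !mulr_ge0 // exprn_ge0 // invr_ge0.
  apply: le_trans (lerD H (uU _ _)) _.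
  by rewrite exprS; lra.
have [W [W0 dW u'E]] := pu'.
have uE t : u t = W (clamp t) by rewrite -u'u.
exists u; split => //; first by rewrite uE clamp_id ?W0 // normr0 ltW.
move=> t ta; have ta1 : `|t| < a + 1 by apply: lt_trans ta _; rewrite ltrDl.
apply: near_eq_is_derive (dW t ta1).
have : \forall s \near t, `|s| < a.
  exact: cvgr_lt (@norm_continuous _ _ t) _ ta.
by apply: filterS => s sa; rewrite uE clamp_id // ltW.
Unshelve. all: by end_near. Qed.

End Picard.

Lemma continuous_pair (T X Y : topologicalType) (f : T -> X) (g : T -> Y) t :
  {for t, continuous f} -> {for t, continuous g} ->
  {for t, continuous (fun s => (f s, g s))}.
Proof. by move=> cf cg; exact: cvg_pair cf cg. Qed.

(** * Composition with graphs, and uniformity over compact times *)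

Section CkMore.
Context {R : realType}.
Implicit Types (V W : normedModType R).

Lemma continuous_sum (T : topologicalType) V (I : Type) (r : seq I) (f : I -> T -> V) t :
  (forall i, {for t, continuous (f i)}) ->
  {for t, continuous (fun s => \sum_(i <- r) f i s)}.
Proof.
move=> cf; elim: r => [|i r IH].
  have -> : (fun s => \sum_(i <- [::]) f i s) = fun=> 0.
    by apply/funext => s; rewrite big_nil.
  exact: cvg_cst.
have -> : (fun s => \sum_(j <- i :: r) f j s) = fun s => f i s + \sum_(j <- r) f j s.
  by apply/funext => s; rewrite big_cons.
by apply: cvgD; [exact: cf|exact: IH].
Qed.

Lemma continuous_scale (T : topologicalType) V (c : T -> R) (f : T -> V) t :
  {for t, continuous c} -> {for t, continuous f} ->
  {for t, continuous (fun s => c s *: f s)}.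
Proof. by move=> cc cf; exact: cvgZ cc cf. Qed.

Lemma differentiable_row V m (f : V -> 'rV[R]_m.+1) x :
  (forall j, differentiable (fun y => f y 0 j) x) -> differentiable f x.
Proof.
move=> df.
pose F j := fun y => f y 0 j *: (delta_mx 0 j : 'rV[R]_m.+1).
have -> : f = \sum_(j < m.+1) F j.
  by apply/funext => y; rewrite fct_sumE {1}(row_sum_delta (f y)).
by apply: differentiable_sum => j; apply: differentiableZl.
Qed.

Lemma Ck_continuous V W k U (f : V -> W) x : Ck k U f -> U x -> {for x, continuous f}.
Proof. by elim: k => [|k IH]; [exact|move=> /CkW/IH]. Qed.

Lemma Ck_scale V m k U (c : R) (f : V -> 'rV[R]_m.+1) : open U ->
  Ck k U f -> Ck k U (fun x => c *: f x).
Proof.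
move=> oU cf; apply/(Ck_mxP _ _ oU) => j.
apply: (Ck_ext oU _ (Ck_mul oU (@Ck_cst R V R k U c) ((Ck_mxP _ _ oU).1 cf j))) => x _.
by rewrite mxE.
Qed.

Lemma diff_split V W m (F : V * 'rV[R]_m.+1 -> W) z v w : differentiable F z ->
  'd F z (v, w) = 'D_(v, 0) F z + \sum_(a < m.+1) w 0 a *: 'D_(0, delta_mx 0 a) F z.
Proof.
move=> dF.
have -> : (v, w) = (v, 0) + \sum_(a < m.+1) w 0 a *: (0, delta_mx 0 a) :> V * 'rV[R]_m.+1.
  have -> : \sum_(a < m.+1) w 0 a *: (0, delta_mx 0 a) = (0, w) :> V * 'rV[R]_m.+1.
    rewrite {2}(row_sum_delta w); elim/big_rec2: _ => //= a y1 y2 _ ->.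
    by congr (_, _); rewrite /= scaler0 add0r.
  by congr (_, _); rewrite /= ?addr0 ?add0r.
rewrite linearD linear_sum deriveE //; congr (_ + _); apply: eq_bigr => a _.
by rewrite linearZ deriveE.
Qed.

Lemma differentiable_graph V W m (F : V * 'rV[R]_m.+1 -> W) (u : V -> 'rV[R]_m.+1) x :
  differentiable u x -> differentiable F (x, u x) ->
  differentiable (fun y => F (y, u y)) x.
Proof.
move=> du dF; apply: (@differentiable_comp _ _ _ _ (fun y => (y, u y)) F) => //.
exact: differentiable_pair.
Qed.

Lemma derive_graph V W m (F : V * 'rV[R]_m.+1 -> W) (u : V -> 'rV[R]_m.+1) x v :
  differentiable u x -> differentiable F (x, u x) ->
  'D_v (fun y => F (y, u y)) x = 'D_(v, 0) F (x, u x) +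
    \sum_(a < m.+1) 'D_v u x 0 a *: 'D_(0, delta_mx 0 a) F (x, u x).
Proof.
move=> du dF; rewrite deriveE; last exact: differentiable_graph.
rewrite (@diff_comp _ _ _ _ (fun y => (y, u y)) F) //; last exact: differentiable_pair.
rewrite /= diff_pair // -diff_split //= deriveE //.
by rewrite (diff_val (f := id)).
Qed.

(** A directional derivative of the composite is a sum of products of derivatives of [u] with
    composites of the same shape, so the induction on [k] closes. *)
Lemma Ck_graph V m k U (O : set (V * 'rV[R]_m.+1)) (F : V * 'rV[R]_m.+1 -> R)
    (u : V -> 'rV[R]_m.+1) : open U -> open O -> (forall x, U x -> O (x, u x)) ->
  Ck k U u -> Ck k O F -> Ck k U (fun x => F (x, u x)).
Proof.
move=> oU oO UO; elim: k F => [|k IH] F.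
  move=> cu cF x Ux; apply: (@continuous_comp _ _ _ (fun y => (y, u y)) F).
    exact: (cvg_pair (@cvg_id _ (nbhs x)) (cu x Ux)).
  exact/cF/UO.
move=> Cu CF; have [[du cu] [dF cF]] := (Cu, CF); split=> [x Ux|v].
  by apply: differentiable_graph; [exact: du|exact/dF/UO].
have H a := Ck_mul oU ((Ck_mxP _ _ oU).1 (cu v) a) (IH _ (CkW Cu) (cF (0, delta_mx 0 a))).
have := Ck_add oU (IH _ (CkW Cu) (cF (v, 0))) (Ck_sum (index_enum _) oU H).
apply: Ck_ext => // x; rewrite inE => Ux.
by rewrite derive_graph //; [exact: du|exact/dF/UO].
Qed.

(** This is how the linearized equation inherits the constant [L]. *)
Lemma lipschitz_derive V W (f : V -> W) v0 w L :
  (\forall v \near v0, `|f v - f v0| <= L * `|v - v0|) ->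
  derivable f v0 w -> `|'D_w f v0| <= L * `|w|.
Proof.
move=> fL df.
have c : `|x^-1 *: ((f \o shift v0) (x *: w) - f v0)| @[x --> 0^'] --> `|'D_w f v0|.
  exact: cvg_norm df.
rewrite -(cvg_lim _ c) //; apply: limr_le; first by apply/cvg_ex; eexists; exact: c.
have [r r0 H] := (nearP _ _).1 fL.
have : \forall h \near (0 : R), `|h * `|w| | < r.
  have -> : r = `|0 * `|w| | + r by rewrite mul0r normr0 add0r.
  have cc : {for (0 : R), continuous (fun h : R => `|h * `|w| |)}.
    apply: (@continuous_comp _ _ _ (fun h : R => h * `|w|)); last exact: norm_continuous.
    exact: mulrr_continuous.
  by apply: cvgr_lt cc _ _; rewrite ltrDl.
move=> hr; near=> h.
have h0 : h != 0 by near: h; exact: nbhs_dnbhs_neq.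
rewrite normrZ normfV ler_pdivrMl ?normr_gt0 // mulrCA -normrZ.
have E : h *: w = shift v0 (h *: w) - v0 by rewrite /= addrK.
rewrite {2}E; apply: H; rewrite -E normrZ -[`|w|]ger0_norm // -normrM.
by near: h; exact: cvg_within hr.
Unshelve. all: by end_near. Qed.

Lemma is_derive_time V W (f : R * V -> W) (t : R) (x : V) (w : W) :
  is_derive t 1 (fun s : R => f (s, x)) w <-> is_derive (t, x) (1, 0) f w.
Proof.
have E : (fun h : R => h^-1 *: (((fun s : R => f (s, x)) \o shift t) (h *: 1) - f (t, x)))
    = (fun h : R => h^-1 *: ((f \o shift (t, x)) (h *: (1, 0)) - f (t, x))).
  apply/funext => h /=; congr (_ *: (f _ - _)).
  by congr (_, _); rewrite /= scaler0 add0r.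
by split=> -[d1 d2]; apply: DeriveDef; move: d1 d2; rewrite /derivable /derive E.
Qed.

Lemma is_derive_space V' V W (f : V' * V -> W) (t : V') (x y : V) (w : W) :
  is_derive x y (fun z => f (t, z)) w <-> is_derive (t, x) (0, y) f w.
Proof.
have E : (fun h : R => h^-1 *: (((fun z => f (t, z)) \o shift x) (h *: y) - f (t, x)))
    = (fun h : R => h^-1 *: ((f \o shift (t, x)) (h *: (0, y)) - f (t, x))).
  apply/funext => h /=; congr (_ *: (f _ - _)).
  by congr (_, _); rewrite /= scaler0 add0r.
by split=> -[d1 d2]; apply: DeriveDef; move: d1 d2; rewrite /derivable /derive E.
Qed.

Lemma is_derive_small V W (f : V -> W) x v w :
  (forall e : R, 0 < e -> \forall h \near (0 : R),
    `|f (h *: v + x) - f x - h *: w| <= e * `|h|) -> is_derive x v f w.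
Proof.
move=> H; suff c : h^-1 *: ((f \o shift x) (h *: v) - f x) @[h --> 0^'] --> w.
  apply: DeriveDef; last by rewrite /derive; exact: cvg_lim.
  by rewrite /derivable; apply/cvg_ex; exists w.
apply/cvgrPdist_le => e e0; have He := H e e0.
have h1 : \forall h \near (0 : R)^', `|f (h *: v + x) - f x - h *: w| <= e * `|h|.
  exact: cvg_within He.
near=> h.
have h0 : h != 0 by near: h; exact: nbhs_dnbhs_neq.
have -> : w - h^-1 *: ((f \o shift x) (h *: v) - f x) =
    - (h^-1 *: (f (h *: v + x) - f x - h *: w)).
  by rewrite /= [in RHS]scalerBr scalerA mulVf // scale1r opprB.
rewrite normrN normrZ normfV ler_pdivrMl ?normr_gt0 // mulrC.
by near: h; exact: h1.
Unshelve. all: by end_near. Qed.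

Lemma open_slab (a : R) V (B : set V) : open B ->
  open [set p : R * V | `|p.1| < a /\ B p.2].
Proof.
move=> oB; apply: openI.
  apply: (@open_comp _ _ (fun p : R * V => `|p.1|) [set r : R | r < a]) => //.
  move=> p _; apply: (@continuous_comp _ _ _ fst); last exact: norm_continuous.
  exact: continuous_fst.
by apply: (@open_comp _ _ snd B) => // p _; exact: continuous_snd.
Qed.

(** The tube lemma for the compact interval [[-b, b]]. *)
Lemma compact_near_segment (X : topologicalType) (b : R) (x0 : X) (P : X -> R -> Prop) :
  (forall t, `|t| <= b -> \forall s \near t & x \near x0, P x s) ->
  \forall x \near x0, forall t : R, `|t| <= b -> P x t.
Proof.
move=> H.
have := (compact_near_coveringP _).1 (@segment_compact R (- b) b) X (nbhs x0) P _.
move=> /(_ (nbhs_filter x0)) K.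
have itvE t : `[- b, b]%classic t <-> `|t| <= b by rewrite /= in_itv /= -ler_norml.
have {}K : \forall x \near x0, `[- b, b]%classic `<=` P x.
  by apply: K => t /itvE; exact: H.
by apply: filterS K => x Kx t /itvE; exact: Kx.
Qed.

Lemma compact_uniform (X : topologicalType) W (b : R) (x0 : X) (f : R * X -> W) :
  (forall t : R, `|t| <= b -> {for (t, x0), continuous f}) ->
  forall e : R, 0 < e ->
  \forall x \near x0, forall t : R, `|t| <= b -> `|f (t, x) - f (t, x0)| <= e.
Proof.
move=> cf e e0; apply: compact_near_segment => t tb.
have e2 : 0 < e / 2 by rewrite divr_gt0.
have /cvgrPdist_le/(_ _ e2)[[A B] [/= tA xB] AB] := cf t tb.
exists (A, B) => // -[s x] [/= As Bx].
have h1 := AB (s, x) (conj As Bx).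
have h2 := AB (s, x0) (conj As (nbhs_singleton xB)).
have -> : f (s, x) - f (s, x0) = (f (t, x0) - f (s, x0)) - (f (t, x0) - f (s, x)).
  by rewrite opprB [RHS]addrC subrKA.
apply: le_trans (ler_normB _ _) _; apply: le_trans (lerD h2 h1) _.
by rewrite -splitr.
Qed.

End CkMore.

(** * Smooth dependence on the initial point *)

Section ParametricODE.
Context {R : realType} {d : nat}.
Let X := 'rV[R]_d.+1.
Variables (a L : R) (B : set X).
Hypotheses (a0 : 0 < a) (L0 : 0 <= L) (aL : 2 * a * L <= 2^-1) (oB : open B).
Let S : set (R * X) := [set p | `|p.1| < a /\ B p.2].

(** The unknown is the displacement from the initial point, zero at time 0 for every parameter; its
    space derivatives then also vanish at time 0 and solve a problem of the same form. [Q] confines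
    the values, as a nonlinear [F] is Lipschitz only locally. *)
Definition param_solution m (Q : set 'rV[R]_m.+1)
    (F : (R * X) * 'rV[R]_m.+1 -> 'rV[R]_m.+1) (u : R * X -> 'rV[R]_m.+1) :=
  [/\ forall p v w, S p -> Q v -> Q w -> `|F (p, v) - F (p, w)| <= L * `|v - w|,
      forall p, S p -> Q (u p),
      forall x, B x -> u (0, x) = 0 &
      forall p, S p -> is_derive p (1, 0) u (F (p, u p))].

Section Equation.
Variables (m : nat).
Let U := 'rV[R]_m.+1.
Variables (Q : set U) (F : (R * X) * U -> U) (u : R * X -> U).
Hypothesis oQ : open Q.
Hypothesis sol : param_solution Q F u.
Let O : set ((R * X) * U) := [set z | S z.1 /\ Q z.2].

Lemma open_SQ : open O.
Proof.
apply: openI.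
  by apply: (@open_comp _ _ fst S) => [p _|]; [exact: continuous_fst|exact: open_slab].
by apply: (@open_comp _ _ snd Q) => // p _; exact: continuous_snd.
Qed.

Let uO p : S p -> O (p, u p).
Proof. by case: sol => _ uQ _ _ Sp; split => //; exact: uQ. Qed.

Let dut x (t : R) : B x -> `|t| < a ->
  is_derive t 1 (fun s : R => u (s, x)) (F ((t, x), u (t, x))).
Proof. by case: sol => _ _ _ du Bx ta; apply/is_derive_time/du. Qed.

Let cut x (t : R) : B x -> `|t| < a -> {for t, continuous (fun s : R => u (s, x))}.
Proof.
move=> Bx ta; apply: differentiable_continuous; apply/derivable1_diffP.
by have [] := dut Bx ta.
Qed.

(** The solutions started at [x] and [x0] differ by [w] with [|w'| <= L * |w| + de], where [de]
    measures the change of [F] in its parameter along the fixed curve [u (., x0)], uniformly in time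
    by compactness. *)
Lemma solution_continuous : (forall z, O z -> {for z, continuous F}) ->
  forall p, S p -> {for p, continuous u}.
Proof.
move=> cF [t0 x0] [/= t0a Bx0].
pose b := (`|t0| + a) / 2.
have t0b : `|t0| < b by rewrite /b; move: t0a; lra.
have ba : b < a by rewrite /b; move: t0a; lra.
have b0 : 0 < b by exact: le_lt_trans t0b.
apply/cvgrPdist_le => e e0.
(* On [[-b, b]] with [b < a] the estimate for [w] is [4 * b * de], hence at most [e / 2]; the other
   half is for the continuity of [u] in time at [x0]. *)
pose de := e / (8 * a); have de0 : 0 < de by rewrite divr_gt0 // mulr_gt0.
have cPsi (t : R) : `|t| <= b ->
    {for (t, x0), continuous (fun z : R * X => F (z, u (z.1, x0)))}.
  move=> tb; have ta : `|t| < a := le_lt_trans tb ba.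
  apply: (@continuous_comp _ _ _ (fun z : R * X => (z, u (z.1, x0))) F).
    apply: continuous_pair; first exact: cvg_id.
    apply: (@continuous_comp _ _ _ fst (fun s => u (s, x0))); first exact: continuous_fst.
    exact: cut.
  by apply/cF/uO.
have H := compact_uniform cPsi de0.
have HB : \forall x \near x0, B x by exact: open_nbhs_nbhs.
have e2 : 0 < e / 2 by rewrite divr_gt0.
have /cvgrPdist_le/(_ _ e2) Hu := cut Bx0 t0a.
have Hb : \forall s \near t0, `|s| < b by exact: cvgr_lt (@norm_continuous _ _ t0) _ t0b.
have Ht := filterI Hb Hu; have Hx := filterI HB H.
exists ([set s | `|s| < b /\ `|u (t0, x0) - u (s, x0)| <= e / 2],
  [set x | B x /\ forall t : R, `|t| <= b ->
    `|F ((t, x), u (t, x0)) - F ((t, x0), u (t, x0))| <= de]).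
  split; [exact: Ht|exact: Hx].
move=> -[s x] [/= [sb us] [Bx Fx]].
pose w (r : R) := u (r, x) - u (r, x0).
have dw r : - b <= r <= b -> derivable w r 1 /\ `|'D_1 w r| <= L * `|w r| + de.
  rewrite -ler_norml => rb; have ra := le_lt_trans rb ba.
  have [dw ew] : is_derive r 1 w (F ((r, x), u (r, x)) - F ((r, x0), u (r, x0))).
    by apply: is_deriveB; exact: dut.
  split => //; rewrite ew.
  have -> : F ((r, x), u (r, x)) - F ((r, x0), u (r, x0)) =
     (F ((r, x), u (r, x)) - F ((r, x), u (r, x0))) +
     (F ((r, x), u (r, x0)) - F ((r, x0), u (r, x0))) by rewrite subrKA.
  apply: le_trans (ler_normD _ _) _; apply: lerD; last exact: Fx.
  by case: sol => FL uQ _ _; apply: FL => //; apply: uQ.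
have w0 : w 0 = 0 by case: sol => _ _ u0 _; rewrite /w !u0 // subrr.
have := @short_gronwall R m w (- b) b 0 L de _ L0 (ltW de0) _ w0 dw s.
rewrite oppr_le0 (ltW b0) -ler_norml (ltW sb) => /(_ isT _ isT) ws.
have {ws} ws : `|w s| <= e / 2.
  apply: le_trans (ws _) _.
    by move: aL; have := ler_wpM2r L0 (ltW ba); lra.
  have -> : e / 2 = 2 * (a + a) * de by rewrite /de; field; rewrite gt_eqF.
  by rewrite ler_wpM2r ?ltW //; move: ba; lra.
have -> : u (t0, x0) - u (s, x) = (u (t0, x0) - u (s, x0)) - w s.
  by rewrite /w opprB subrKA.
by apply: le_trans (ler_normB _ _) _; move: us ws; lra.
Qed.

(** The right-hand side of the variational equation: [z.2] stands for the derivative of [u] in the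
    spatial direction [y]. It is spelled out in partial derivatives of [F], the form in which [Ck]
    controls it. *)
Definition linearized (y : X) (z : (R * X) * U) : U :=
  'D_((0, y), 0) F (z.1, u z.1) +
  \sum_(i < m.+1) z.2 0 i *: 'D_(0, delta_mx 0 i) F (z.1, u z.1).

Hypothesis dF : forall z, O z -> differentiable F z.
Hypothesis cDF : forall v z, O z -> {for z, continuous (fun z => 'D_v F z)}.

Lemma linearizedE y p v : S p -> linearized y (p, v) = 'd F (p, u p) ((0, y), v).
Proof. by move=> Sp; rewrite diff_split //; exact/dF/uO. Qed.

Lemma linearized_lipschitz y p v w : S p ->
  `|linearized y (p, v) - linearized y (p, w)| <= L * `|v - w|.
Proof.
move=> Sp; rewrite !linearizedE // -linearB /=.
have -> : ((0, y), v) - ((0, y), w) = (0, v - w) :> (R * X) * U.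
  by congr (_, _); rewrite /= subrr.
have dFu := dF (uO Sp).
rewrite -deriveE //.
have [dFp <-] : is_derive (u p) (v - w) (fun q => F (p, q)) ('D_(0, v - w) F (p, u p)).
  by apply/is_derive_space/derivableP/diff_derivable.
apply: lipschitz_derive => //.
have HQ : \forall q \near u p, Q q by apply: open_nbhs_nbhs; split => //; exact: (uO Sp).2.
by apply: filterS HQ => q Qq; case: sol => FL uQ _ _; apply: FL => //; exact: uQ.
Qed.

Let lin_cont (T : topologicalType) y (t0 : T) (Y : T -> (R * X) * U) (v : T -> U) :
  {for t0, continuous Y} -> {for t0, continuous v} -> O (Y t0) ->
  {for t0, continuous (fun t => 'D_((0, y), 0) F (Y t) +
     \sum_(i < m.+1) v t 0 i *: 'D_(0, delta_mx 0 i) F (Y t))}.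
Proof.
move=> cY cv OY.
have cD w : {for t0, continuous (fun t => 'D_w F (Y t))}.
  by apply: (@continuous_comp _ _ _ Y (fun z => 'D_w F z)) => //; exact: cDF.
apply: cvgD; first exact: cD.
apply: continuous_sum => i; apply: cvgZ; last exact: cD.
apply: (@continuous_comp _ _ _ v (fun N : U => N 0 i)) => //.
exact: coord_continuous.
Qed.

(** The candidate [z] for the derivative is obtained by solving the variational equation; the
    remainder [u (t, h *: y + x0) - u (t, x0) - h *: z t] is then shown to be small compared with
    [h] by the short-interval estimate. *)
Lemma solution_derive_space x0 y b : B x0 -> 0 < b -> b < a ->
  exists z : R -> U, z 0 = 0 /\ forall t : R, `|t| < b ->
    is_derive (t, x0) (0, y) u (z t) /\
    is_derive t 1 z (linearized y ((t, x0), z t)).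
Proof.
move=> Bx0 b0 ba.
have Sc t : S (clamp b t, x0) by split => //=; apply: le_lt_trans ba; exact: clamp_le.
(* Picard iteration expects a right-hand side at all real times, while the linearized one is
   controlled only in the slab; clamping to [[-b, b]] stays inside it. *)
pose G t v := linearized y ((clamp b t, x0), v).
have Gc (v : R -> U) : continuous v -> continuous (fun t => G t (v t)).
  move=> cv t; apply: (@lin_cont _ y t (fun t => ((clamp b t, x0), u (clamp b t, x0))) v).
  - have ct : {for t, continuous (fun t => (clamp b t, x0))}.
      by apply: continuous_pair; [exact: clamp_continuous|exact: cvg_cst].
    apply: continuous_pair; first exact: ct.
    apply: (@continuous_comp _ _ _ (clamp b) (fun s => u (s, x0))).
      exact: clamp_continuous.
    by apply: cut => //; exact: (Sc t).1.
  - exact: cv.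
  - exact: uO.
have [be be0 G0] : exists2 be, 0 <= be & forall t, `|G t 0| <= be.
  have [||c _ cmax] := @EVT_max R (fun t => `|G t 0|) (- b) b.
  - by move: b0; lra.
  - apply: continuous_subspaceT => t; apply: (@continuous_comp _ _ _ (fun t => G t 0)).
      exact/Gc/cst_continuous.
    exact: norm_continuous.
  exists `|G c 0|; first exact: normr_ge0.
  move=> t.
  have -> : G t 0 = G (clamp b t) 0 by rewrite /G (@clamp_id _ b (clamp b t)) // clamp_le.
  by apply: cmax; rewrite in_itv /= -ler_norml clamp_le.
have bL : b * L <= 2^-1 by move: aL; have := ler_wpM2r L0 (ltW ba); have := mulr_ge0 (ltW b0) L0; lra.
(* The linearized equation is Lipschitz on the whole space, so the radius can be chosen as large as
   the bound [be] requires. *)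
have [z [z0 cz _ dz]] := @picard R m b L be (2 * b * be) G b0 L0 be0 bL (lexx _)
  (fun v cv _ => Gc v cv) (fun t v w _ _ => linearized_lipschitz y v w (Sc t)) G0.
exists z; split => // t1 t1b; split; last first.
  by have := dz t1 t1b; rewrite /G (clamp_id (ltW t1b)).
apply/is_derive_space; apply: is_derive_small => e e0.
pose c := (`|t1| + b) / 2.
have t1c : `|t1| < c by rewrite /c; move: t1b; lra.
have cb : c < b by rewrite /c; move: t1b; lra.
have c0 : 0 < c by exact: le_lt_trans t1c.
(* The final bound on [[-c, c]] is [4 * c * de * |h|] with [c < a]. *)
pose de := e / (4 * a); have de0 : 0 < de by rewrite divr_gt0 // mulr_gt0.
pose ze (t : R) : (R * X) * U := ((0, y), z t).
(* For fixed [t] this is the line through [((t, x0), u (t, x0))] with velocity [((0, y), z t)].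
   [Psi (t, s)] below is the derivative of [F] along it, and at [s = 0] it is the right-hand side of
   the equation for [z]. *)
pose Y (p : R * R) : (R * X) * U := p.2 *: ze p.1 + ((p.1, x0), u (p.1, x0)).
have Y0 t : Y (t, 0) = ((t, x0), u (t, x0)) by rewrite /Y /= scale0r add0r.
have YE t s : Y (t, s) = ((t, s *: y + x0), s *: z t + u (t, x0)).
  by congr (_, _); congr (_, _); rewrite /= scaler0 add0r.
have St (t : R) : `|t| <= c -> S (t, x0).
  by move=> tc; split => //=; apply: le_lt_trans tc _; exact: lt_trans cb ba.
have OY0 (t : R) : `|t| <= c -> O (Y (t, 0)) by move=> tc; rewrite Y0; exact/uO/St.
have cY (t : R) : `|t| <= c -> {for (t, 0), continuous Y}.
  move=> tc; have [/= ta _] := St t tc.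
  have c1 : {for (t, 0 : R), continuous (fun p : R * R => ((p.1, x0), u (p.1, x0)))}.
    apply: continuous_pair.
      by apply: continuous_pair; [exact: continuous_fst|exact: cvg_cst].
    apply: (@continuous_comp _ _ _ fst (fun s => u (s, x0))); first exact: continuous_fst.
    exact: cut.
  have c2 : {for (t, 0 : R), continuous (fun p : R * R => ze p.1)}.
    apply: continuous_pair; first exact: cvg_cst.
    apply: (@continuous_comp _ _ _ fst z); first exact: continuous_fst.
    exact: cz.
  by apply: cvgD c1; apply: cvgZ c2; exact: continuous_snd.
pose Psi (p : R * R) := 'D_((0, y), 0) F (Y p) +
  \sum_(i < m.+1) z p.1 0 i *: 'D_(0, delta_mx 0 i) F (Y p).
have cPsi (t : R) : `|t| <= c -> {for (t, 0), continuous Psi}.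
  move=> tc; apply: (lin_cont (Y := Y) (v := fun p : R * R => z p.1)).
  - exact: cY.
  - apply: (@continuous_comp _ _ _ fst z); first exact: continuous_fst.
    exact: cz.
  - exact: OY0.
have H1 := compact_uniform cPsi de0.
have H2 : \forall s \near (0 : R), forall t : R, `|t| <= c -> O (Y (t, s)).
  apply: compact_near_segment => t tc; have := cY t tc.
  by move=> /(_ O); apply; apply: open_nbhs_nbhs; split; [exact: open_SQ|exact: OY0].
have [r r0 H] := (nearP _ _).1 (filterI H1 H2).
apply/nearP; exists r => // h; rewrite subr0 => hr.
have HY (s t : R) : `|s| <= `|h| -> `|t| <= c ->
    O (Y (t, s)) /\ `|Psi (t, s) - Psi (t, 0)| <= de.
  move=> sh tc; have [|G1 G2] := H s; first by rewrite subr0; exact: le_lt_trans hr.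
  by split; [exact: G2|exact: G1].
have PsiE t s : O (Y (t, s)) -> Psi (t, s) = 'D_(ze t) F (Y (t, s)).
  by move=> OY; rewrite deriveE ?diff_split //; exact: dF.
have Taylor (t : R) : `|t| <= c ->
    `|F (Y (t, h)) - F (Y (t, 0)) - h *: Psi (t, 0)| <= de * `|h|.
  move=> tc.
  pose W (s : R) := F (Y (t, s)) - F (Y (t, 0)) - s *: Psi (t, 0).
  apply: (@mean_value_sym R m `|h| W de) => //; [exact: ltW| |].
    by rewrite /W subrr scale0r subrr.
  move=> s sh; have [OY Psis] := HY s t sh tc.
  have dF1 : is_derive s 1 (fun s => F (Y (t, s))) (Psi (t, s)).
    rewrite (PsiE _ _ OY).
    by apply: (@is_derive_line _ _ _ F ((t, x0), u (t, x0)) (ze t)); exact/diff_derivable/dF.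
  have d2 : is_derive s 1 (fun r : R => r *: Psi (t, 0)) (Psi (t, 0)).
    have := is_derive_line (f := id) (x := 0) (s := s) (@derivable_id _ _ _ (Psi (t, 0))).
    rewrite derive_id; have -> // : (fun r : R => id (r *: Psi (t, 0) + 0)) =
      (fun r : R => r *: Psi (t, 0)) by apply/funext => r'; rewrite addr0.
  have d3 := is_derive_cst (F (Y (t, 0))) s (1 : R).
  have [dW eW] : is_derive s 1 W (Psi (t, s) - 0 - Psi (t, 0)).
    exact: (@is_deriveB _ _ _ _ _ _ _ _ _ (@is_deriveB _ _ _ _ _ _ _ _ _ dF1 d3) d2).
  by split => //; rewrite eW subr0.
have Bh : B (h *: y + x0).
  have [|[[_ Bh] _] _] := HY h 0 (lexx _); first by rewrite normr0 ltW.
  by move: Bh; rewrite YE.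
pose w (t : R) := u (t, h *: y + x0) - u (t, x0) - h *: z t.
have dw (t : R) : - c <= t <= c -> derivable w t 1 /\ `|'D_1 w t| <= L * `|w t| + de * `|h|.
  rewrite -ler_norml => tc.
  have tb : `|t| < b := le_lt_trans tc cb; have ta : `|t| < a := lt_trans tb ba.
  have E : linearized y ((t, x0), z t) = Psi (t, 0) by rewrite /Psi Y0.
  have dzt : is_derive t 1 z (Psi (t, 0)).
    by have := dz t tb; rewrite /G (clamp_id (ltW tb)) E.
  have [dw ew] : is_derive t 1 w (F ((t, h *: y + x0), u (t, h *: y + x0)) -
      F ((t, x0), u (t, x0)) - h *: Psi (t, 0)).
    apply: is_deriveB; first by apply: is_deriveB; exact: dut.
  split; first exact: dw.
  rewrite ew -(Y0 t).
  set A := F ((t, _), _).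
  (* In the first difference the parameters agree and the values differ by [w t], so the Lipschitz
     bound applies; the second is a Taylor remainder. *)
  have -> : A - F (Y (t, 0)) - h *: Psi (t, 0) =
      (A - F (Y (t, h))) + (F (Y (t, h)) - F (Y (t, 0)) - h *: Psi (t, 0)).
    by rewrite [RHS]addrA subrKA.
  apply: le_trans (ler_normD _ _) _; apply: lerD; last exact: Taylor tc.
  have [[_ QY] _] := HY h t (lexx _) tc.
  have := sol; case => FL uQ _ _.
  have := FL (t, h *: y + x0) (u (t, h *: y + x0)) (Y (t, h)).2 _ _ QY.
  rewrite YE /= opprD addrA addrAC; apply; first by split.
  by apply: uQ; split.
have w0 : w 0 = 0.
  by case: sol => _ _ u0 _; rewrite /w !u0 // z0 scaler0 !subr0.
have deh : 0 <= de * `|h| by rewrite mulr_ge0 // ltW.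
have := @short_gronwall R m w (- c) c 0 L (de * `|h|) _ L0 deh _ w0 dw t1.
rewrite oppr_le0 (ltW c0) -ler_norml (ltW t1c) => /(_ isT _ isT) ws.
apply: le_trans (ws _) _.
  by move: aL; have := ler_wpM2r L0 (ltW (lt_trans cb ba)); lra.
rewrite mulrA ler_wpM2r // /de.
have eE : 4 * a * (e / (4 * a)) = e by field; rewrite gt_eqF.
rewrite -[leRHS]eE.
by rewrite ler_wpM2r ?ltW //; move: (lt_trans cb ba); lra.
Qed.

End Equation.

(** Linearizing costs [F] one order and uses [u] only at order [k], which the induction below has
    already reached. *)
Lemma linearized_Ck m k (Q : set 'rV[R]_m.+1) (F : (R * X) * 'rV[R]_m.+1 -> 'rV[R]_m.+1)
    (u : R * X -> 'rV[R]_m.+1) y : open Q -> param_solution Q F u ->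
  Ck k.+1 [set z | S z.1 /\ Q z.2] F -> Ck k S u ->
  Ck k [set z | S z.1 /\ [set: 'rV[R]_m.+1] z.2] (linearized F u y).
Proof.
move=> oQ sol CF uk.
have oS : open S by exact: open_slab.
have oO := open_SQ oQ.
have oO' := @open_SQ m setT openT.
have H v j : Ck k [set z | S z.1 /\ [set: 'rV[R]_m.+1] z.2]
    (fun z : (R * X) * 'rV[R]_m.+1 => 'D_v F (z.1, u z.1) 0 j).
  apply: (@Ck_sub _ _ _ k (fst @^-1` S)) => [z []//|].
  apply: (@Ck_linear_comp _ _ _ _ k fst S (fun p => 'D_v F (p, u p) 0 j)).
    exact: continuous_fst.
  apply: (Ck_graph oS oO (F := fun z => 'D_v F z 0 j)) => //.
    by case: sol => _ uQ _ _ p Sp; split => //; exact: uQ.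
  exact: (Ck_mxP _ _ oO).1 (CF.2 v) j.
have Hc i : Ck k [set z | S z.1 /\ [set: 'rV[R]_m.+1] z.2]
    (fun z : (R * X) * 'rV[R]_m.+1 => z.2 0 i).
  apply: (@Ck_sub _ _ _ k (snd @^-1` setT)) => [z []//|].
  apply: (@Ck_linear_comp _ _ _ _ k snd setT (fun v : 'rV[R]_m.+1 => v 0 i)).
    exact: continuous_snd.
  apply: (Ck_mxP k (fun v : 'rV[R]_m.+1 => v) openT).1.
  by apply: (@Ck_linear _ _ _ k setT idfun) => x; exact: cvg_id.
apply/(Ck_mxP _ _ oO') => j.
have H2 i := Ck_mul oO' (Hc i) (H (0, delta_mx 0 i) j).
have := Ck_add oO' (H ((0, y), 0) j) (Ck_sum (index_enum _) oO' H2).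
apply: Ck_ext => // z _; rewrite /linearized mxE summxE; congr (_ + _).
by apply: eq_bigr => i _; rewrite mxE.
Qed.

(** The induction runs over all equations on the same slab at once, so that it applies to the
    linearized equation, with [Q] the whole space. Time derivatives are read off the equation, and
    the two kinds combine by linearity. *)
Theorem param_solution_Ck k m (Q : set 'rV[R]_m.+1)
    (F : (R * X) * 'rV[R]_m.+1 -> 'rV[R]_m.+1) (u : R * X -> 'rV[R]_m.+1) :
  open Q -> param_solution Q F u -> Ck k [set z | S z.1 /\ Q z.2] F -> Ck k S u.
Proof.
elim: k Q F u => [|k IH] Q F u oQ sol CF; first exact: solution_continuous sol CF.
have uk : Ck k S u := IH _ _ _ oQ sol (CkW CF).
have oS : open S by exact: open_slab.
have oO := open_SQ oQ.
have dF := CF.1.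
have cDF v z : S z.1 /\ Q z.2 -> {for z, continuous (fun z => 'D_v F z)}.
  by move=> Oz; exact: Ck_continuous (CF.2 v) Oz.
have dsp y (t : R) x : B x -> `|t| < a ->
    derivable u (t, x) (0, y) /\
    is_derive (t, x) (1, 0) (fun p => 'D_(0, y) u p)
      (linearized F u y ((t, x), 'D_(0, y) u (t, x))).
  move=> Bx ta; pose b := (`|t| + a) / 2.
  have tb : `|t| < b by rewrite /b; move: ta; lra.
  have ba : b < a by rewrite /b; move: ta; lra.
  have b0 : 0 < b by exact: le_lt_trans tb.
  have [z [z0 dz]] := solution_derive_space oQ sol dF cDF y Bx b0 ba.
  have [[du duE] dzt] := dz t tb; split; first exact: du.
  rewrite duE.
  apply/is_derive_time; apply: near_eq_is_derive dzt.
  have : \forall s \near t, `|s| < b by exact: cvgr_lt (@norm_continuous _ _ t) _ tb.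
  by apply: filterS => s sb; have [[_ ->]] := dz s sb.
have Cy y : Ck k S (fun p => 'D_(0, y) u p).
  apply: IH openT _ (linearized_Ck y oQ sol CF uk); split => //.
  - by move=> p v w Sp _ _; apply: (linearized_lipschitz oQ sol).
  - move=> x Bx; have [||z [z0 dz]] := solution_derive_space (b := a / 2) oQ sol dF cDF y Bx.
    + by rewrite divr_gt0.
    + by move: a0; lra.
    by have [|[_ ->]] := dz 0; first by rewrite normr0 divr_gt0.
  - by move=> [t x] [/= ta Bx]; have [] := dsp y t x Bx ta.
have Ct : Ck k S (fun p => F (p, u p)).
  apply/(Ck_mxP _ _ oS) => j.
  apply: (Ck_graph oS oO (F := fun z => F z 0 j)) => //.
    by case: sol => _ uQ _ _ p Sp; split => //; exact: uQ.
  exact: (Ck_mxP _ _ oO).1 (CkW CF) j.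
have dt p : S p -> is_derive p (1, 0) u (F (p, u p)) by case: sol => _ _ _; exact.
(* Joint differentiability follows from the continuity of the partial derivatives: [Ct] gives it in
   time, [Cy] in space. *)
have du p : S p -> differentiable u p.
  move=> Sp; apply: differentiable_row => j.
  have Sn : \forall q \near p, S q by exact: open_nbhs_nbhs.
  have dj v q : derivable u q v -> derivable (fun y => u y 0 j) q v /\
      'D_v (fun y => u y 0 j) q = 'D_v u q 0 j.
    move=> dq; split; first exact: ((derivable_mxP u q v).1 dq).
    by rewrite derive_mx // mxE.
  have cj v (f : R * X -> 'rV[R]_m.+1) : Ck k S f ->
      (forall q, S q -> is_derive q v u (f q)) ->
      {for p, continuous ('D_v (fun y => u y 0 j))}.
    move=> Cf df; apply: (@Ck_continuous _ _ _ k S) Sp.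
    apply: (Ck_ext oS _ ((Ck_mxP _ _ oS).1 Cf j)) => q; rewrite inE => Sq.
    by have [d1 d2] := df q Sq; rewrite (dj v q d1).2 d2.
  apply: differentiable_time_row.
  - by apply: filterS Sn => q Sq; apply: (dj _ _ _).1; have [] := dt q Sq.
  - exact: cj Ct dt.
  - move=> y; apply: filterS Sn => -[t x] [/= ta Bx].
    by apply: (dj _ _ _).1; have [] := dsp y t x Bx ta.
  - move=> y; apply: cj (Cy y) _ => -[t x] [/= ta Bx].
    by apply: derivableP; have [] := dsp y t x Bx ta.
split => // -[s y].
have := Ck_add oS (Ck_scale s oS Ct) (Cy y).
apply: Ck_ext => // p; rewrite inE => Sp.
have -> : (s, y) = s *: (1, 0) + (0, y) :> R * X.
  by congr (_, _); rewrite /= ?scaler0 ?add0r // addr0 [RHS]mulr1.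
rewrite [RHS]deriveE; last exact: du.
rewrite linearD linearZ -!deriveE; try exact: du.
by have [_ ->] := dt p Sp.
Qed.

End ParametricODE.

(** * Local flows of smooth fields on open sets of rows *)

Section LocalFlow.
Context {R : realType} {d : nat}.
Let X := 'rV[R]_d.+1.
Implicit Types (x y v : X) (O : set X).

Lemma locally_lipschitz O (f : X -> X) x0 : open O -> O x0 -> Ck 1 O f ->
  exists r L : R, [/\ 0 < r, 0 < L, forall x, `|x - x0| < r -> O x,
    forall x, `|x - x0| < r -> `|f x| <= `|f x0| + 1 &
    forall x y, `|x - x0| < r -> `|y - x0| < r -> `|f y - f x| <= L * `|y - x|].
Proof.
move=> oO Ox0 [df cf].
(* The summand 1 makes the bound valid near [x0] by continuity, and makes the resulting Lipschitz
   constant positive. *)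
pose K (j : nat) := `|'D_(delta_mx 0 (inord j)) f x0| + 1.
have H1 : \forall y \near x0, O y by exact: open_nbhs_nbhs.
have H2 : \forall y \near x0, `|f y| <= `|f x0| + 1.
  have c : {for x0, continuous (fun y => `|f y|)}.
    apply: (@continuous_comp _ _ _ f); last exact: norm_continuous.
    exact/differentiable_continuous/df.
  by apply: cvgr_le c _ _; rewrite ltrDl.
have H3 : \forall y \near x0, forall j, (j < d.+1)%N ->
    `|'D_(delta_mx 0 (inord j)) f y| <= K j.
  apply: near_ord => j _.
  have c : {for x0, continuous (fun y => `|'D_(delta_mx 0 (inord j)) f y|)}.
    apply: (@continuous_comp _ _ _ (fun y => 'D_(delta_mx 0 (inord j)) f y)).
      exact: cf.
    exact: norm_continuous.
  by apply: cvgr_le c _ _; rewrite ltrDl.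
have [r r0 H] := (nearP _ _).1 (filterI H1 (filterI H2 H3)).
have K1 j : 1 <= K j by rewrite lerDr.
exists r, (\sum_(j < d.+1) K j); split => //.
- rewrite big_ord_recl; apply: ltr_wpDr; last exact: lt_le_trans (K1 _).
  by apply: sumr_ge0 => j _; exact: le_trans (K1 _).
- by move=> x /H[].
- by move=> x /H[_ []].
move=> x y xr yr; pose W (s : R) := f (s *: (y - x) + x).
have xyr (s : R) : 0 <= s <= 1 -> `|s *: (y - x) + x - x0| < r.
  move=> /andP[s0 s1].
  have -> : s *: (y - x) + x - x0 = s *: (y - x0) + (1 - s) *: (x - x0).
    by rewrite scalerBl scale1r addrCA -scalerBr opprB [_ + (x0 - x)]addrA subrK addrC addrA addrAC.
  apply: le_lt_trans (ler_normD _ _) _; rewrite !normrZ ger0_norm // ger0_norm ?subr_ge0 //.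
  pose D := Num.max `|y - x0| `|x - x0|.
  have Dr : D < r by rewrite gt_max yr xr.
  apply: le_lt_trans Dr; have -> : D = s * D + (1 - s) * D by ring.
  by apply: lerD; rewrite ler_wpM2l ?subr_ge0 // le_max lexx ?orbT.
have := @mean_value_le R d W 0 1 ((\sum_(j < d.+1) K j) * `|y - x|) ler01.
have -> : W 0 = f x by rewrite /W scale0r add0r.
have -> : W 1 = f y by rewrite /W scale1r subrK.
rewrite subr0 mulr1; apply => s /xyr /H[Os [_ Ds]].
have dfs := df _ Os.
have [dW eW] := is_derive_line (@diff_derivable _ _ _ _ _ (y - x) dfs).
split; first exact: dW.
rewrite eW deriveE // diff_delta // mulr_suml.
apply: le_trans (ler_norm_sum _ _ _) _; apply: ler_sum => j _.
rewrite normrZ mulrC; apply: ler_pM => //; last exact: row_norm_coord.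
by have := Ds j (ltn_ord j); rewrite inord_val.
Qed.

Theorem local_flow O (f : X -> X) x0 : open O -> O x0 -> smooth O f ->
  exists (a r : R) (th : R * X -> X), let S := [set p : R * X | `|p.1| < a /\ `|p.2 - x0| < r] in
  [/\ 0 < a /\ 0 < r, smooth S th, forall x, `|x - x0| < r -> th (0, x) = x,
      forall p, S p -> O (th p) &
      forall p, S p -> is_derive p (1, 0) th (f (th p))].
Proof.
move=> oO Ox0 sf.
have [r' [L [r'0 L0 rO rf rL]]] := locally_lipschitz oO Ox0 (sf 1%N).
(* Initial points stay within [rho] of [x0] and displacements below [2 * rho], which together remain
   in the ball of radius [r']. The open ball [Q] of radius [2 * rho] contains the closed one of
   radius [rho] where Picard iteration keeps the displacement. *)
pose rho := r' / 3; have rho0 : 0 < rho by rewrite divr_gt0.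
pose be := `|f x0| + 1; have be0 : 0 < be by rewrite ltr_wpDl.
(* The first bound gives [2 * a * L <= 2^-1], as smooth dependence requires; the second is the
   condition [abe] of Picard iteration. *)
pose a := Num.min (4 * L)^-1 (rho / (2 * be)).
have a0 : 0 < a by rewrite lt_min invr_gt0 !divr_gt0 ?mulr_gt0.
have aL : 4 * a * L <= 1.
  have := ge_min (4 * L)^-1 (4 * L)^-1 (rho / (2 * be)); rewrite lexx /= -/a.
  by rewrite -[(4 * L)^-1]mul1r ler_pdivlMr ?mulr_gt0 //; lra.
have abe : 2 * a * be <= rho.
  have := ge_min (rho / (2 * be)) (4 * L)^-1 (rho / (2 * be)); rewrite lexx orbT -/a.
  by rewrite ler_pdivlMr ?mulr_gt0 //; lra.
pose B := [set x | `|x - x0| < rho].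
have oB : open B.
  apply: (@open_comp _ _ (fun x => `|x - x0|) [set s : R | s < rho]) => // x _.
  apply: (@continuous_comp _ _ _ (fun x => x - x0)); last exact: norm_continuous.
  by apply: continuousB; [exact: cvg_id|exact: cst_continuous].
pose Q := [set v : X | `|v| < 2 * rho].
have oQ : open Q.
  by apply: (@open_comp _ _ (fun v : X => `|v|) [set s : R | s < 2 * rho]) => // x _; exact: norm_continuous.
have BQ x v : B x -> Q v -> `|x + v - x0| < r'.
  rewrite /B /Q /= addrAC => Bx Qv; apply: le_lt_trans (ler_normD _ _) _.
  by move: Bx Qv; rewrite /rho; lra.
have rQ v : `|v| <= rho -> Q v by move=> vr; rewrite /Q /=; apply: le_lt_trans vr _; move: rho0; lra.
have /choice[U UP] : forall x, exists u : R -> X, B x ->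
    [/\ u 0 = 0, continuous u, forall t, `|u t| <= rho &
      forall t : R, `|t| < a -> is_derive t 1 u (f (x + u t))].
  move=> x; have [Bx|nB] := pselect (B x); last by exists (fun=> 0).
  have cG (u : R -> X) : continuous u -> (forall t, `|u t| <= rho) ->
      continuous (fun t => f (x + u t)).
    move=> cu ur t; apply: (@continuous_comp _ _ _ (fun t => x + u t) f).
      by apply: cvgD; [exact: cvg_cst|exact: cu].
    by apply: (sf 0%N); apply/rO/BQ => //; exact: rQ.
  have [|||u [u0 cu ur du]] := @picard R d a L be rho (fun _ v => f (x + v)) a0 (ltW L0) (ltW be0) _ abe cG.
  - by move: aL; lra.
  - move=> t v w vr wr; apply: le_trans (rL _ _ _ _) _; [exact/BQ/rQ|exact/BQ/rQ|].
    by rewrite opprD addrACA subrr add0r.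
  - move=> t; rewrite addr0; apply: rf; apply: lt_trans Bx _; rewrite /rho; move: r'0; lra.
  by exists u.
pose u (p : R * X) := U p.2 p.1.
pose S := [set p : R * X | `|p.1| < a /\ B p.2].
pose F (z : (R * X) * X) := f (z.1.2 + z.2).
have sol : param_solution a L B Q F u.
  split.
  - move=> p v w [_ Bp] Qv Qw; apply: le_trans (rL _ _ _ _) _; [exact: BQ|exact: BQ|].
    by rewrite opprD addrACA subrr add0r.
  - by move=> p [_ Bp]; have [_ _ ur _] := UP _ Bp; apply: rQ; exact: ur.
  - by move=> x Bx; have [] := UP _ Bx.
  - move=> [t x] [/= ta Bx]; have [_ _ _ du] := UP _ Bx.
    exact/is_derive_time/du.
have oS : open S by exact: open_slab.
have CF k : Ck k [set z | S z.1 /\ Q z.2] F.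
  pose l : {linear ((R * X) * X)%type -> X} := (snd \o fst) \+ snd.
  have cl : continuous l.
    move=> z; apply: cvgD; last exact: continuous_snd.
    apply: (@continuous_comp _ _ _ fst snd); [exact: continuous_fst|exact: continuous_snd].
  apply: (@Ck_sub _ _ _ k (l @^-1` O)) => [z [[_ Bz] Qz]|].
    by apply: rO; exact: BQ.
  exact: Ck_linear_comp cl (sf k).
have aL' : 2 * a * L <= 2^-1 by move: aL; lra.
have Cu k : Ck k S u := param_solution_Ck a0 (ltW L0) aL' oB oQ sol (CF k).
exists a, rho, (fun p => p.2 + u p); split => //.
- move=> k; apply: Ck_add => //.
  by apply: (@Ck_linear _ _ _ k S snd); exact: continuous_snd.
- by move=> x Bx; have [u0 _ _ _] := UP _ Bx; rewrite /u /= u0 addr0.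
- by move=> p [pa Bp]; apply/rO/BQ => //; case: sol => _ uQ _ _; exact: uQ.
- move=> [t x] [/= ta Bx]; have [_ _ _ du] := UP _ Bx.
  apply/is_derive_time; rewrite -[X in is_derive _ _ _ X]add0r.
  exact: (@is_deriveD _ _ _ (cst x) (U x) t 1 _ _ (is_derive_cst x t 1) (du t ta)).
Qed.

End LocalFlow.

(** * Calculus in charts *)

Section VectorCalculus.
Context {R : realType} {d : nat}.
Let X := 'rV[R]_d.+1.

Lemma open_preimage_in (S T : topologicalType) (A : set S) (f : S -> T) (C : set T) :
  open A -> (forall x, A x -> {for x, continuous f}) -> open C -> open (A `&` f @^-1` C).
Proof.
move=> oA cf oC; rewrite openE => x [Ax Cfx]; apply: filterI.
  exact: open_nbhs_nbhs.
by apply: (cf x Ax); exact: open_nbhs_nbhs.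
Qed.

Lemma Ck_comp_time (V : normedModType R) k U (O : set (R * X)) (f : R * X -> R)
    (h1 : V -> R) (h2 : V -> X) : open U -> open O ->
  (forall z, U z -> O (h1 z, h2 z)) -> Ck k U h1 -> Ck k U h2 -> Ck k O f ->
  Ck k U (fun z => f (h1 z, h2 z)).
Proof.
move=> oU oO UO; elim: k f => [|k IH] f.
  move=> c1 c2 cf z Uz; apply: (@continuous_comp _ _ _ (fun z => (h1 z, h2 z)) f).
    by apply: continuous_pair; [exact: c1|exact: c2].
  exact/cf/UO.
move=> C1 C2 Cf; have [[d1 c1] [d2 c2]] := (C1, C2); have [df cf] := Cf.
have dh z : U z -> differentiable (fun z => (h1 z, h2 z)) z.
  by move=> Uz; apply: differentiable_pair; [exact: d1|exact: d2].
split=> [z Uz|v].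
  by apply: (@differentiable_comp _ _ _ _ (fun z => (h1 z, h2 z)) f); [exact: dh|exact/df/UO].
have IH' w := IH _ (CkW C1) (CkW C2) (cf w).
have H a := Ck_mul oU ((Ck_mxP _ _ oU).1 (c2 v) a) (IH' (0, delta_mx 0 a)).
have := Ck_add oU (Ck_mul oU (c1 v) (IH' (1, 0))) (Ck_sum (index_enum _) oU H).
apply: Ck_ext => // z; rewrite inE => Uz.
have dfz := df _ (UO z Uz).
rewrite [RHS]deriveE; last first.
  by apply: (@differentiable_comp _ _ _ _ (fun z => (h1 z, h2 z)) f); [exact: dh|].
rewrite (@diff_comp _ _ _ _ (fun z => (h1 z, h2 z)) f) //; last exact: dh.
rewrite /= diff_pair /=; [|exact: d1|exact: d2].
rewrite diff_split // -!deriveE; [|exact: d2|exact: d1]; congr (_ + _).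
have -> : ('D_v h1 z, 0) = 'D_v h1 z *: (1, 0) :> R * X.
  by congr (_, _); rewrite /= ?scaler0 // [RHS]mulr1.
by rewrite [RHS]deriveE // linearZ -deriveE.
Qed.

Lemma derive_commute_row (V : normedModType R) (f : V -> X) v w x (U : set V) :
  open U -> U x -> Ck 2 U f ->
  'D_w ('D_v f) x = 'D_v ('D_w f) x.
Proof.
move=> oU Ux Cf; have [df cf] := Cf.
have H a b j : 'D_a ('D_b f) x 0 j = 'D_a ('D_b (fun y => f y 0 j)) x.
  rewrite derive_mx ?mxE; last by apply: diff_derivable; exact: (cf b).1.
  apply: near_eq_derive; have Un : \forall y \near x, U y by exact: open_nbhs_nbhs.
  apply: filterS Un => y Uy; rewrite derive_mx ?mxE //; exact/diff_derivable/df.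
apply/rowP => j.
have Cj := (Ck_mxP _ _ oU).1 Cf j.
have E := derive_commute v w oU Ux Cj.
exact: etrans (H w v j) (etrans E (esym (H v w j))).
Qed.

(** The product rule, after expanding the differential in partial derivatives. With [f] a transition
    map it gives the derivative of a vector field under a change of chart. *)
Lemma derive_diff_apply (f z : X -> X) v x (U : set X) : open U -> U x -> Ck 2 U f ->
  differentiable z x ->
  'D_v (fun y => 'd f y (z y)) x = 'd f x ('D_v z x) + 'D_v ('D_(z x) f) x.
Proof.
move=> oU Ux Cf dz; have [df cf] := Cf.
have Un : \forall y \near x, U y by exact: open_nbhs_nbhs.
have dza a : differentiable (fun y => z y 0 a) x.
  apply: (@differentiable_comp _ _ _ _ z (fun N : X => N 0 a)) => //.
  exact: differentiable_coord.
have dDf w : derivable ('D_w f) x v by apply: diff_derivable; exact: (cf w).1.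
have coordD (u : X -> X) j : derivable u x v -> is_derive x v (fun y => u y 0 j) ('D_v u x 0 j).
  move=> du; apply: DeriveDef; first exact: ((derivable_mxP u x v).1 du).
  by rewrite derive_mx // mxE.
(* Used twice: with [c = z], and with [c] constantly [z x] to recognise the second-derivative
   term. *)
have E1 (c : X -> X) : (forall a, derivable (fun y => c y 0 a) x v) ->
    'D_v (fun y => \sum_(a < d.+1) c y 0 a *: 'D_(delta_mx 0 a) f y) x =
    \sum_(a < d.+1) ('D_v (fun y => c y 0 a) x *: 'D_(delta_mx 0 a) f x +
       c x 0 a *: 'D_v ('D_(delta_mx 0 a) f) x).
  move=> dc.
  have dS j : is_derive x v (fun y => (\sum_(a < d.+1) c y 0 a *: 'D_(delta_mx 0 a) f y) 0 j)
     ((\sum_(a < d.+1) ('D_v (fun y => c y 0 a) x *: 'D_(delta_mx 0 a) f x +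
       c x 0 a *: 'D_v ('D_(delta_mx 0 a) f) x)) 0 j).
    pose h (a : 'I_d.+1) y := c y 0 a * 'D_(delta_mx 0 a) f y 0 j.
    have -> : (fun y => (\sum_(a < d.+1) c y 0 a *: 'D_(delta_mx 0 a) f y) 0 j) =
        \sum_(a < d.+1) h a.
      by apply/funext => y; rewrite fct_sumE summxE; apply: eq_bigr => a _; rewrite mxE.
    rewrite summxE; apply: is_derive_sum => a.
    have [e1 e2] := coordD _ j (dDf (delta_mx 0 a)).
    have := @is_deriveM _ _ (fun y => c y 0 a) (fun y => 'D_(delta_mx 0 a) f y 0 j) x v _ _
       (derivableP (dc a)) (coordD _ j (dDf (delta_mx 0 a))).
    by move/is_derive_eq; apply; rewrite !mxE addrC /GRing.scale /= [X in _ + X]mulrC.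
  have dS' : derivable (fun y => \sum_(a < d.+1) c y 0 a *: 'D_(delta_mx 0 a) f y) x v.
    by apply/derivable_mxP => i j; rewrite ord1; have [] := dS j.
  apply/rowP => j; rewrite derive_mx // mxE.
  by have [_ ->] := dS j.
have -> : 'D_v (fun y => 'd f y (z y)) x =
    'D_v (fun y => \sum_(a < d.+1) z y 0 a *: 'D_(delta_mx 0 a) f y) x.
  by apply: near_eq_derive; apply: filterS Un => y Uy; rewrite diff_delta //; exact: df.
rewrite E1; last by move=> a; exact: diff_derivable.
rewrite big_split /=; congr (_ + _).
  rewrite diff_delta; last exact: df.
  apply: eq_bigr => a _; congr (_ *: _).
  by have [_ ->] := coordD z a (@diff_derivable _ _ _ _ _ v dz).
have -> : 'D_v ('D_(z x) f) x =
    'D_v (fun y => \sum_(a < d.+1) (cst (z x)) y 0 a *: 'D_(delta_mx 0 a) f y) x.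
  apply: near_eq_derive; apply: filterS Un => y Uy.
  by rewrite deriveE ?diff_delta //; exact: df.
rewrite E1; last by move=> a; exact: derivable_cst.
by apply: eq_bigr => a _; rewrite (derive_cst (z x 0 a)) scale0r add0r.
Qed.

End VectorCalculus.

Section BilinearDerivative.
Context {R : realType} {d : nat} {V : normedModType R}.
Let X := 'rV[R]_d.+1.
Variable h : X -> X -> X -> R.
Hypothesis hlin : forall x v, scalar (h x v).
Hypothesis hsym : forall x v w, h x v w = h x w v.

Let hE x v w : h x v w = \sum_a \sum_b v 0 a * w 0 b * h x (delta_mx 0 a) (delta_mx 0 b).
Proof.
rewrite {1}(row_sum_delta v) (hsuml hlin hsym); apply: eq_bigr => a _.
rewrite (hZl hlin hsym) {1}(row_sum_delta w) (hsumr hlin) mulr_sumr.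
by apply: eq_bigr => b _; rewrite (hZr hlin) mulrA.
Qed.

Lemma is_derive_bilinear (c : V -> X) (v w : V -> X) p e :
  (forall a b, differentiable (fun x => h x a b) (c p)) ->
  differentiable c p -> differentiable v p -> differentiable w p ->
  is_derive p e (fun q => h (c q) (v q) (w q))
    ('D_('D_e c p) (fun x => h x (v p) (w p)) (c p) +
     h (c p) ('D_e v p) (w p) + h (c p) (v p) ('D_e w p)).
Proof.
move=> dh dc dv dw.
have coordD (u : V -> X) a : differentiable u p ->
    is_derive p e (fun q => u q 0 a) ('D_e u p 0 a).
  move=> /(@diff_derivable _ _ _ _ _ e) du.
  apply: DeriveDef; first exact: ((derivable_mxP u p e).1 du).
  by rewrite derive_mx // mxE.
pose H a b x := h x (delta_mx 0 a) (delta_mx 0 b).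
have dH a b : is_derive p e (H a b \o c) ('D_('D_e c p) (H a b) (c p)).
  have dHc : differentiable (H a b \o c) p by apply: differentiable_comp => //; exact: dh.
  apply: DeriveDef; first exact: diff_derivable.
  by rewrite deriveE // diff_comp //= ?deriveE //; exact: dh.
pose f (a b : 'I_d.+1) q := v q 0 a * w q 0 b * H a b (c q).
have -> : (fun q => h (c q) (v q) (w q)) = \sum_a \sum_b f a b.
  by apply/funext => q; rewrite hE fct_sumE; apply: eq_bigr => a _; rewrite fct_sumE.
have -> : 'D_('D_e c p) (fun x => h x (v p) (w p)) (c p) =
    \sum_a \sum_b v p 0 a * w p 0 b * 'D_('D_e c p) (H a b) (c p).
  pose k (a b : 'I_d.+1) := (v p 0 a * w p 0 b) \*: H a b.
  have -> : (fun x => h x (v p) (w p)) = \sum_a \sum_b k a b.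
    by apply/funext => x; rewrite hE fct_sumE; apply: eq_bigr => a _; rewrite fct_sumE.
  have dk a b : is_derive (c p) ('D_e c p) (k a b)
      ((v p 0 a * w p 0 b) * 'D_('D_e c p) (H a b) (c p)).
    by apply: is_deriveZ; apply: derivableP; apply: diff_derivable; exact: dh.
  have dk' a : is_derive (c p) ('D_e c p) (\sum_b k a b)
      (\sum_b (v p 0 a * w p 0 b) * 'D_('D_e c p) (H a b) (c p)) by exact: is_derive_sum.
  by have [_ ->] := is_derive_sum dk'.
rewrite !hE -!big_split /=.
apply: is_derive_sum => a; rewrite -!big_split /=; apply: is_derive_sum => b.
have := @is_deriveM _ _ _ _ p e _ _
  (@is_deriveM _ _ _ _ p e _ _ (coordD v a dv) (coordD w b dw)) (dH a b).
by move/is_derive_eq; apply; rewrite !fctE /= /GRing.scale /= /H; ring.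
Qed.

End BilinearDerivative.

(** * Vector fields and brackets under change of chart *)

Section FieldCharts.
Context {R : realType} {d : nat} {M : manifold R d}.
Implicit Types (p q : M) (i j : chart M) (U : set M) (u v w : 'rV[R]_d.+1)
  (X Y Z : M -> 'rV[R]_d.+1).

Lemma coord_change i j q v : dom i q -> dom j q ->
  coord j q v = 'd (phi j \o psi i) (phi i q) (coord i q v).
Proof.
move=> iq jq; exact: esym (transition_comp v (dom_chart_at q) iq jq).
Qed.

Lemma coord_chart_at q v : coord (chart_at q) q v = v.
Proof. exact: transition_id (dom_chart_at q). Qed.

Lemma local_repE i X q : dom i q -> local_rep i X (phi i q) = coord i q (X q).
Proof. by move=> iq; rewrite /local_rep phiK. Qed.

Lemma near_chart i U q : open U -> U q -> dom i q ->
  \forall x \near phi i q,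
    [/\ (phi i @` dom i) x, U (psi i x), dom i (psi i x) & phi i (psi i x) = x].
Proof.
move=> oU Uq iq; have o := @open_phi _ _ M i U oU.
have xo : (phi i @` (U `&` dom i)) (phi i q) by exists q.
have : \forall x \near phi i q, (phi i @` (U `&` dom i)) x by exact: open_nbhs_nbhs.
by apply: filterS => x /[dup] -[r [_ ir] rx] /psiK[? ? ?]; split => //; exists r.
Qed.

Lemma smooth_field_diff i U X q : smooth_field U X -> U q -> dom i q ->
  differentiable (local_rep i X) (phi i q).
Proof. by move=> sX Uq iq; have [dX _] := sX i 1%N; apply: dX; exists q. Qed.

Lemma smooth_field_sub U U' X : U' `<=` U -> smooth_field U X -> smooth_field U' X.
Proof.
by move=> UU' sX i k; apply: Ck_sub (sX i k) => x [q [Uq iq] <-]; exists q => //; split => //; exact: UU'.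
Qed.

(** A change of chart adds a second derivative of the transition map, symmetric in [v] and [X q];
    the two such terms cancel in a bracket, which is thereby independent of the chart. *)
Lemma derive_local_rep i U X q v : open U -> smooth_field U X -> U q -> dom i q ->
  let t := phi i \o psi (chart_at q) in let y := phi (chart_at q) q in
  'D_(coord i q v) (local_rep i X) (phi i q) =
    'd t y ('D_v (local_rep (chart_at q) X) y) + 'D_v ('D_(X q) t) y.
Proof.
move=> oU sX Uq iq t y; set c := chart_at q.
have cq : dom c q := dom_chart_at q.
have ty : t y = phi i q by rewrite /t /y /= phiK.
have dt : differentiable t y by exact: transition_diff.
have oi := @open_dom _ _ M i.
have Oy : (phi c @` (dom i `&` dom c)) y by exists q.
have Ct : Ck 2 (phi c @` (dom i `&` dom c)) t.
  by rewrite setIC; exact: transition_smooth.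
have := @derive_diff_apply _ _ t (local_rep c X) v y _ (open_phi oi) Oy Ct
  (smooth_field_diff sX Uq cq).
have -> : local_rep c X y = X q by rewrite local_repE // coord_chart_at.
move=> <-.
have dXi : differentiable (local_rep i X) (t y) by rewrite ty; exact: smooth_field_diff iq.
transitivity ('D_v (local_rep i X \o t) y).
  rewrite [RHS](deriveE v (differentiable_comp dt dXi)) (diff_comp dt dXi) /=.
  by rewrite -(deriveE _ dXi) ty (coord_change v cq iq) coord_chart_at.
apply: near_eq_derive; have := near_chart oi iq cq.
apply: filterS => z [_ iz cz pz].
rewrite /= (local_repE _ iz) (coord_change _ cz iz).
by rewrite pz.
Qed.

Lemma bracket_chart i U X Y q : open U -> smooth_field U X -> smooth_field U Y ->
  U q -> dom i q ->
  coord i q (bracket X Y q) = 'D_(coord i q (X q)) (local_rep i Y) (phi i q) -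
    'D_(coord i q (Y q)) (local_rep i X) (phi i q).
Proof.
move=> oU sX sY Uq iq.
rewrite (derive_local_rep _ oU sX Uq iq) (derive_local_rep _ oU sY Uq iq).
have oi := @open_dom _ _ M i; have cq := dom_chart_at q.
have Oy : (phi (chart_at q) @` (dom i `&` dom (chart_at q))) (phi (chart_at q) q) by exists q.
have Ct : Ck 2 (phi (chart_at q) @` (dom i `&` dom (chart_at q))) (phi i \o psi (chart_at q)).
  by rewrite setIC; exact: transition_smooth.
have E := derive_commute_row (X q) (Y q) (open_phi oi) Oy Ct.
by rewrite opprD addrACA -E subrr addr0 -linearB.
Qed.

End FieldCharts.

(** * The Lie derivative of the metric as a tensor *)

Section MetricCharts.
Context {R : realType} {n : nat} {M : manifold R n.+1} (g : lorentz_metric M).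
Implicit Types (p q : M) (i j : chart M) (U : set M) (v w : 'rV[R]_n.+2)
  (X Y Z : M -> 'rV[R]_n.+2).

Definition chart_metric i x v w := g (psi i x) (tvec i (psi i x) v) (tvec i (psi i x) w).

Lemma chart_metric_linear i x v : scalar (chart_metric i x v).
Proof.
move=> c w w'; rewrite /chart_metric /tvec linearP.
exact: metric_linear.
Qed.

Lemma chart_metric_sym i x v w : chart_metric i x v w = chart_metric i x w v.
Proof. by rewrite /chart_metric Defs.metric_sym. Qed.

Lemma chart_metricE i q v w : dom i q ->
  g q v w = chart_metric i (phi i q) (coord i q v) (coord i q w).
Proof. by move=> iq; rewrite /chart_metric phiK // !coordK. Qed.

Lemma chart_metric_diff i q v w : dom i q ->
  differentiable (fun x => chart_metric i x v w) (phi i q).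
Proof. by move=> iq; have [dg _] := metric_smooth g i v w 1%N; apply: dg; exists q. Qed.

(* The value of [L_X g] on two tangent vectors at [q], computed in [chart_at q]. *)
Definition lie_at X q v w : R :=
  let c := chart_at q in
  'D_(X q) (fun x => chart_metric c x v w) (phi c q)
  + g q ('D_v (local_rep c X) (phi c q)) w + g q v ('D_w (local_rep c X) (phi c q)).

(** The derivatives of [Y] and [Z] given by the product rule cancel against those in the brackets,
    so only the values at [q] remain. *)
Lemma lie_metricE U X Y Z q : open U -> U q -> smooth_field U X ->
  smooth_field U Y -> smooth_field U Z ->
  lie_metric X g Y Z q = lie_at X q (Y q) (Z q).
Proof.
move=> oU Uq sX sY sZ; rewrite /lie_metric /lie_at /deriv_along /bracket.
set c := chart_at q; set x := phi c q; have cq : dom c q := dom_chart_at q.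
have Ex (T : M -> 'rV[R]_n.+2) : local_rep c T x = T q by rewrite local_repE // coord_chart_at.
have gE v w : g q v w = chart_metric c x v w by rewrite (chart_metricE _ _ cq) !coord_chart_at.
have did : differentiable (@id 'rV[R]_n.+2) x by [].
have := @is_derive_bilinear _ _ _ (chart_metric c) (chart_metric_linear c)
  (chart_metric_sym c) id (local_rep c Y) (local_rep c Z) x (X q)
  (fun a b => chart_metric_diff a b cq) did
  (smooth_field_diff sY Uq cq) (smooth_field_diff sZ Uq cq).
rewrite derive_id !Ex -!gE => -[_ E].
have -> : 'D_(X q) ((fun q0 => g q0 (Y q0) (Z q0)) \o psi c) x =
    'D_(X q) (fun y => chart_metric c (id y) (local_rep c Y y) (local_rep c Z y)) x.
  apply: near_eq_derive; have := near_chart oU Uq cq.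
  by apply: filterS => y [_ _ cy py] /=; rewrite (chart_metricE _ _ cy) py.
rewrite {}E (hBl (metric_linear g) (Defs.metric_sym g) q).
rewrite (hBr (metric_linear g) q).
have aux (e a b a' b' : R) : e + a + b - (a - a') - (b - b') = e + a' + b' by ring.
exact: aux.
Qed.

End MetricCharts.

(** * Flows on manifolds *)

Section FlowCharts.
Context {R : realType} {d : nat} {M : manifold R d}.
Variables (X : M -> 'rV[R]_d.+1) (D : set (R * M)) (th : R -> M -> M).
Hypothesis sX : smooth_field setT X.
Hypothesis flow : is_flow X D th.
Implicit Types (p q : M) (i j : chart M) (v w : 'rV[R]_d.+1).

Lemma flow_continuous t p : D (t, p) ->
  {for (t, p), continuous (fun z : R * M => th z.1 z.2)}.
Proof.
move=> Dtp; have [_ _ _ /(_ _ _ Dtp)[i [j [N [oN ip Np Nd sN]]]] _] := flow.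
pose Phi (z : R * 'rV[R]_d.+1) := phi j (th z.1 (psi i z.2)).
have jtp : dom j (th t p) by have [_] := Nd _ _ Np; rewrite phiK.
have c1 : {for (t, p), continuous (fun z : R * M => (z.1, phi i z.2))}.
  apply: continuous_pair; first exact: cvg_fst.
  apply: (@continuous_comp _ _ _ snd (phi i)); first exact: cvg_snd.
  exact: phi_continuous.
have n1 : \forall z \near (t, p), N (z.1, phi i z.2).
  by apply: c1; exact: open_nbhs_nbhs.
have n2 : \forall z \near (t, p), dom i z.2.
  by apply: (@cvg_snd _ _ (nbhs t) (nbhs p)); apply: open_nbhs_nbhs; split => //; exact: open_dom.
have c2 : {for (t, p), continuous (fun z : R * M => psi j (Phi (z.1, phi i z.2)))}.
  apply: (@continuous_comp _ _ _ (fun z : R * M => Phi (z.1, phi i z.2)) (psi j)).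
    by apply: (@continuous_comp _ _ _ (fun z : R * M => (z.1, phi i z.2)) Phi) => //; exact: (sN 0%N).
  by apply: psi_continuous; exists (th t p) => //; rewrite /Phi /= phiK.
have E : \forall z \near (t, p), psi j (Phi (z.1, phi i z.2)) = th z.1 z.2.
  apply: filterS2 n1 n2 => z Nz iz; have [_] := Nd _ _ Nz.
  by rewrite /Phi /= phiK // => jz; rewrite phiK.
rewrite /prop_for /continuous_at /= -(nbhs_singleton E).
exact: cvg_trans (near_eq_cvg E) c2.
Qed.

Lemma flow_continuous_time t p : D (t, p) -> {for t, continuous (th ^~ p)}.
Proof.
move=> Dtp; apply: (@continuous_comp _ _ _ (fun s : R => (s, p)) (fun z => th z.1 z.2)).
  by apply: continuous_pair; [exact: cvg_id|exact: cst_continuous].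
exact: flow_continuous.
Qed.

Definition flow_rep i j (z : R * 'rV[R]_d.+1) : 'rV[R]_d.+1 :=
  phi j (th z.1 (psi i z.2)).

(** A flow is assumed smooth in some pair of charts, and its equation is stated in the chart
    selected at each point; transition maps carry both to an arbitrary pair. *)
Lemma flow_chart i j t p : D (t, p) -> dom i p -> dom j (th t p) ->
  exists N : set (R * 'rV[R]_d.+1), [/\ open N, N (t, phi i p),
    forall z, N z -> [/\ (phi i @` dom i) z.2, D (z.1, psi i z.2) &
      dom j (th z.1 (psi i z.2))],
    smooth N (flow_rep i j) &
    forall z, N z -> is_derive z (1, 0) (flow_rep i j) (local_rep j X (flow_rep i j z))].
Proof.
move=> Dtp ip jtp.
have [oD _ _ /(_ _ _ Dtp)[i' [j' [N' [oN' i'p N'p N'd sN']]]] dth] := flow.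
pose ta := phi i' \o psi i.
pose U1 := phi i @` (dom i' `&` dom i).
have oU1 : open U1 by apply: open_phi; exact: open_dom.
have U1i x : U1 x -> [/\ (phi i @` dom i) x, dom i' (psi i x), dom i (psi i x) & phi i (psi i x) = x].
  by move=> U1x; have [? ? E] := psiK U1x; split => //; exists (psi i x).
have Cta k : Ck k U1 ta by rewrite /U1 setIC; exact: transition_smooth.
(* [A1], [A2], [A3] and [N] shrink step by step: each new condition is a preimage under a map whose
   continuity is known only on the preceding set. *)
pose A1 : set (R * 'rV[R]_d.+1) := setT `&` snd @^-1` U1.
have oA1 : open A1.
  by apply: open_preimage_in; [exact: openT|move=> z _; exact: cvg_snd|].
have A1U z : A1 z -> U1 z.2 by case.
pose h (z : R * 'rV[R]_d.+1) := (z.1, ta z.2).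
have ch z : A1 z -> {for z, continuous h}.
  move=> A1z; apply: continuous_pair; first exact: cvg_fst.
  apply: (@continuous_comp _ _ _ snd ta); first exact: cvg_snd.
  by apply: (Cta 0%N); exact: A1U.
pose A2 := A1 `&` h @^-1` N'.
have oA2 : open A2 by exact: open_preimage_in.
pose k0 (z : R * 'rV[R]_d.+1) : R * M := (z.1, psi i z.2).
have ck z : A2 z -> {for z, continuous k0}.
  move=> [A1z _]; apply: continuous_pair; first exact: cvg_fst.
  apply: (@continuous_comp _ _ _ snd (psi i)); first exact: cvg_snd.
  by apply: psi_continuous; have [] := U1i _ (A1U _ A1z).
pose A3 := A2 `&` k0 @^-1` D.
have oA3 : open A3 by exact: open_preimage_in.
pose th0 (z : R * 'rV[R]_d.+1) := th z.1 (psi i z.2).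
have cth z : A3 z -> {for z, continuous th0}.
  move=> [A2z Dz].
  apply: (@continuous_comp _ _ _ k0 (fun y : R * M => th y.1 y.2)); first exact: ck.
  exact: flow_continuous.
pose N := A3 `&` th0 @^-1` (dom j).
have oN : open N by apply: open_preimage_in => //; exact: open_dom.
have NE z : N z -> [/\ U1 z.2, N' (h z), D (z.1, psi i z.2) & dom j (th z.1 (psi i z.2))].
  by move=> [[[/A1U]]].
have th'E z : N z -> th z.1 (psi i' (ta z.2)) = th z.1 (psi i z.2).
  by move=> /NE[/U1i[_ i'z _ _] _ _ _]; rewrite /ta /= phiK.
exists N; split => //.
- split; last by rewrite /th0 /= phiK.
  split; last by rewrite /k0 /= phiK.
  split; last by rewrite /h /ta /= phiK.
  by split => //=; exists p.
- by move=> z /NE[/U1i[? _ _ _] _ ? ?].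
- pose Phi' (z : R * 'rV[R]_d.+1) := phi j' (th z.1 (psi i' z.2)).
  pose O := phi j' @` (dom j `&` dom j').
  have oO : open O by apply: open_phi; exact: open_dom.
  have Nj' z : N z -> dom j' (th z.1 (psi i z.2)).
    move=> Nz; have [_ N'h _ _] := NE z Nz; have [_] := N'd _ _ N'h.
    by rewrite th'E.
  have hO z : N z -> O (Phi' (h z)).
    move=> Nz; have [_ _ _ jz] := NE z Nz; exists (th z.1 (psi i z.2)).
      by split => //; exact: Nj'.
    by rewrite /Phi' /h /= th'E.
  move=> k.
  have Ch : Ck k N (Phi' \o h).
    apply/(Ck_mxP _ _ oN) => b.
    apply: (Ck_comp_time oN oN' (f := fun z => Phi' z 0 b) (h1 := fst) (h2 := ta \o snd)).
    - by move=> z /NE[].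
    - by apply: (@Ck_linear _ _ _ k N fst) => z; exact: cvg_fst.
    - apply: (@Ck_sub _ _ _ k (snd @^-1` U1)) => [z /NE[]//|].
      by apply: Ck_linear_comp => // z; exact: cvg_snd.
    - exact: (Ck_mxP _ _ oN').1 (sN' k) b.
  apply/(Ck_mxP _ _ oN) => b.
  have Cs : Ck k O (fun x => (phi j \o psi j') x 0 b).
    by apply: (Ck_mxP _ _ oO).1; rewrite /O setIC; exact: transition_smooth.
  apply: (Ck_ext oN _ (Ck_comp oN oO hO Ch Cs)) => z; rewrite inE => Nz.
  by rewrite /flow_rep /= /Phi' /h /= (th'E z Nz) phiK //; exact: Nj'.
move=> [s x] /NE[/= U1x _ Dz jz].
set q := psi i x; set c := chart_at (th s q).
have cq : dom c (th s q) := dom_chart_at _.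
apply/is_derive_time.
have dg : is_derive s 1 (fun r => phi c (th r q)) (X (th s q)) := dth _ _ Dz.
have dgd : differentiable (fun r => phi c (th r q)) s.
  by apply/derivable1_diffP; have [] := dg.
have dt : differentiable (phi j \o psi c) (phi c (th s q)) by exact: transition_diff.
have Es : \forall r \near s, (phi j \o psi c) (phi c (th r q)) = flow_rep i j (r, x).
  have cc := flow_continuous_time Dz.
  have nc : \forall r \near s, dom c (th r q).
    by apply: cc; apply: open_nbhs_nbhs; split => //; exact: open_dom.
  by apply: filterS nc => r cr; rewrite /flow_rep /= phiK.
apply: near_eq_is_derive Es _.
apply: DeriveDef; first exact/diff_derivable/(differentiable_comp dgd dt).
rewrite (@deriveE R R _ _ _ 1 (differentiable_comp dgd dt)) (diff_comp dgd dt) /=.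
rewrite -(@deriveE R R _ _ _ 1 dgd); have [_ ->] := dg.
by rewrite /flow_rep /= local_repE // (coord_change _ cq jz) coord_chart_at.
Qed.

Lemma differentiable_section (V W : normedModType R) (f : R * V -> W) (t : R) (x v : V) :
  differentiable f (t, x) ->
  differentiable (fun y => f (t, y)) x /\ 'd (fun y => f (t, y)) x v = 'D_(0, v) f (t, x).
Proof.
move=> df; have d1 : differentiable (fun y => f (t, y)) x.
  by apply: (@differentiable_comp _ _ _ _ (fun y => (t, y)) f).
split; first exact: d1.
rewrite -(deriveE v d1).
have dv : derivable f (t, x) (0, v) by exact: diff_derivable.
by have [_ ->] := (@is_derive_space _ _ _ _ f t x v _).2 (derivableP dv).
Qed.

(** [tangent_map] refers to the chart selected at [th t p], which may vary wildly with [t]. In a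
    fixed chart the transported vector is a space derivative of one smooth map and can be
    differentiated in time. *)
Lemma coord_tangent_map j t p v : D (t, p) -> dom j (th t p) ->
  coord j (th t p) (tangent_map (th t) p v) =
  'D_(0, v) (flow_rep (chart_at p) j) (t, phi (chart_at p) p).
Proof.
move=> Dtp jtp; set i := chart_at p; set c := chart_at (th t p); set x0 := phi i p.
have ip : dom i p := dom_chart_at p; have ctp : dom c (th t p) := dom_chart_at _.
have [Nc [oNc Nc0 Ncd sNc _]] := flow_chart Dtp ip ctp.
have [Nj [oNj Nj0 Njd sNj _]] := flow_chart Dtp ip jtp.
have [d1 _] := differentiable_section v ((sNc 1%N).1 _ Nc0).
have [d2 <-] := differentiable_section v ((sNj 1%N).1 _ Nj0).
have x0E : flow_rep i c (t, x0) = phi c (th t p) by rewrite /flow_rep /= phiK.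
have dt : differentiable (phi j \o psi c) (flow_rep i c (t, x0)).
  by rewrite x0E; exact: transition_diff.
have E : \forall x \near x0, flow_rep i j (t, x) = ((phi j \o psi c) \o (fun y => flow_rep i c (t, y))) x.
  have ct : {for x0, continuous (fun x : 'rV[R]_d.+1 => (t, x))}.
    by apply: continuous_pair; [exact: cst_continuous|exact: cvg_id].
  have : \forall x \near x0, Nc (t, x) by apply: ct; exact: open_nbhs_nbhs.
  by apply: filterS => x /Ncd[_ _ cx]; rewrite /flow_rep /= phiK.
have [_ E'] := near_eq_diff E d2.
have := congr1 (fun f => f v) E' => <-.
by rewrite (diff_comp d1 dt) /= x0E.
Qed.

(** Exchanging the time and space derivatives reduces the second claim to differentiating the flow
    equation in the initial point. *)
Lemma flow_jacobi j t p v : D (t, p) -> dom j (th t p) ->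
  let x0 := phi (chart_at p) p in let Phi := flow_rep (chart_at p) j in
  [/\ is_derive t 1 (fun s => Phi (s, x0)) (local_rep j X (phi j (th t p))) &
     is_derive t 1 (fun s => 'D_(0, v) Phi (s, x0))
      ('D_(coord j (th t p) (tangent_map (th t) p v)) (local_rep j X) (phi j (th t p)))].
Proof.
move=> Dtp jtp x0 Phi; have ip : dom (chart_at p) p := dom_chart_at p.
have [N [oN N0 Nd sN dN]] := flow_chart Dtp ip jtp.
have P0 : Phi (t, x0) = phi j (th t p) by rewrite /Phi /flow_rep /= phiK.
split; first by rewrite -P0; apply/is_derive_time/dN.
apply: (@is_derive_time _ _ _ (fun z => 'D_(0, v) Phi z) t x0 _).2; apply: DeriveDef.
  by apply: diff_derivable; exact: (((sN 2%N).2 (0, v)).1 _ N0).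
have -> := @derive_commute_row R d _ Phi ((0, v) : R * 'rV[R]_d.+1) ((1, 0) : R * 'rV[R]_d.+1)
  _ _ oN N0 (sN 2%N).
rewrite coord_tangent_map // -/Phi -/x0.
have dP : differentiable Phi (t, x0) := (sN 1%N).1 _ N0.
have dxi : differentiable (local_rep j X) (Phi (t, x0)).
  by rewrite P0; exact: smooth_field_diff sX I jtp.
transitivity ('D_(0, v) (local_rep j X \o Phi) (t, x0)).
  apply: near_eq_derive; have : \forall z \near (t, x0), N z by exact: open_nbhs_nbhs.
  by apply: filterS => z /dN[_ ->].
rewrite (deriveE (0, v) (differentiable_comp dP dxi)) (diff_comp dP dxi) /=.
by rewrite -(deriveE _ dP) -(deriveE _ dxi) P0.
Qed.

End FlowCharts.

(** * Propagation along a time interval *)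

Section RealLine.
Context {R : realType}.

Lemma scalar_zero_ode (y : R -> R) a b c C : a <= c <= b -> 0 <= C ->
  (b - a) * C <= 2^-1 -> y c = 0 ->
  (forall t : R, a <= t <= b -> derivable y t 1 /\ `|'D_1 y t| <= C * `|y t|) ->
  forall t : R, a <= t <= b -> y t = 0.
Proof.
move=> acb C0 abC yc dy t tab.
pose w (s : R) : 'rV[R]_1 := \row_j y s.
have nw s : `|w s| = `|y s|.
  apply/le_anti; rewrite row_norm_le /=; last by move=> j; rewrite mxE.
  by have := row_norm_coord (w s) 0; rewrite mxE.
have wj (i : 'I_1) j : (fun s => w s i j) = y by apply/funext => s; rewrite mxE.
have dw (s : R) : a <= s <= b -> derivable w s 1 /\ `|'D_1 w s| <= C * `|w s| + 0.
  move=> /dy[d1 d2]; have d3 : derivable w s 1 by apply/derivable_mxP => i j; rewrite wj.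
  split; first exact: d3.
  rewrite addr0 nw; apply: row_norm_le => j.
  by rewrite derive_mx // mxE wj.
have wc : w c = 0 by apply/rowP => j; rewrite !mxE.
have := @short_gronwall R 0 w a b c C 0 acb C0 (lexx 0) abC wc dw t tab.
by rewrite mulr0 nw normr_le0 => /eqP.
Qed.

(** The hypothesis passes [P] both from the centre to its neighbours and back, so the set where [P]
    holds is relatively open and closed in a connected segment. Rescaling to [[0, 1]] treats both
    signs of [t] at once. *)
Lemma segment_ind (P : R -> Prop) (t : R) : P 0 ->
  (forall s : R, 0 <= s <= t \/ t <= s <= 0 -> exists2 e : R, 0 < e &
     forall s1 s2 : R, `|s1 - s| < e -> `|s2 - s| < e -> P s1 -> P s2) ->
  P t.
Proof.
move=> P0 H; pose Q : set R := [set r | P (r * t)].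
have HQ (r : R) : 0 <= r <= 1 -> exists2 e : R, 0 < e &
    forall r1 r2 : R, `|r1 - r| < e -> `|r2 - r| < e -> Q r1 -> Q r2.
  move=> /andP[r0 r1]; have [|e e0 He] := H (r * t).
    have [t0|/ltW t0] := leP 0 t; [left|right].
      by rewrite mulr_ge0 //= ler_piMl.
    by rewrite mulr_ge0_le0 // andbT; rewrite -subr_ge0 -{2}[t]mul1r -mulrBl mulr_le0 // subr_le0.
  exists (e / (`|t| + 1)); first by rewrite divr_gt0 // ltr_wpDl.
  move=> r1' r2' h1 h2; apply: He; rewrite -mulrBl normrM.
    apply: le_lt_trans (_ : `|r1' - r| * (`|t| + 1) < e).
      by rewrite ler_wpM2l // lerDl.
    by rewrite -ltr_pdivlMr // ltr_wpDl.
  apply: le_lt_trans (_ : `|r2' - r| * (`|t| + 1) < e).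
    by rewrite ler_wpM2l // lerDl.
  by rewrite -ltr_pdivlMr // ltr_wpDl.
have c01 : connected `[0 : R, 1]%classic by exact: segment_connected.
suff QA : `[0 : R, 1]%classic `&` Q = `[0 : R, 1]%classic.
  have : (`[0 : R, 1]%classic `&` Q) 1 by rewrite QA /= in_itv /= ler01 lexx.
  by move=> [_]; rewrite /Q /= mul1r.
apply: c01.
- by exists 0; split; [rewrite /= in_itv /= lexx ler01|rewrite /Q /= mul0r].
- exists (interior Q); first exact: open_interior.
  apply/seteqP; split => [r [r01 Qr]|r [r01 /interior_subset Qr]]; split => //.
  have [|e e0 He] := HQ r; first by rewrite /= in_itv /= in r01.
  by apply/(nearP r Q); exists e => // s sr; apply: (He r s) => //; rewrite subrr normr0.
- exists (closure Q); first exact: closed_closure.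
  apply/seteqP; split => [r [r01 Qr]|r [r01 cQ]]; split => //; first exact: subset_closure.
  have [|e e0 He] := HQ r; first by rewrite /= in_itv /= in r01.
  have [s [Qs rs]] := cQ _ (nbhsx_ballx r e e0).
  by apply: (He s r) => //; [rewrite distrC|rewrite subrr normr0].
Qed.

Lemma is_derive_near_cst (W : normedModType R) (f : R -> W) t c w :
  (\forall s \near t, f s = c) -> is_derive t 1 f w -> w = 0.
Proof.
move=> fc [_ <-]; have -> : 'D_1 f t = 'D_1 (cst c) t by exact: near_eq_derive.
exact: derive_cst.
Qed.

End RealLine.

(** * Existence of flows on a manifold *)

Section ExistsFlow.
Context {R : realType} {d : nat} {M : manifold R d}.
Variable X : M -> 'rV[R]_d.+1.
Hypothesis sX : smooth_field setT X.

(** Membership in [aut] quantifies over flows, so it carries information at [p] only once a flow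
    through [p] exists. A local flow in the chart at [p] is transported by [psi]. *)
Lemma exists_flow p : exists D th, is_flow X D th /\ D (0, p).
Proof.
set c := chart_at p; set x0 := phi c p; have cp : dom c p := dom_chart_at p.
pose O := phi c @` dom c; have oO : open O by exact: open_cod.
have Ox0 : O x0 by exists p.
have sf : smooth O (local_rep c X) by have := sX c; rewrite setTI.
have OE x : O x -> dom c (psi c x) /\ phi c (psi c x) = x.
  by move=> [q cq <-]; rewrite phiK.
have [a [r [ph [[a0 r0] sph ph0 Oph dph]]]] := local_flow oO Ox0 sf.
set S := [set z : R * 'rV[R]_d.+1 | `|z.1| < a /\ `|z.2 - x0| < r] in sph Oph dph.
have SO x : `|x - x0| < r -> O x.
  by move=> xr; rewrite -(ph0 x xr); apply: Oph; split => //=; rewrite normr0.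
pose B := [set q | dom c q /\ `|phi c q - x0| < r].
have oball : open [set x : 'rV[R]_d.+1 | `|x - x0| < r].
  apply: (@open_comp _ _ (fun x : 'rV[R]_d.+1 => `|x - x0|) [set s : R | s < r]) => // x _.
  apply: (@continuous_comp _ _ _ (fun x : 'rV[R]_d.+1 => x - x0)); last exact: norm_continuous.
  by apply: continuousB; [exact: cvg_id|exact: cst_continuous].
have oB : open B.
  apply: (@open_preimage_in _ _ (dom c) (phi c)) oball; first exact: open_dom.
  by move=> q; exact: phi_continuous.
pose D := [set z : R * M | `|z.1| < a /\ B z.2].
pose th (t : R) (q : M) := psi c (ph (t, phi c q)).
exists D, th; split; last by split; [rewrite /= normr0|split => //; rewrite subrr normr0].
have DS t q : D (t, q) -> S (t, phi c q) by move=> [ta [_ qr]].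
have oS : open S by exact: (@open_slab _ a _ _ oball).
split.
- apply: openI.
    apply: (@open_comp _ _ (fun z : R * M => `|z.1|) [set s : R | s < a]) => // z _.
    apply: (@continuous_comp _ _ _ fst); last exact: norm_continuous.
    exact: cvg_fst.
  by apply: (@open_comp _ _ snd B) => // z _; exact: cvg_snd.
- move=> t s q [/= ta Bq] st; split => //=; apply: le_lt_trans ta.
  case: st => /andP[h1 h2]; first by rewrite !ger0_norm //; exact: le_trans h2.
  by rewrite !ler0_norm ?lerN2 //; exact: le_trans h1 _.
- by move=> q [_ [cq qr]]; rewrite /th ph0 // phiK.
- move=> t q Dtq; exists c, c, S; have [_ [cq _]] := Dtq; split => //.
  + exact: DS.
  + move=> s x [/= sa xr]; have Ox := SO _ xr; split => //.
    by rewrite /th (OE _ Ox).2; apply: (OE _ (Oph _ _)).1.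
  + move=> k; apply: (Ck_ext oS _ (sph k)) => -[s x]; rewrite inE => Ssx.
    have [_ /= xr] := Ssx; rewrite /th /= (OE _ (SO _ xr)).2.
    by rewrite (OE _ (Oph _ Ssx)).2.
move=> t q Dtq; set q' := th t q; set c' := chart_at q'.
have St := DS _ _ Dtq.
have [cq' pq'] := OE _ (Oph _ St); rewrite -/q' in cq' pq'.
have dg : is_derive t 1 (fun s => ph (s, phi c q)) (local_rep c X (ph (t, phi c q))).
  by apply/is_derive_time; exact: dph.
have dgd : differentiable (fun s => ph (s, phi c q)) t.
  by apply/derivable1_diffP; have [] := dg.
have dt : differentiable (phi c' \o psi c) (ph (t, phi c q)).
  by rewrite -pq'; apply: transition_diff => //; exact: dom_chart_at.
have dco := differentiable_comp dgd dt.
apply: DeriveDef; first exact: (@diff_derivable _ _ _ _ _ (1 : R) dco).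
rewrite (@deriveE R R _ _ _ 1 dco) (diff_comp dgd dt) /= -(@deriveE R R _ _ _ 1 dgd).
have [_ ->] := dg.
by rewrite -pq' local_repE // -coord_change // ?coord_chart_at //; exact: dom_chart_at.
Qed.

End ExistsFlow.

(** * Derivatives of the metric along a flow *)

Section AlongFlow.
Context {R : realType} {n : nat} {M : manifold R n.+1} (g : lorentz_metric M).
Variables (X : M -> 'rV[R]_n.+2) (D : set (R * M)) (th : R -> M -> M).
Hypothesis sX : smooth_field setT X.
Hypothesis flow : is_flow X D th.
Implicit Types (p q : M) (v w : 'rV[R]_n.+2).

Lemma near_flow_domain t p : D (t, p) -> \forall s \near t, D (s, p).
Proof.
move=> Dtp; have [oD _ _ _ _] := flow.
have c : {for t, continuous (fun s : R => (s, p))}.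
  by apply: continuous_pair; [exact: cvg_id|exact: cst_continuous].
by apply: c; exact: open_nbhs_nbhs.
Qed.

(** Since [D] is open, [th 0] is the identity near [p] and not just at [p]. *)
Lemma tangent_map0 p v : D (0, p) -> th 0 p = p /\ tangent_map (th 0) p v = v.
Proof.
move=> D0; have [oD _ th0 _ _] := flow.
have p0 := th0 p D0; split => //.
rewrite /tangent_map p0; set i := chart_at p; have ip : dom i p := dom_chart_at p.
have c : {for p, continuous (fun q : M => (0 : R, q))}.
  by apply: continuous_pair; [exact: cst_continuous|exact: cvg_id].
have nD : \forall q \near p, D (0, q) by apply: c; exact: open_nbhs_nbhs.
have np : \forall x \near phi i p, D (0, psi i x).
  have ic : (phi i @` dom i) (phi i p) by exists p.
  have := psi_continuous ic; rewrite /prop_for /continuous_at phiK // => ci.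
  exact: ci nD.
have E : \forall x \near phi i p, (phi i \o psi i) x = (phi i \o th 0 \o psi i) x.
  by apply: filterS np => x /th0 /= ->.
have [_ ->] := near_eq_diff E (transition_diff ip ip).
exact: transition_id.
Qed.

Let rep (T : M -> 'rV[R]_n.+2) q : local_rep (chart_at q) T (phi (chart_at q) q) = T q.
Proof. by rewrite local_repE ?coord_chart_at //; exact: dom_chart_at. Qed.

Let gE q v w : chart_metric g (chart_at q) (phi (chart_at q) q) v w = g q v w.
Proof. by rewrite [RHS](chart_metricE _ _ _ (dom_chart_at q)) !coord_chart_at. Qed.

Let near_chart_flow t p : D (t, p) ->
  \forall s \near t, D (s, p) /\ dom (chart_at (th t p)) (th s p).
Proof.
move=> Dtp; apply: filterI; first exact: near_flow_domain.
apply: (flow_continuous_time flow Dtp); apply: open_nbhs_nbhs; split; first exact: open_dom.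
exact: dom_chart_at.
Qed.

(** In the chart at [th t p], the transported vectors have the derivatives of [X] in their own
    directions as time derivatives; the product rule then yields the three terms of [lie_at]. *)
Lemma flow_metric t p v w : D (t, p) ->
  is_derive t 1 (fun s => g (th s p) (tangent_map (th s) p v) (tangent_map (th s) p w))
   (lie_at g X (th t p) (tangent_map (th t) p v) (tangent_map (th t) p w)).
Proof.
move=> Dtp; set q := th t p; set j := chart_at q; have jq : dom j q := dom_chart_at q.
set i := chart_at p; set x0 := phi i p; have ip : dom i p := dom_chart_at p.
have [dc dv] := flow_jacobi sX flow v Dtp jq.
have [_ dw] := flow_jacobi sX flow w Dtp jq.
pose c s := flow_rep th i j (s, x0).
pose V z s := 'D_(0, z) (flow_rep th i j) (s, x0).
have VE z : V z t = tangent_map (th t) p z by rewrite /V -(coord_tangent_map flow _ Dtp jq) coord_chart_at.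
have cs s : c s = phi j (th s p) by rewrite /c /flow_rep /= phiK.
have cE : c t = phi j q by exact: cs.
have cD : 'D_1 c t = local_rep j X (phi j q) by have [_] := dc.
have dif (W : normedModType R) (f : R -> W) e : is_derive t 1 f e -> differentiable f t.
  by move=> [df _]; exact/derivable1_diffP.
have dh a b : differentiable (fun x => chart_metric g j x a b) (c t).
  by rewrite cE; exact: chart_metric_diff.
have := @is_derive_bilinear _ _ _ (chart_metric g j) (@chart_metric_linear _ _ _ g j)
  (@chart_metric_sym _ _ _ g j) c (V v) (V w) t 1 dh (dif _ _ _ dc) (dif _ _ _ dv) (dif _ _ _ dw).
have vD : 'D_1 (V v) t = 'D_(coord j q (tangent_map (th t) p v)) (local_rep j X) (phi j q).
  by have [_] := dv.
have wD : 'D_1 (V w) t = 'D_(coord j q (tangent_map (th t) p w)) (local_rep j X) (phi j q).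
  by have [_] := dw.
rewrite cD vD wD.
rewrite !VE cE !coord_chart_at rep !gE; apply: near_eq_is_derive.
apply: filterS (near_chart_flow Dtp) => s [Ds js].
rewrite [RHS](chart_metricE _ _ _ js) cs.
by rewrite (coord_tangent_map flow v Ds js) (coord_tangent_map flow w Ds js).
Qed.

(** Here the second argument varies by the derivative of [Y] along [X]; adding and subtracting the
    derivative of [X] along [Y] splits this into [lie_at] and the bracket. *)
Lemma flow_field_metric U Y t p v : open U -> smooth_field U Y -> D (t, p) -> U (th t p) ->
  is_derive t 1 (fun s => g (th s p) (tangent_map (th s) p v) (Y (th s p)))
   (lie_at g X (th t p) (tangent_map (th t) p v) (Y (th t p)) +
    g (th t p) (tangent_map (th t) p v) (bracket X Y (th t p))).
Proof.
move=> oU sY Dtp Uq; set q := th t p; set j := chart_at q; have jq : dom j q := dom_chart_at q.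
set i := chart_at p; set x0 := phi i p; have ip : dom i p := dom_chart_at p.
have [dc dv] := flow_jacobi sX flow v Dtp jq.
pose c s := flow_rep th i j (s, x0).
pose V s := 'D_(0, v) (flow_rep th i j) (s, x0).
have VE : V t = tangent_map (th t) p v by rewrite /V -(coord_tangent_map flow _ Dtp jq) coord_chart_at.
have cs s : c s = phi j (th s p) by rewrite /c /flow_rep /= phiK.
have cE : c t = phi j q by exact: cs.
have cD : 'D_1 c t = local_rep j X (phi j q) by have [_] := dc.
have dif (W : normedModType R) (f : R -> W) e : is_derive t 1 f e -> differentiable f t.
  by move=> [df _]; exact/derivable1_diffP.
have dh a b : differentiable (fun x => chart_metric g j x a b) (c t).
  by rewrite cE; exact: chart_metric_diff.
have dY : differentiable (local_rep j Y) (c t).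
  by rewrite cE; exact: smooth_field_diff sY Uq jq.
have dYc := differentiable_comp (dif _ _ _ dc) dY.
have := @is_derive_bilinear _ _ _ (chart_metric g j) (@chart_metric_linear _ _ _ g j)
  (@chart_metric_sym _ _ _ g j) c V (local_rep j Y \o c) t 1 dh (dif _ _ _ dc) (dif _ _ _ dv) dYc.
have -> : 'D_1 (local_rep j Y \o c) t = 'D_(X q) (local_rep j Y) (phi j q).
  rewrite (@deriveE R R _ _ _ 1 dYc) (diff_comp (dif _ _ _ dc) dY) /=.
  rewrite -(@deriveE R R _ _ _ 1 (dif _ _ _ dc)) -(deriveE _ dY) cE.
  by rewrite cD rep.
have vD : 'D_1 V t = 'D_(coord j q (tangent_map (th t) p v)) (local_rep j X) (phi j q).
  by have [_] := dv.
rewrite cD vD.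
rewrite VE /= cE !coord_chart_at !rep !gE => H.
have -> : lie_at g X q (tangent_map (th t) p v) (Y q) +
    g q (tangent_map (th t) p v) (bracket X Y q) =
  'D_(X q) (fun x => chart_metric g j x (tangent_map (th t) p v) (Y q)) (phi j q)
  + g q ('D_(tangent_map (th t) p v) (local_rep j X) (phi j q)) (Y q)
  + g q (tangent_map (th t) p v) ('D_(X q) (local_rep j Y) (phi j q)).
  rewrite /lie_at /bracket (hBr (metric_linear g) q) -/j.
  have aux (e a b b' : R) : e + a + b + (b' - b) = e + a + b' by ring.
  exact: aux.
apply: near_eq_is_derive H.
apply: filterS (near_chart_flow Dtp) => s [Ds js].
rewrite [RHS](chart_metricE _ _ _ js) /= cs.
by rewrite (coord_tangent_map flow v Ds js) (local_repE _ js).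
Qed.

End AlongFlow.

(** * Propagation of adapted frames *)

(** The coefficient [f] will come from a pointwise choice, with no continuity known. In a fixed
    chart [|f| * |K|] is the norm of the bracket, which is continuous, and [|K|] is bounded below
    near [q0]. *)
Lemma bracket_coefficient_bounded (R : realType) (d : nat) (M : manifold R d)
    (X K : M -> 'rV[R]_d.+1) (f : M -> R) U q0 :
  open U -> U q0 -> smooth_field U X -> smooth_field U K ->
  (forall q, U q -> K q != 0) -> (forall q, U q -> bracket X K q = f q *: K q) ->
  exists2 C, 0 <= C & \forall q \near q0, `|f q| <= C.
Proof.
move=> oU Uq0 sX sK K0 fK; set j := chart_at q0; set x0 := phi j q0.
have jq0 : dom j q0 := dom_chart_at q0.
pose O := phi j @` (U `&` dom j); have oO : open O by exact: open_phi.
have Ox0 : O x0 by exists q0.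
(* The direction moves with the point, while smoothness controls derivatives in fixed directions,
   hence the expansion in partial derivatives. *)
pose dirs (A B : M -> 'rV[R]_d.+1) x :=
  \sum_(a < d.+1) local_rep j A x 0 a *: 'D_(delta_mx 0 a) (local_rep j B) x.
have cdirs A B : smooth_field U A -> smooth_field U B -> {for x0, continuous (dirs A B)}.
  move=> sA sB; apply: continuous_sum => a; apply: continuous_scale; last first.
    exact: (sB j 1%N).2 _ _ Ox0.
  apply: (@continuous_comp _ _ _ (local_rep j A) (fun N : 'rV[R]_d.+1 => N 0 a)).
    exact: (sA j 0%N) _ Ox0.
  exact: coord_continuous.
pose be x := dirs X K x - dirs K X x.
have cbe : {for x0, continuous (fun x => `|be x|)}.
  apply: (@continuous_comp _ _ _ be); last exact: norm_continuous.
  by apply: continuousB; exact: cdirs.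
have cka : {for x0, continuous (fun x => `|local_rep j K x|)}.
  apply: (@continuous_comp _ _ _ (local_rep j K)); last exact: norm_continuous.
  exact: (sK j 0%N) _ Ox0.
have bE q : U q -> dom j q -> f q *: local_rep j K (phi j q) = be (phi j q).
  move=> Uq jq.
  rewrite (local_repE _ jq) /coord -linearZ -fK // -/(coord j q _).
  rewrite (bracket_chart oU sX sK Uq jq) -!(local_repE _ jq).
  have dK := smooth_field_diff sK Uq jq; have dX := smooth_field_diff sX Uq jq.
  have E1 : 'D_(local_rep j X (phi j q)) (local_rep j K) (phi j q) = dirs X K (phi j q).
    exact: etrans (deriveE _ dK) (diff_delta _ dK).
  have E2 : 'D_(local_rep j K (phi j q)) (local_rep j X) (phi j q) = dirs K X (phi j q).
    exact: etrans (deriveE _ dX) (diff_delta _ dX).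
  by rewrite E1 E2.
have m0 : 0 < `|local_rep j K x0|.
  by rewrite normr_gt0 local_repE // coord_chart_at K0.
set m := `|local_rep j K x0| in m0 *.
have cphi : {for q0, continuous (phi j)} by exact: phi_continuous.
have n1 : \forall q \near q0, m / 2 < `|local_rep j K (phi j q)|.
  have c : {for q0, continuous (fun q => `|local_rep j K (phi j q)|)}.
    exact: (@continuous_comp _ _ _ (phi j) (fun x => `|local_rep j K x|)).
  by apply: (cvgr_gt _ c); rewrite -/x0 -/m; lra.
have n2 : \forall q \near q0, `|be (phi j q)| < `|be x0| + 1.
  have c : {for q0, continuous (fun q => `|be (phi j q)|)}.
    exact: (@continuous_comp _ _ _ (phi j) (fun x => `|be x|)).
  by apply: (cvgr_lt _ c); rewrite ltrDl.
have nU : \forall q \near q0, U q by exact: open_nbhs_nbhs.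
have nj : \forall q \near q0, dom j q by apply: open_nbhs_nbhs; split => //; exact: open_dom.
exists (2 * (`|be x0| + 1) / m); first by apply: divr_ge0; [apply: mulr_ge0 => //; exact: addr_ge0|exact: ltW].
apply: filterS3 nU nj (filterI n1 n2) => q Uq jq [h1 h2].
rewrite ler_pdivlMr //.
have := congr1 (fun v => `|v|) (bE q Uq jq); rewrite normrZ => E.
have h3 : `|f q| * (m / 2) <= `|be x0| + 1.
  have h4 : `|f q| * (m / 2) <= `|f q| * `|local_rep j K (phi j q)|.
    by apply: ler_wpM2l => //; exact: ltW.
  apply: le_trans h4 _; rewrite E; exact: ltW.
move: h3 => {h1 h2 E}; move: `|f q| (`|be x0| + 1) => x y h3.
by move: h3; lra.
Qed.

(** * The null line, its orthogonal complement and adapted frames *)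

Section Frames.
Context {R : realType} {n : nat} {M : manifold R n.+1}.
Variables (g : lorentz_metric M) (lam : null_distribution g).
Implicit Types (p q : M) (v w : 'rV[R]_n.+2) (u : 'M[R]_n.+2).

Let gZr := hZr (metric_linear g).
Let gZl := hZl (metric_linear g) (Defs.metric_sym g).

Lemma null_distributionZ q c v : lam q v -> lam q (c *: v).
Proof.
have [K _ ->] := null_line lam q.
by move=> [c' _ <-]; exists (c * c') => //; rewrite scalerA.
Qed.

Lemma perp_line q K w : K != 0 -> lam q = [set c *: K | c in setT] ->
  perp g lam q w <-> g q K w = 0.
Proof.
move=> K0 lamE; split=> [pw|Kw v].
  by apply: pw; rewrite lamE; exists 1 => //; rewrite scale1r.
by rewrite lamE => -[c _ <-]; rewrite gZl Kw mulr0.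
Qed.

Lemma null_perp q v : lam q v -> perp g lam q v.
Proof.
have [K K0 lamE] := null_line lam q; rewrite (perp_line _ K0 lamE) lamE => -[c _ <-].
rewrite gZr; have -> : g q K K = 0; last by rewrite mulr0.
by apply: (@nulld_null _ _ _ g lam); rewrite lamE; exists 1 => //; rewrite scale1r.
Qed.

Lemma perp_null q w : perp g lam q w -> g q w w = 0 -> lam q w.
Proof.
have [K K0 lamE] := null_line lam q; rewrite (perp_line _ K0 lamE) => Kw ww.
have KK : g q K K = 0.
  by apply: (@nulld_null _ _ _ g lam); rewrite lamE; exists 1 => //; rewrite scale1r.
apply: contrapT => nw; have : 0 < g q w w.
  apply: (lorentz_null_pos K0 KK Kw) => c wc; apply: nw.
  by rewrite lamE wc; exists c.
by rewrite ww ltxx.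
Qed.

(** Testing against [lam] itself puts [v] in the complement; testing then against [v] makes it
    null. *)
Lemma perp_perp q v : (forall w, perp g lam q w -> g q w v = 0) -> lam q v.
Proof.
move=> H; have [K K0 lamE] := null_line lam q.
have pv : perp g lam q v.
  rewrite (perp_line _ K0 lamE); apply: H; apply: null_perp.
  by rewrite lamE; exists 1 => //; rewrite scale1r.
by apply: perp_null => //; exact: H.
Qed.

Lemma null_frameP q u v : adapted_frames lam q u -> lam q v ->
  exists c, v = c *: (vec_k *m u).
Proof.
move=> /adaptedP[uu lk vw kw]; have [K K0 lamE] := null_line lam q.
move: lk; rewrite lamE => -[c0 _ c0K] [c _ <-].
have c00 : c0 != 0.
  apply/eqP => c00; have := kw (delta_mx 0 idx_l); rewrite -c0K c00 scale0r.
  rewrite Defs.metric_sym (h0r (metric_linear g)) mxE !eqxx.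
  by move/eqP; rewrite eq_sym oner_eq0.
by exists (c / c0); rewrite -c0K scalerA divfK.
Qed.

Lemma perp_frameP q u v : adapted_frames lam q u ->
  perp g lam q (v *m u) <-> v 0 idx_l = 0.
Proof.
move=> au; have /adaptedP[uu lk vw kw] := au; split=> [pv|vl x lx].
  by rewrite -kw; exact: pv.
by have [c ->] := null_frameP au lx; rewrite gZl kw vl mulr0.
Qed.

Lemma smooth_field_frame U (s : M -> 'M[R]_n.+2) v : open U ->
  (forall a, smooth_field U (fun q => row a (s q))) ->
  smooth_field U (fun q => v *m s q).
Proof.
move=> oU ss i k; have oO := open_phi (i := i) oU.
have H a := Ck_scale (v 0 a) oO (ss a i k).
apply: (Ck_ext oO _ (Ck_sum (index_enum _) oO H)) => x _.
rewrite /local_rep mulmx_sum_row /coord linear_sum.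
by apply: eq_bigr => a _; rewrite linearZ.
Qed.

(** The extension has constant coefficients in a local adapted frame. Lying in [lam] or in its
    complement depends on these coefficients alone, so it passes from [q] to all of [U]. *)
Lemma extend_vector q v : exists U Y, [/\ open U, U q, smooth_field U Y, Y q = v &
  (lam q v -> forall r, U r -> lam r (Y r)) /\
  (perp g lam q v -> forall r, U r -> perp g lam r (Y r))].
Proof.
have [U [s [oU Uq su ss]]] := adapted_section lam q.
have [uq _ _ _ _] := su q Uq.
have vE : v = (v *m invmx (s q)) *m s q by rewrite mulmxKV.
exists U, (fun r => (v *m invmx (s q)) *m s r); split => //.
  exact: smooth_field_frame.
split=> [lv r Ur|pv r Ur].
  have [c vc] := null_frameP (su q Uq) lv.
  have -> : v *m invmx (s q) = c *: vec_k by rewrite vc -scalemxAl mulmxK.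
  rewrite -scalemxAl; apply: null_distributionZ.
  by have /adaptedP[] := su r Ur.
by rewrite (perp_frameP _ (su r Ur)) -(perp_frameP _ (su q Uq)) -vE.
Qed.

Lemma lie_atC X q v w : lie_at g X q v w = lie_at g X q w v.
Proof.
rewrite /lie_at (Defs.metric_sym g q v) (Defs.metric_sym g q _ w) addrAC.
congr (_ + _ + _); congr ('D_(X q) _ _); apply/funext => x.
exact: chart_metric_sym.
Qed.

Section PointwiseLie.
Variable X : M -> 'rV[R]_n.+2.
Hypothesis sX : smooth_field setT X.

Lemma nil_killing_lie_at : nil_killing lam X -> forall q,
  (forall v w, lam q v -> lie_at g X q v w = 0) /\
  (forall v w, perp g lam q v -> perp g lam q w -> lie_at g X q v w = 0).
Proof.
move=> nk q.
have H v w : exists U Y Z, [/\ open U, U q, smooth_field U Y, smooth_field U Z &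
  [/\ lie_metric X g Y Z q = lie_at g X q v w,
    lam q v -> section_on lam U Y, perp g lam q v -> section_on (perp g lam) U Y &
    perp g lam q w -> section_on (perp g lam) U Z]].
  have [U1 [Y [oU1 U1q sY Yq [lY pY]]]] := extend_vector q v.
  have [U2 [Z [oU2 U2q sZ Zq [_ pZ]]]] := extend_vector q w.
  have oU : open (U1 `&` U2) by exact: openI.
  have sY' : smooth_field (U1 `&` U2) Y by apply: smooth_field_sub sY => r [].
  have sZ' : smooth_field (U1 `&` U2) Z by apply: smooth_field_sub sZ => r [].
  have sX' : smooth_field (U1 `&` U2) X by exact: smooth_field_sub sX.
  exists (U1 `&` U2), Y, Z; split => //; split.
  - by rewrite (lie_metricE g oU (conj U1q U2q) sX' sY' sZ') Yq Zq.
  - by move=> lv; split => // r [U1r _]; exact: lY.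
  - by move=> pv; split => // r [U1r _]; exact: pY.
  - by move=> pw; split => // r [_ U2r]; exact: pZ.
split=> v w.
  move=> lv; have [U [Y [Z [oU Uq sY sZ [<- lY _ _]]]]] := H v w.
  by apply: (nk U oU).1 => //; exact: lY.
move=> pv pw; have [U [Y [Z [oU Uq sY sZ [<- _ pY pZ]]]]] := H v w.
by apply: (nk U oU).2 => //; [exact: pY|exact: pZ].
Qed.

Lemma lie_at_nil_killing :
  (forall q v w, lam q v -> lie_at g X q v w = 0) ->
  (forall q v w, perp g lam q v -> perp g lam q w -> lie_at g X q v w = 0) ->
  nil_killing lam X.
Proof.
move=> H1 H2 U oU; have sXU : smooth_field U X by exact: smooth_field_sub sX.
split=> [Y Z [sY lY] sZ p Up|W W' [sW pW] [sW' pW'] p Up].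
  by rewrite (lie_metricE g oU Up sXU sY sZ); apply: H1; exact: lY.
by rewrite (lie_metricE g oU Up sXU sW sW'); apply: H2; [exact: pW|exact: pW'].
Qed.

End PointwiseLie.

Lemma push_frame_mul (f : M -> M) p v u :
  v *m push_frame f p u = tangent_map f p (v *m u).
Proof.
rewrite !mulmx_sum_row /tangent_map linear_sum; apply: eq_bigr => a _.
by rewrite linearZ rowK.
Qed.

Lemma row_push_frame (f : M -> M) p u a :
  row a (push_frame f p u) = tangent_map f p (row a u).
Proof. by rewrite rowK. Qed.

Section Flow.
Variables (X : M -> 'rV[R]_n.+2) (D : set (R * M)) (th : R -> M -> M).
Hypothesis sX : smooth_field setT X.
Hypothesis flow : is_flow X D th.

(* While a null vector stays null and orthogonal to [lam] it stays in [lam], so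
   it suffices to propagate [perp lam] and then the values of the metric. *)
Lemma flow_adapted_near p u t0 : alg_nil_killing lam X -> D (t0, p) ->
  exists2 e : R, 0 < e & forall s1 s2 : R, `|s1 - t0| < e -> `|s2 - t0| < e ->
    adapted_frames lam (th s1 p) (push_frame (th s1) p u) ->
    adapted_frames lam (th s2 p) (push_frame (th s2) p u).
Proof.
move=> [_ nk ap] Dt0; set q0 := th t0 p.
have lie0 := nil_killing_lie_at sX nk.
have [U [K [oU Uq0 sK KE]]] := nulld_line lam q0.
have sXU : smooth_field U X by exact: smooth_field_sub sX.
have lK q : U q -> lam q (K q).
  by move=> /KE[_ ->]; exists 1 => //; rewrite scale1r.
have /choice[f fK] : forall q, exists c, U q -> bracket X K q = c *: K q.
  move=> q; have [Uq|nU] := pselect (U q); last by exists 0.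
  have := ap U K oU (conj sK lK) q Uq; rewrite (KE q Uq).2 => -[c _ cK].
  by exists c.
have [C C0 fC] := bracket_coefficient_bounded oU Uq0 sXU sK (fun q Uq => (KE q Uq).1) fK.
have n1 : \forall s \near t0, U (th s p) /\ `|f (th s p)| <= C.
  have nU : \forall q \near q0, U q by exact: open_nbhs_nbhs.
  have fc := flow_continuous_time flow Dt0.
  have [F1 F2] := (fc _ nU, fc _ fC).
  exact: filterI F1 F2.
have [e1 e10 He1] := (nearP _ _).1 (filterI (near_flow_domain flow Dt0) n1).
(* Two times within [e] of [t0] are less than [2 * e] apart, and [2 * e * C <= 2^-1] is the
   shortness condition; the summand 1 is there because [C] may be 0. *)
pose e := Num.min e1 (4 * (C + 1))^-1.
have C1 : 0 < C + 1 by rewrite ltr_wpDl.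
have e0 : 0 < e by rewrite lt_min e10 invr_gt0 mulr_gt0.
have eC : 2 * e * C <= 2^-1.
  have : e <= (4 * (C + 1))^-1 by rewrite ge_min lexx orbT.
  rewrite -[X in _ <= X]mul1r ler_pdivlMr ?mulr_gt0 //.
  by have := mulr_ge0 (ltW e0) C0; move: e0; lra.
exists e; first exact: e0.
move=> s1 s2 s1e s2e.
have He (s : R) : `|s - t0| < e -> [/\ D (s, p), U (th s p) & `|f (th s p)| <= C].
  move=> se; have [|Ds [Us fs]] := He1 s; last by split.
  by apply: lt_le_trans se _; rewrite ge_min lexx.
(* The equations are solved from [s1] on the interval between the two times, in either direction;
   [t0] may lie outside it. *)
pose a := Num.min s1 s2; pose b := Num.max s1 s2.
have s1ab : a <= s1 <= b by rewrite ge_min le_max !lexx.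
have s2ab : a <= s2 <= b by rewrite ge_min le_max !lexx !orbT.
have ae : `|a - t0| < e by rewrite /a minEle; case: ifP.
have bet : `|b - t0| < e by rewrite /b maxEle; case: ifP.
have abe (s : R) : a <= s <= b -> `|s - t0| < e.
  by move: ae bet; rewrite !ltr_norml => /andP[? ?] /andP[? ?] /andP[? ?]; apply/andP; split; lra.
have abC : (b - a) * C <= 2^-1.
  apply: le_trans eC; rewrite ler_wpM2r //.
  by move: ae bet; rewrite !ltr_norml => /andP[? ?] /andP[? ?]; lra.
pose T s v := tangent_map (th s) p v.
have pK (s : R) v : a <= s <= b -> perp g lam (th s p) (T s v) <-> g (th s p) (T s v) (K (th s p)) = 0.
  move=> /abe/He[_ Us _]; rewrite Defs.metric_sym.
  exact: perp_line (KE _ Us).1 (KE _ Us).2.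
have perpT v : perp g lam (th s1 p) (T s1 v) -> forall s : R, a <= s <= b ->
    perp g lam (th s p) (T s v).
  rewrite (pK _ _ s1ab) => v1 s sab; rewrite (pK _ _ sab).
  apply: (@scalar_zero_ode R (fun s => g (th s p) (T s v) (K (th s p))) a b s1 C) => //.
  move=> r rab; have [Dr Ur fr] := He r (abe r rab).
  have [d1 d2] := flow_field_metric g sX flow v oU sK Dr Ur.
  split; first exact: d1.
  rewrite d2 lie_atC (lie0 _).1 ?add0r; last exact: lK.
  by rewrite fK // gZr normrM ler_wpM2r.
have cstT v w : (forall s : R, a <= s <= b -> lie_at g X (th s p) (T s v) (T s w) = 0) ->
    forall s : R, a <= s <= b -> g (th s p) (T s v) (T s w) = g (th s1 p) (T s1 v) (T s1 w).
  move=> L0 s sab; pose G (s : R) := g (th s p) (T s v) (T s w).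
  apply/eqP; rewrite -subr_eq0; apply/eqP.
  (* A zero derivative satisfies the estimate with any nonnegative constant; [C] is the one for
     which the interval is known to be short. *)
  apply: (@scalar_zero_ode R (fun s => G s - G s1) a b s1 C) => //; first by rewrite subrr.
  move=> r rab; have [Dr _ _] := He r (abe r rab).
  have dG := flow_metric g sX flow v w Dr; rewrite (L0 r rab) in dG.
  have [d1 d2] := @is_deriveB _ _ _ G (cst (G s1)) r 1 _ _ dG (is_derive_cst (G s1) r 1).
  split; first exact: d1.
  by have -> : 'D_1 (fun s => G s - G s1) r = 0 - 0 := d2; rewrite subrr normr0 mulr_ge0.
have lamT v : lam (th s1 p) (T s1 v) -> forall s : R, a <= s <= b -> lam (th s p) (T s v).
  move=> l1; have p1 := perpT v (null_perp l1).
  have nul (s : R) : a <= s <= b -> g (th s p) (T s v) (T s v) = 0.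
    move=> sab; rewrite (cstT _ _ _ s sab); first exact: (@nulld_null _ _ _ g lam) l1.
    by move=> r rab; apply: (lie0 _).2; exact: p1.
  by move=> s sab; apply: perp_null; [exact: p1|exact: nul].
move=> [uu lk lm kl mm]; rewrite !row_push_frame in lk kl.
have lk2 := lamT _ lk.
have pm c : perp g lam (th s1 p) (T s1 (row (idx_m c) u)).
  by have := lm c; rewrite row_push_frame.
have kl2 : g (th s2 p) (row idx_k (push_frame (th s2) p u))
    (row idx_l (push_frame (th s2) p u)) = 1.
  rewrite !row_push_frame -kl; apply: cstT s2ab => s sab.
  by apply: (lie0 _).1; exact: lk2.
have rT s c : row c (push_frame (th s) p u) = T s (row c u) by exact: row_push_frame.
have mm2 c c' : g (th s2 p) (row (idx_m c) (push_frame (th s2) p u))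
    (row (idx_m c') (push_frame (th s2) p u)) = (c == c')%:R.
  have E := mm c c'; rewrite (rT s1 (idx_m c)) (rT s1 (idx_m c')) in E.
  rewrite (rT s2 (idx_m c)) (rT s2 (idx_m c')).
  apply: etrans E; apply: cstT s2ab => s sab.
  by apply: (lie0 _).2; apply: perpT sab; exact: pm.
have lk3 : lam (th s2 p) (row idx_k (push_frame (th s2) p u)).
  by rewrite row_push_frame; exact: lk2.
have lm2 c : perp g lam (th s2 p) (row (idx_m c) (push_frame (th s2) p u)).
  by rewrite row_push_frame; exact: perpT (pm c) s2 s2ab.
have [vw kw] := adapted_pair lk3 lm2 kl2 mm2.
split; [exact: pair_unit vw kw|exact: lk3|exact: lm2|exact: kl2|exact: mm2].
Qed.

End Flow.
End Frames.

(** * The two inclusions *)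

Section Main.
Context {R : realType} {n : nat} {M : manifold R n.+1}.
Variables (g : lorentz_metric M) (lam : null_distribution g).
Implicit Types (p q : M) (v w : 'rV[R]_n.+2) (X : M -> 'rV[R]_n.+2).

Lemma alg_nil_killing_aut X : alg_nil_killing lam X -> aut (adapted_structure lam) X.
Proof.
move=> aX; have [sX _ _] := aX; split=> // D th flow t p u Dtp Pu.
have [_ Dint _ _ _] := flow.
have D0 : D (0, p).
  by apply: (Dint t) => //; have [t0|/ltW t0] := leP 0 t; [left|right]; rewrite lexx ?t0.
pose P (s : R) := adapted_frames lam (th s p) (push_frame (th s) p u).
suff : P t by [].
apply: segment_ind => [|s st].
  have uE : push_frame (th 0) p u = u.
    by apply/row_matrixP => a; rewrite row_push_frame; have [_ ->] := tangent_map0 flow (row a u) D0.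
  by rewrite /P uE; have [-> _] := tangent_map0 flow 0 D0.
have Ds : D (s, p) by apply: Dint Dtp _; exact: st.
have [e e0 H] := flow_adapted_near sX flow u aX Ds.
by exists e.
Qed.

Lemma aut_alg_nil_killing X : aut (adapted_structure lam) X -> alg_nil_killing lam X.
Proof.
move=> [sX aX].
have gZl := hZl (metric_linear g) (Defs.metric_sym g).
(* One flow through [p] and one frame [u], still adapted at all times near 0: its constant products
   serve the three verifications below. *)
have lie_flow p : exists D th u, [/\ is_flow X D th, D (0, p), adapted_frames lam p u &
    \forall t \near (0 : R), D (t, p) /\ adapted_frames lam (th t p) (push_frame (th t) p u)].
  have [D [th [flow D0]]] := exists_flow sX p.
  have [U [s [_ Up su _]]] := adapted_section lam p.
  exists D, th, (s p); split => //; first exact: su.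
  apply: filterS (near_flow_domain flow D0) => t Dt; split => //.
  exact: (aX D th flow t p (s p) Dt (su p Up)).
have lie1 p v w : lam p v -> lie_at g X p v w = 0.
  have [D [th [u [flow D0 au Fu]]]] := lie_flow p; move=> lv.
  have [uu _ _ _ _] := au.
  have [c vE] := null_frameP au lv.
  pose w' := w *m invmx u; have wE : w = w' *m u by rewrite mulmxKV.
  have dG := flow_metric g sX flow v w D0.
  have [thp tv] := tangent_map0 flow v D0; have [_ tw] := tangent_map0 flow w D0.
  (* In any adapted frame the product of [c *: vec_k] with [w'] is [c] times the [l]-coefficient of
     [w']. *)
  rewrite thp tv tw in dG; apply: (is_derive_near_cst (c := c * w' 0 idx_l) _ dG).
  apply: filterS Fu => t [_ /adaptedP[_ _ _ kw]].
  by rewrite vE scalemxAl wE -!push_frame_mul -scalemxAl gZl kw.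
have lie2 p v w : perp g lam p v -> perp g lam p w -> lie_at g X p v w = 0.
  have [D [th [u [flow D0 au Fu]]]] := lie_flow p; move=> pv pw.
  have [uu _ _ _ _] := au.
  pose v' := v *m invmx u; have vE : v = v' *m u by rewrite mulmxKV.
  pose w' := w *m invmx u; have wE : w = w' *m u by rewrite mulmxKV.
  have v0 : v' 0 idx_l = 0 by apply/(perp_frameP _ au); rewrite -vE.
  have w0 : w' 0 idx_l = 0 by apply/(perp_frameP _ au); rewrite -wE.
  have dG := flow_metric g sX flow v w D0.
  have [thp tv] := tangent_map0 flow v D0; have [_ tw] := tangent_map0 flow w D0.
  (* On coefficient rows without [l]-component, every adapted frame carries the metric to [eta]. *)
  rewrite thp tv tw in dG; apply: (is_derive_near_cst (c := Defs.eta v' w') _ dG).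
  apply: filterS Fu => t [_ /adaptedP[_ _ vw _]].
  by rewrite vE wE -!push_frame_mul vw.
split => //; first exact: lie_at_nil_killing.
move=> U Y oU [sY lY] p Up; apply: perp_perp => w pw.
have [D [th [u [flow D0 au Fu]]]] := lie_flow p.
have [uu _ _ _ _] := au.
have wE : w = (w *m invmx u) *m u by rewrite mulmxKV.
have w0 : (w *m invmx u) 0 idx_l = 0 by apply/(perp_frameP _ au); rewrite -wE.
have [thp tw] := tangent_map0 flow w D0.
have Up' : U (th 0 p) by rewrite thp.
have := flow_field_metric g sX flow w oU sY D0 Up'.
rewrite thp tw lie_atC (lie1 _ _ _ (lY p Up)) add0r => dG.
(* The transported [w] stays orthogonal to [lam], which contains [Y], so the product vanishes near
   time 0; by [lie1] its derivative there is the product of [w] with the bracket. *)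
apply: (is_derive_near_cst (c := 0) _ dG).
have nU : \forall q \near th 0 p, U q by exact: open_nbhs_nbhs.
have fc := flow_continuous_time flow D0.
have nUt : \forall t \near (0 : R), U (th t p) by exact: (fc _ nU).
apply: filterS2 nUt Fu => t Ut [_ at_].
rewrite Defs.metric_sym; have : perp g lam (th t p) (tangent_map (th t) p w).
  by rewrite wE -push_frame_mul; apply/(perp_frameP _ at_).
by apply; exact: lY.
Qed.

End Main.

(* n is dim M - 2. *)
Theorem corollary1 (R : realType) (n : nat) (M : manifold R n.+1)
  (g : lorentz_metric M) (lam : null_distribution g) :
  alg_nil_killing lam = aut (adapted_structure lam).
Proof.
by apply/seteqP; split=> X; [exact: alg_nil_killing_aut|exact: aut_alg_nil_killing].
Qed.
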